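(* Let $\lambda\in(0,1)$ and let $(\epsilon_n)_{n>0}$ be a sequence of nonnegative reals defined via the inductive procedure described in the context (performed with this $\lambda$). Put $\epsilon_n=0$ for $n\le 0$, and let $\mu=\bigotimes_{n\in\mathbb Z}\mu_n$ on $X=\{0,1\}^{\mathbb Z}$, where $$\mu_n(0)=\frac1{1+\lambda e^{\epsilon_n}},\qquad \mu_n(1)=\frac{\lambda e^{\epsilon_n}}{1+\lambda e^{\epsilon_n}},\qquad n\in\mathbb Z.$$ Then the two-sided shift $T$ on $(X,\mu)$ is $\mu$-nonsingular, $\mu$-conservative and of type $III_1$.
   Context: Notation: $(Tx)_n=x_{n+1}$. For $n>0$, $\mathcal A_n$ is the set of cylinders $\{x\in X: x_i=a_i,\ -n\le i\le n\}$ with $a_{-n},\dots,a_n\in\{0,1\}$. Inductive procedure. Fix a sequence $(\eta_n)_{n\ge1}$ of positive reals such that $\eta_n\to0$ as $n\to\infty$. Start with $L_0=1$ and $\epsilon_1=0$ (so $\mu_1(0)=1/(1+\lambda)$). Suppose $\epsilon_1,\dots,\epsilon_{L_{n-1}}$ (hence $\mu_i$ for $i\le L_{n-1}$) are already defined. Put $\mu^{(n)}=\bigotimes_{i\le L_{n-1}}\mu_i\otimes\bigotimes_{i>L_{n-1}}\mu_1$. This measure is equivalent to $\bigotimes_{i\in\mathbb Z}\mu_1$, so $T$ is $\mu^{(n)}$-nonsingular and $\mu^{(n)}$-conservative. Step 1: for each $A\in\mathcal A_{L_{n-1}}$ choose pairwise disjoint cylinders $B_1,\dots,B_m\subset A$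 and positive integers $p_1,\dots,p_m$ (all depending on $A$) such that $T^{p_i}B_i\subset A$ for each $i$, $T^{p_i}B_i\cap T^{p_j}B_j=\emptyset$ for $i\ne j$, and $\mu^{(n)}(\bigsqcup_iB_i)>0.9\,\mu^{(n)}(A)$. Define $\tau_A:\bigsqcup_{i=1}^mB_i\to A$ by $\tau_Ax=T^{p_i}x$ if $x\in B_i$. Then $\tau_A$ is one-to-one and $\frac{d\mu^{(n)}\circ\tau_A}{d\mu^{(n)}}(x)=1$ for all $x\in\bigsqcup_{i=1}^mB_i$. Choose $\ell_n>L_{n-1}$ so large that, for every $A\in\mathcal A_{L_{n-1}}$ and every $i$, the sets $B_i$ and $T^{p_i}B_i$ are unions of cylinders from $\mathcal A_{\ell_n}$; it follows that $p_i<\ell_n$ for each $i$. Put $\epsilon_j=0$ for $L_{n-1}<j\le\ell_n$. Step 2: choose an integer $L_n>2\ell_n$ and (nonnegative) reals $\epsilon_{\ell_n+1}\ge\cdots\ge\epsilon_{L_n}$ such that $$\sum_{j=\ell_n+1}^{2\ell_n}\epsilon_j<\eta_n,\qquad \sum_{j=\ell_n+1}^{L_n}(\epsilon_{j-1}-\epsilon_j)^2<\eta_n,\qquad \sum_{j=\ell_n+1}^{L_n}\epsilon_j^2>1.$$ Continue for $n=1,2,\dots$; this gives $\ell_1<L_1<\ell_2<L_2<\cdots$ and the sequence $(\epsilon_n)_{n\ge1}$. Terminology: an invertible $T$ is $\mu$-nonsingular if $\mu\circ T^{-1}\sim\mu$. It is $\mu$-conservative if for each $A$ with $\mu(A)>0$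 there is $n>0$ with $\mu(T^{-n}A\cap A)>0$. It is of type $III_1$ if its Maharam extension $(x,t)\mapsto(Tx,\frac{d\mu\circ T}{d\mu}(x)\,t)$ on $X\times\mathbb R^*_+$ (with $\mu$ times a measure equivalent to Lebesgue measure) is ergodic.
   Formalization: The formal theorem additionally assumes that the sum of the squares of the η_n converges; with only η_n→0 the procedure allows jumps ε_{ℓ_n+1}=η_n/2 whose squares sum to infinity (e.g. η_n=n^{-1/2}), and then T is not nonsingular. *)

(* Defs.v *)
From HB Require Import structures.
From mathcomp Require Import all_boot all_order all_algebra finmap.
From mathcomp Require Import all_classical all_reals all_analysis.
Set Implicit Arguments.
Unset Strict Implicit.
Unset Printing Implicit Defensive.
Import Order.TTheory GRing.Theory Num.Theory.
Import numFieldNormedType.Exports.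
Local Open Scope classical_set_scope.
Local Open Scope ring_scope.

(** * Nonsingular dynamics *)

Section dynamics.
Local Open Scope ereal_scope.
Context d (X : measurableType d) (R : realType).

Definition nonsingular (mu : set X -> \bar R) (T : X -> X) : Prop :=
  pushforward mu T `<< mu /\ mu `<< pushforward mu T.

Definition conservative (mu : set X -> \bar R) (T : X -> X) : Prop :=
  forall A, measurable A -> 0 < mu A ->
    exists n, (0 < n)%N /\ 0 < mu (iter n T @^-1` A `&` A).

Definition ergodic (mu : set X -> \bar R) (T : X -> X) : Prop :=
  forall E, measurable E -> T @^-1` E = E -> mu E = 0 \/ mu (~` E) = 0.

End dynamics.

Section maharam_extension.
Local Open Scope ereal_scope.
Context d (X : measurableType d) (R : realType).

(* An everywhere positive, finite version of d(mu o T)/d mu, where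
   (mu o T)(A) = mu (T A), for an invertible bimeasurable T. *)
Definition RN_version (mu : set X -> \bar R) (T : X -> X) (f : X -> R) : Prop :=
  [/\ measurable_fun setT f, (forall x, (0 < f x)%R) &
      forall A, measurable A -> mu (T @` A) = \int[mu]_(x in A) (f x)%:E].

Definition maharam (T : X -> X) (f : X -> R) (xt : X * R) : X * R :=
  (T xt.1, (f xt.1 * xt.2)%R).

(* The Maharam extension lives on X * ]0, +oo[, which [maharam T f] and its
   inverse preserve when f > 0; this is rendered by a measure on X * R that
   vanishes off X * ]0, +oo[. *)
Definition lebesgue_pos : set R -> \bar R :=
  mrestr (@lebesgue_measure R) (measurable_itv `]0%R, +oo[).

(* Two versions f differ only on a mu-null set, so for nonsingular T the choice
   of the version does not affect ergodicity. *)
Definition type_III1 (mu : set X -> \bar R) (T : X -> X) : Prop :=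
  exists f, RN_version mu T f /\ ergodic (mu \x lebesgue_pos) (maharam T f).

End maharam_extension.

(** * The two-sided shift space *)

Definition cylinder (F : {fset int}) (a : int -> bool) : set (int -> bool) :=
  [set x | forall i, i \in F -> x i = a i].

Definition cylinders : set (set (int -> bool)) :=
  [set A | exists F a, A = cylinder F a].

Definition shift_space := g_sigma_algebraType cylinders.

Definition bshift (x : shift_space) : shift_space := fun n => x (n + 1).

Definition central_cylinders (n : nat) : set (set shift_space) :=
  [set A | exists a : int -> bool,
    A = [set x | forall i : int, - n%:Z <= i <= n%:Z -> x i = a i]].

Definition union_of (G : set (set shift_space)) (B : set shift_space) : Prop :=
  exists2 H, H `<=` G & B = \bigcup_(C in H) C.

Section product_measures.
Context (R : realType).

(* This characterizes mu: the cylinders are stable under intersection (up to the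
   empty set) and generate the sigma-algebra. *)
Definition is_product_measure (q : int -> bool -> R)
    (mu : probability shift_space R) : Prop :=
  forall (F : {fset int}) (a : int -> bool),
    mu (cylinder F a) = (\prod_(i <- F) q i (a i))%:E.

Definition coord_law (lam e : R) (b : bool) : R :=
  if b then lam * expR e / (1 + lam * expR e) else 1 / (1 + lam * expR e).

End product_measures.

(** * The inductive procedure *)

Section procedure.
Context (R : realType).

(* The law of the i-th coordinate under mu^(n), with K = L_(n-1). *)
Definition stage_law (lam : R) (eps : int -> R) (K : nat) (i : int) :
    bool -> R :=
  if i <= K%:Z then coord_law lam (eps i) else coord_law lam (eps 1).

(* For a cylinder A, a partial self-map tau_A of A, piecewise a positive power
   of the shift, defined on more than 0.9 of A, and visible at scale l. *)
Definition good_partial_map (nu : probability shift_space R) (l : nat)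
    (A : set shift_space) : Prop :=
  exists m (B : 'I_m -> set shift_space) (p : 'I_m -> nat),
  [/\ forall i, [/\ cylinders (B i), B i `<=` A, (0 < p i)%N &
                    iter (p i) bshift @` B i `<=` A],
      trivIset setT B,
      trivIset setT (fun i => iter (p i) bshift @` B i),
      ((9 / 10)%:E * nu A < nu (\bigcup_i B i))%E &
      forall i, union_of (central_cylinders l) (B i) /\
                union_of (central_cylinders l) (iter (p i) bshift @` B i)].

(* K = L_(n-1) and l = l_n *)
Definition step1 (lam : R) (eps : int -> R) (K l : nat) : Prop :=
  [/\ (K < l)%N,
      exists2 nu : probability shift_space R,
        is_product_measure (stage_law lam eps K) nu &
        forall A, central_cylinders K A -> good_partial_map nu l A &
      forall j : nat, (K < j <= l)%N -> eps j%:Z = 0].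

(* l = l_n, M = L_n and e = eta_n *)
Definition step2 (e : R) (eps : int -> R) (l M : nat) : Prop :=
  [/\ (2 * l < M)%N,
      (forall j : nat, (l < j <= M)%N -> 0 <= eps j%:Z) /\
      (forall j : nat, (l < j < M)%N -> eps j.+1%:Z <= eps j%:Z),
      \sum_(l.+1 <= j < (2 * l).+1) eps j%:Z < e,
      \sum_(l.+1 <= j < M.+1) (eps (j%:Z - 1) - eps j%:Z) ^+ 2 < e &
      1 < \sum_(l.+1 <= j < M.+1) eps j%:Z ^+ 2].

(* Pitfall: eta_n --> 0 alone does not bound the sum over all j of
   (eps_(j-1) - eps_j)^2, hence does not make the shift nonsingular: the jumps
   eps_(l_n + 1) = eta_n / 2 are allowed. Square-summability of eta is exactly
   what excludes this; the theorem assumes it separately. *)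
Definition inductive_procedure (lam : R) (eta : nat -> R) (eps : int -> R)
    (L l : nat -> nat) : Prop :=
  [/\ L 0%N = 1%N, eps 1 = 0 &
      forall n, (0 < n)%N ->
        step1 lam eps (L n.-1) (l n) /\ step2 (eta n) eps (l n) (L n)].

End procedure.

(* Main.v *)
(* Write S for the Maharam extension and m for the product of mu with t^-2 dt on t > 0;
   S preserves m. A chi-square bound compares mu with mu o T^p as soon as the sum over j of
   (eps_(j-p) - eps_j)^2 is finite. Since eta is square-summable, p = 1 gives
   nonsingularity. At stage n, step 1 provides return times p on most of every central
   cylinder, along which d(mu o T^p)/d mu is close to 1. Hence for each a > 0 the
   set t > a of finite measure m is recurrent for S, and T is conservative.

   Let E be S-invariant. The flip of the coordinate k, with t multiplied by e^(eps_k) or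
   e^(-eps_k), preserves the m-class and commutes with S up to moving k far into the past,
   where eps = 0: the orbits of z and of its flip differ in ever earlier coordinates
   only. Approximating E by sets that do not see the past, Hopf's maximal inequality
   shows that E is invariant under all flips.

   Let H_b(x) be the mass of the fiber E_x above level b. Flipping the coordinate k
   dilates E_x by e^(eps_k), so a weighted sum of centred coordinate functions has
   variance of order sum eps_k^2, but would detect with a covariance of the same order any
   dependence on b of the integral of b H_b over a cylinder C. As sum eps_k^2 is infinite,
   this integral does not depend on b; the flips then show that it is gamma mu(C) with
   gamma constant. So m(E n A) = gamma m(A) for all A, which forces m(E) = 0 or
   m(complement of E) = 0. *)
From HB Require Import structures.
Require Import Defs.
From mathcomp Require Import all_boot all_order all_algebra finmap.
From mathcomp Require Import all_classical all_reals all_analysis measurable_realfun.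
From mathcomp Require Import ring lra zify.
Set Implicit Arguments.
Unset Strict Implicit.
Unset Printing Implicit Defensive.
Import Order.TTheory GRing.Theory Num.Theory.
Import numFieldNormedType.Exports.
Local Open Scope classical_set_scope.
Local Open Scope ring_scope.

(** * Approximation and resampling *)

(** The weight t^-2 dt is forced: S multiplies t by the density of mu o T, and a dilation by c must
    change the mass of a fiber by exactly the factor that the change of variables removes. It also
    gives the rays t > a the finite mass 1/a, so that S, which preserves only an infinite measure,
    can be studied through visits to a set of finite measure. Only null sets have to be carried back
    to Lebesgue measure.

    No limit of averages along orbits is taken: to compare a point with its flip it is enough to
    count visits, and the maximal inequality controls these counts.

    The obstacle in the last part is the precision of the expansion in eps_k. Put a_k = e^(eps_k) -
    1. An error of order a_k would be as large as the effect; one of order a_k^2 becomes a_k^3 once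
    weighted by a_k, and since eps_k tends to 0 it is negligible against the sum of the a_k^2. The
    mass above a single level is merely Lipschitz under dilations, so it is replaced by its integral
    over an interval of levels, whose first-order term is the difference of b H_b at the two
    ends. *)

Section approximation.
Context d (T : measurableType d) (R : realType).
Local Open Scope ereal_scope.

(** The approximable sets form a sigma-algebra: the symmetric difference is unchanged under
    complements, and a countable union is first replaced by a finite one, by continuity from above,
    where finiteness of [mu] enters. *)
Lemma algebra_approx (mu : {measure set T -> \bar R}) (G : set (set T)) :
  mu setT < +oo -> G `<=` measurable -> G set0 -> setC_closed G -> setU_closed G ->
  measurable `<=` <<s G >> ->
  forall A, measurable A -> forall e : R, (0 < e)%R ->
  exists2 S, G S & mu ((A `\` S) `|` (S `\` A)) < e%:E.
Proof.
move=> muoo Gm G0 GC GU mG.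
have mufin A : measurable A -> mu A \is a fin_num.
  move=> mA; rewrite ge0_fin_numE//; apply: le_lt_trans muoo.
  by apply: le_measure; rewrite ?inE.
have mY (X Y : set T) : measurable X -> measurable Y ->
    measurable ((X `\` Y) `|` (Y `\` X)).
  by move=> mX mX'; apply: measurableU; exact: measurableD.
pose D := [set A | measurable A /\ forall e : R, (0 < e)%R ->
  exists2 S, G S & mu ((A `\` S) `|` (S `\` A)) < e%:E].
have DU : setU_closed D.
  move=> A B [mA hA] [mB hB]; split; first exact: measurableU.
  move=> e e0; have e20 : (0 < e / 2)%R by rewrite divr_gt0.
  have [S GS hS] := hA _ e20; have [S' GS' hS'] := hB _ e20.
  exists (S `|` S'); first exact: GU.
  have mS := Gm _ GS; have mS' := Gm _ GS'.
  rewrite [e]splitr EFinD; apply: (le_lt_trans _ (lteD hS hS')).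
  apply: (le_trans _ (measureU2 _ _ _)) => //; try exact: mY.
  apply: le_measure; rewrite ?inE; [apply: mY; exact: measurableU| |].
    by apply: measurableU; exact: mY.
  by move=> x /=; tauto.
suff /(_ _) DD : <<s G >> `<=` D by move=> A /mG/DD[].
apply: smallest_sub; last first.
  move=> A GA; split; first exact: Gm.
  by move=> e e0; exists A => //; rewrite setDv setU0 measure0 lte_fin.
have D0 : D set0.
  by split=> // e e0; exists set0 => //; rewrite setDv setU0 measure0 lte_fin.
split => //.
  move=> A [mA hA]; rewrite setTD; split; first exact: measurableC.
  move=> e e0; have [S GS hS] := hA _ e0; exists (~` S); first exact: GC.
  apply: le_lt_trans hS; apply: le_measure; rewrite ?inE.
  - by apply: measurableU; apply: measurableD; apply: measurableC => //; apply: Gm.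
  - by apply: measurableU; apply: measurableD => //; apply: Gm.
  - by move=> x /=; have [] := pselect (A x); have [] := pselect (S x); tauto.
move=> F DF; have mF i : measurable (F i) by case: (DF i).
have mUF : measurable (\bigcup_i F i) by exact: bigcupT_measurable.
split => // e e0; have e20 : (0 < e / 2)%R by rewrite divr_gt0.
pose H n := \big[setU/set0]_(i < n) F i.
have DH n : D (H n).
  by rewrite /H; elim/big_ind : _ => // A B DA DB; exact: DU.
have mH n : measurable (H n) by case: (DH n).
have HUF n : H n `<=` \bigcup_i F i.
  by rewrite /H -bigcup_mkord => x [i _ Fx]; exists i.
have : mu \o (fun n => \bigcup_i F i `\` H n) @ \oo --> mu (\bigcap_n (\bigcup_i F i `\` H n)).
  apply: nonincreasing_cvg_mu.
  - by rewrite -ge0_fin_numE// mufin//; exact: measurableD.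
  - by move=> n; exact: measurableD.
  - by apply: bigcapT_measurable => n; exact: measurableD.
  - move=> m n mn; apply/subsetPset => x [[i _ Fx] nH]; split; first by exists i.
    move=> Hm; apply: nH; move: Hm; rewrite /H -!bigcup_mkord => -[j /= jm Fj].
    by exists j => //=; exact: leq_trans mn.
have -> : \bigcap_n (\bigcup_i F i `\` H n) = set0.
  apply/seteqP; split=> // x Hx; have [[i _ Fx] _] := Hx 0%N I.
  have [_] := Hx i.+1 I; apply; rewrite /H -bigcup_mkord; exists i => //=.
rewrite measure0 => /fine_cvgP[_ /cvgrPdist_lt /(_ _ e20)[N _ /(_ N)]] /=.
move=> /(_ (leqnn N)); rewrite sub0r normrN ger0_norm ?fine_ge0// => hN.
have {}hN : mu (\bigcup_i F i `\` H N) < (e / 2)%:E.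
  by rewrite -[ltLHS]fineK ?lte_fin// mufin//; exact: measurableD.
have [S GS hS] := (DH N).2 _ e20; exists S => //.
have mS := Gm _ GS.
rewrite [e]splitr EFinD; apply: (le_lt_trans _ (lteD hN hS)).
apply: (le_trans _ (measureU2 _ _ _)) => //; try exact: mY; try exact: measurableD.
apply: le_measure; rewrite ?inE; [exact: mY| |].
  by apply: measurableU; [exact: measurableD|exact: mY].
by move=> x /=; have := HUF N x; have [] := pselect (H N x); tauto.
Qed.

End approximation.

Section shift_space_measurability.
Context (R : realType).

Lemma cylinder_fset0 a : cylinder fset0 a = setT.
Proof. by apply/seteqP; split. Qed.

Lemma cylindersE : (@measurable _ shift_space) = <<s cylinders >>.
Proof. by []. Qed.

Lemma measurable_cylinder F a : measurable (cylinder F a : set shift_space).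
Proof. by rewrite cylindersE; apply: sub_sigma_algebra; exists F, a. Qed.

Lemma coordE (i : int) b :
  [set x : shift_space | x i = b] = cylinder [fset i]%fset (fun=> b).
Proof.
apply/seteqP; split => x /=; first by move=> xi j /fset1P ->.
by apply; rewrite inE.
Qed.

Lemma measurable_coord (i : int) b : measurable [set x : shift_space | x i = b].
Proof. by rewrite coordE; exact: measurable_cylinder. Qed.

Lemma measurable_to_shift d (T : measurableType d) (g : T -> shift_space) :
  (forall i b, measurable [set t | g t i = b]) -> measurable_fun setT g.
Proof.
move=> mg; apply: (@measurability _ _ T shift_space setT g cylinders) => //.
move=> _ [_ [F [a ->]] <-]; rewrite setTI.
have -> : g @^-1` cylinder F a = \bigcap_(i in [set` F]) [set t | g t i = a i].
  by apply/seteqP; split.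
exact: fin_bigcap_measurable.
Qed.

(** Two cylinders that prescribe different values at one index have empty intersection, so the empty
    set must be added to get a pi-system. *)
Definition cylinders0 := cylinders `|` [set set0].

Lemma cylinders0_setI : setI_closed cylinders0.
Proof.
move=> A B [[F [a ->]]|->]; last by rewrite set0I; right.
case=> [[F' [a' ->]]|->]; last by rewrite setI0; right.
have [->|/set0P[x [xF xF']]] := eqVneq (cylinder F a `&` cylinder F' a') set0.
  by right.
left; exists (F `|` F')%fset, x; apply/seteqP; split => y /=.
  move=> [yF yF'] i; rewrite in_fsetU => /orP[iF|iF].
    by rewrite yF// xF.
  by rewrite yF'// xF'.
move=> h; split=> i iF; rewrite h ?in_fsetU ?iF ?orbT//; [exact: xF|exact: xF'].
Qed.

Lemma cylinders0E : <<s cylinders0 >> = <<s cylinders >>.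
Proof.
apply/seteqP; split; last first.
  by apply: sub_sigma_algebra2 => A; left.
apply: smallest_sub; first exact: smallest_sigma_algebra.
move=> A [|->]; first exact: sub_sigma_algebra.
exact: sigma_algebra0.
Qed.

Lemma cylinder_measure_unique (m1 m2 : {measure set shift_space -> \bar R}) :
  (m1 setT < +oo)%E ->
  (forall F a, m1 (cylinder F a) = m2 (cylinder F a)) ->
  forall A, measurable A -> m1 A = m2 A.
Proof.
move=> m1oo m12; apply: (@measure_unique _ R shift_space cylinders0 (fun=> setT)) => //.
- by rewrite cylinders0E.
- exact: cylinders0_setI.
- by left; exists fset0, (fun=> true); rewrite cylinder_fset0.
- by rewrite bigcup_const.
- by move=> A [[F [a ->]]|->] //; rewrite !measure0.
Qed.

Definition upd (j : int) (b : bool) (x : shift_space) : shift_space :=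
  fun i => if i == j then b else x i.

Lemma measurable_upd j b : measurable_fun setT (upd j b).
Proof.
apply: measurable_to_shift => i c; rewrite /upd.
have [_|_] := eqVneq i j; last exact: measurable_coord.
by have [->|bc] := eqVneq b c; [rewrite (_ : mkset _ = setT)|
  rewrite (_ : mkset _ = set0)] => //; apply/seteqP; split => //= x;
  apply/eqP.
Qed.

Lemma upd_same j b x : upd j b x j = b.
Proof. by rewrite /upd eqxx. Qed.

Lemma upd_other j b x i : i != j -> upd j b x i = x i.
Proof. by rewrite /upd => /negPf ->. Qed.

Lemma upd_id j x : upd j (x j) x = x.
Proof. by apply/funext => i; rewrite /upd; case: eqVneq => [->|]. Qed.

Lemma upd_upd j b c x : upd j b (upd j c x) = upd j b x.
Proof. by apply/funext => i; rewrite /upd; case: eqVneq. Qed.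

End shift_space_measurability.

Section image_measure.
Context d d' (T1 : measurableType d) (T2 : measurableType d') (R : realType).

(** The measurability proof is an argument so that the instances below make every such image a
    measure, and the image of a probability a probability. *)
Definition image_measure (m : {measure set T1 -> \bar R}) (f : T1 -> T2)
  (mf : measurable_fun setT f) : set T2 -> \bar R := pushforward m f.

HB.instance Definition _ m f mf := Measure.copy (@image_measure m f mf)
  (measure_function_pushforward__canonical__measure_function_Measure m mf).

Let image_measureT (m : probability T1 R) f mf :
  @image_measure m f mf setT = 1%E.
Proof.
by rewrite /image_measure /pushforward preimage_setT; exact: (@probability_setT _ _ _ m).
Qed.

HB.instance Definition _ (m : probability T1 R) f mf :=
  Measure_isProbability.Build _ _ _ (@image_measure m f mf) (image_measureT m mf).

End image_measure.

Section resampling.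
Context (R : realType) (q : int -> bool -> R).
Hypothesis q_ge0 : forall i b, 0 <= q i b.
Hypothesis q_sum : forall i, q i true + q i false = 1.
Context (mu : probability shift_space R) (hmu : is_product_measure q mu).
Local Open Scope ereal_scope.

(** If [j] is not in [F], both updates leave the cylinder unchanged and the weights add up to 1.
    Otherwise only the update to [a j] has a non-empty preimage, the cylinder freed of its condition
    at [j]. *)
Lemma resample_cylinder j F a :
  mu (cylinder F a) = (q j true)%:E * mu (upd j true @^-1` cylinder F a) +
                      (q j false)%:E * mu (upd j false @^-1` cylinder F a).
Proof.
have qs := q_sum j.
have [jF|jF] := boolP (j \in F); last first.
  have E b : upd j b @^-1` cylinder F a = cylinder F a.
    by apply/seteqP; split => x h i iF; have := h i iF; rewrite upd_other//;
      apply: contraNneq jF => <-.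
  by rewrite !E -ge0_muleDl ?lee_fin// -EFinD qs mul1e.
have E1 : upd j (a j) @^-1` cylinder F a = cylinder (F `\ j)%fset a.
  apply/seteqP; split => x h i.
    by rewrite in_fsetD1 => /andP[ij iF]; have := h i iF; rewrite upd_other.
  move=> iF; have [->|ij] := eqVneq i j; first by rewrite upd_same.
  by rewrite upd_other// h// in_fsetD1 ij.
have E2 : upd j (~~ a j) @^-1` cylinder F a = set0.
  apply/seteqP; split => x // /(_ j jF); rewrite upd_same.
  by case: (a j).
have muE : mu (cylinder F a) = (q j (a j))%:E * mu (cylinder (F `\ j)%fset a).
  by rewrite !hmu (big_fsetD1 j)//= EFinM.
rewrite muE; case: (a j) E1 E2 => /= -> ->; rewrite measure0 mule0 ?adde0//.
by rewrite add0e.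
Qed.

Definition resampled j : {measure set shift_space -> \bar R} :=
  measure_add
    (mscale (NngNum (q_ge0 j true)) (image_measure mu (measurable_upd j true)))
    (mscale (NngNum (q_ge0 j false)) (image_measure mu (measurable_upd j false))).

Lemma resampledE j A : measurable A -> mu A = resampled j A.
Proof.
apply: cylinder_measure_unique.
  by apply: le_lt_trans (ltry 1); rewrite -(@probability_setT _ _ _ mu).
move=> F a; rewrite [LHS](resample_cylinder j) /resampled [RHS]measure_addE.
by rewrite /mscale /image_measure.
Qed.

(** Fubini in one coordinate, without splitting a factor off the space: redrawing the coordinate [j]
    with law [q j] preserves [mu] on cylinders, hence everywhere. Independence of the coordinates is
    used mostly in this form. *)
Lemma ge0_integral_resample (j : int) (u : shift_space -> \bar R) :
  measurable_fun setT u -> (forall x, 0 <= u x) ->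
  \int[mu]_x u x = \int[mu]_x ((q j true)%:E * u (upd j true x) +
                               (q j false)%:E * u (upd j false x)).
Proof.
move=> mu_ u0.
rewrite (eq_measure_integral (resampled j)); last first.
  by move=> A mA _; exact: resampledE.
have mc b : measurable_fun setT (fun x => u (upd j b x)).
  exact: measurableT_comp mu_ (measurable_upd j b).
rewrite ge0_integral_measure_add// !ge0_integral_mscale//=.
rewrite !(ge0_integral_pushforward (measurable_upd _ _))//.
rewrite ge0_integralD//=; last 4 first.
- by move=> x _; rewrite mule_ge0// lee_fin.
- exact: measurable_funeM.
- by move=> x _; rewrite mule_ge0// lee_fin.
- exact: measurable_funeM.
by rewrite !ge0_integralZl//; rewrite lee_fin.
Qed.

End resampling.

(** * Bounded measurable functions and their expectations *)

Section bounded_measurable.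
Context d (T : measurableType d) (R : realType).
Implicit Types u v : T -> R.

Definition bmeas u := measurable_fun setT u /\ exists M : R, forall x, `|u x| <= M.

Lemma bmeas_cst (c : R) : bmeas (fun=> c).
Proof. by split; [exact: measurable_cst|exists `|c|]. Qed.

Lemma bmeasD u v : bmeas u -> bmeas v -> bmeas (fun x => u x + v x).
Proof.
move=> [mu [M uM]] [mv [N vN]]; split; first exact: measurable_funD.
by exists (M + N) => x; rewrite (le_trans (ler_normD _ _))// lerD.
Qed.

Lemma bmeasM u v : bmeas u -> bmeas v -> bmeas (fun x => u x * v x).
Proof.
move=> [mu [M uM]] [mv [N vN]]; split; first exact: measurable_funM.
by exists (M * N) => x; rewrite normrM ler_pM.
Qed.

Lemma bmeasZ c u : bmeas u -> bmeas (fun x => c * u x).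
Proof. by apply: bmeasM; exact: bmeas_cst. Qed.

Lemma bmeasB u v : bmeas u -> bmeas v -> bmeas (fun x => u x - v x).
Proof.
move=> hu hv; have := bmeasD hu (bmeasZ (-1) hv).
by congr bmeas; apply/funext => x; rewrite mulN1r.
Qed.

Lemma bmeas_indic (A : set T) : measurable A -> bmeas \1_A.
Proof.
move=> mA; split; first exact: measurable_indic.
by exists 1 => x; rewrite indicE; case: (x \in A); rewrite ?normr1 ?normr0.
Qed.

Lemma bmeas_sum (I : Type) (s : seq I) (h : I -> T -> R) :
  (forall i, bmeas (h i)) -> bmeas (fun x => \sum_(i <- s) h i x).
Proof.
move=> hh; elim: s => [|i s IH].
  by under eq_fun do rewrite big_nil; exact: bmeas_cst.
by under eq_fun do rewrite big_cons; exact: bmeasD.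
Qed.

Lemma bmeas_prod (I : Type) (s : seq I) (h : I -> T -> R) :
  (forall i, bmeas (h i)) -> bmeas (fun x => \prod_(i <- s) h i x).
Proof.
move=> hh; elim: s => [|i s IH].
  by under eq_fun do rewrite big_nil; exact: bmeas_cst.
by under eq_fun do rewrite big_cons; exact: bmeasM.
Qed.

Lemma bmeas_comp d' (T' : measurableType d') (g : T' -> T) u :
  measurable_fun setT g -> bmeas u ->
  measurable_fun setT (fun x => u (g x)) /\ exists M : R, forall x, `|u (g x)| <= M.
Proof.
move=> mg [mu [M uM]]; split; first exact: measurableT_comp mu mg.
by exists M.
Qed.

Variable P : probability T R.

Lemma bmeas_integrable u : bmeas u -> P.-integrable setT (EFin \o u).
Proof.
move=> [mu [M uM]]; apply: measurable_bounded_integrable => //.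
  by apply: le_lt_trans (ltry 1); rewrite -(@probability_setT _ _ _ P).
by exists M; split; rewrite ?num_real// => K MK x _ /=; rewrite (le_trans (uM x)) ?ltW.
Qed.

Definition Ex u : R := \int[P]_x u x.

Lemma eq_Ex u v : u =1 v -> Ex u = Ex v.
Proof. by move=> /funext ->. Qed.

Lemma Ex_cst c : Ex (fun=> c) = c.
Proof.
rewrite /Ex Rintegral_cst//.
by have /= -> := @probability_setT _ _ _ P; rewrite mulr1.
Qed.

Lemma ExD u v : bmeas u -> bmeas v -> Ex (fun x => u x + v x) = Ex u + Ex v.
Proof. by move=> hu hv; rewrite /Ex RintegralD//; exact: bmeas_integrable. Qed.

Lemma ExZ c u : bmeas u -> Ex (fun x => c * u x) = c * Ex u.
Proof. by move=> hu; rewrite /Ex RintegralZl//; exact: bmeas_integrable. Qed.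

Lemma ExB u v : bmeas u -> bmeas v -> Ex (fun x => u x - v x) = Ex u - Ex v.
Proof. by move=> hu hv; rewrite /Ex RintegralB//; exact: bmeas_integrable. Qed.

Lemma Ex_le u v : bmeas u -> bmeas v -> (forall x, u x <= v x) -> Ex u <= Ex v.
Proof.
by move=> hu hv uv; apply: le_Rintegral => //; exact: bmeas_integrable.
Qed.

Lemma Ex_ge0 u : (forall x, 0 <= u x) -> 0 <= Ex u.
Proof. by move=> u0; exact: Rintegral_ge0. Qed.

Lemma Ex_norm u : bmeas u -> `|Ex u| <= Ex (fun x => `|u x|).
Proof. by move=> hu; apply: le_normr_Rintegral => //; exact: bmeas_integrable. Qed.

Lemma Ex_sum (I : Type) (s : seq I) (h : I -> T -> R) :
  (forall i, bmeas (h i)) ->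
  Ex (fun x => \sum_(i <- s) h i x) = \sum_(i <- s) Ex (h i).
Proof.
move=> hh; elim: s => [|i s IH].
  by under eq_fun do rewrite big_nil; rewrite big_nil Ex_cst.
under eq_fun do rewrite big_cons.
by rewrite big_cons ExD ?IH//; exact: bmeas_sum.
Qed.

Lemma EFin_Ex u : bmeas u -> (Ex u)%:E = (\int[P]_x (u x)%:E)%E.
Proof.
move=> hu; rewrite /Ex fineK//.
by apply: integrable_fin_num => //; exact: bmeas_integrable.
Qed.

Lemma Ex_indic A : measurable A -> (Ex \1_A)%:E = P A.
Proof.
by move=> mA; rewrite EFin_Ex ?integral_indic ?setIT//; exact: bmeas_indic.
Qed.

End bounded_measurable.

Section product_expectations.
Context (R : realType).
Local Notation X := shift_space.

Definition avg (q : int -> bool -> R) (j : int) (u : X -> R) (x : X) : R :=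
  q j true * u (upd j true x) + q j false * u (upd j false x).

Lemma bmeas_avg q j u : bmeas u -> bmeas (avg q j u).
Proof.
by move=> hu; apply: bmeasD; apply: bmeasZ; apply: (bmeas_comp (measurable_upd _ _) hu).
Qed.

Lemma bmeas_coord j (h : bool -> R) : bmeas (fun x : X => h (x j)).
Proof.
have -> : (fun x : X => h (x j)) = (fun x => h true * \1_[set y : X | y j = true] x
                                 + h false * \1_[set y : X | y j = false] x).
  apply/funext => x; rewrite !indicE.
  have E b : (x \in [set y : X | y j = b]) = (x j == b).
    by apply/idP/eqP; rewrite inE.
  by rewrite !E; case: (x j); rewrite /= ?mulr1 ?mulr0 ?addr0 ?add0r.
by apply: bmeasD; apply: bmeasZ; apply: bmeas_indic; exact: measurable_coord.
Qed.

Section one_measure.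
Context (q : int -> bool -> R).
Hypothesis q_ge0 : forall i b, 0 <= q i b.
Hypothesis q_sum : forall i, q i true + q i false = 1.
Context (mu : probability X R) (hmu : is_product_measure q mu).

Lemma Ex_avg j u : bmeas u -> Ex mu u = Ex mu (avg q j u).
Proof.
move=> hu; have [mu_ [M uM]] := hu.
(* Resampling is available for nonnegative functions; the bound [M] shifts [u] there and cancels, as
   the weights of [avg] add up to 1. *)
suff H : Ex mu (fun x => u x + M) = Ex mu (avg q j (fun x => u x + M)).
  have := H; rewrite ExD//; last exact: bmeas_cst.
  rewrite (_ : avg q j _ = (fun x => avg q j u x + M)); last first.
    apply/funext => x; rewrite /avg !mulrDr addrACA -mulrDl q_sum mul1r//.
  rewrite ExD//; [by move=> /addIr|exact: bmeas_avg|exact: bmeas_cst].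
have huM : bmeas (fun x => u x + M) by apply: bmeasD => //; exact: bmeas_cst.
apply: EFin_inj; rewrite !EFin_Ex//; last exact: bmeas_avg.
rewrite (ge0_integral_resample q_ge0 q_sum hmu j)//.
- by apply/measurable_EFinP; case: huM.
- by move=> x; rewrite lee_fin -lerBlDr sub0r; have := uM x; rewrite ler_norml => /andP[].
Qed.

(** Invariance under updates, not probabilistic independence: it allows averaging out one coordinate
    at a time. *)
Definition indep (s : seq int) (u : X -> R) :=
  forall j b x, j \in s -> u (upd j b x) = u x.

Lemma Ex_prod_indep (s : seq int) (u : X -> R) (h : int -> bool -> R) :
  bmeas u -> uniq s -> indep s u ->
  Ex mu (fun x => u x * \prod_(j <- s) h j (x j)) =
  Ex mu u * \prod_(j <- s) (q j true * h j true + q j false * h j false).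
Proof.
move=> hu; elim: s => [_ _|j s IH /= /andP[js us] inds].
  by under eq_Ex do rewrite big_nil mulr1; rewrite big_nil mulr1.
have hp : bmeas (fun x : X => \prod_(j <- s) h j (x j)).
  by apply: bmeas_prod => i; exact: bmeas_coord.
rewrite big_cons mulrCA -IH//; last first.
  by move=> i b x si; apply: inds; rewrite inE si orbT.
rewrite [LHS](Ex_avg j); last first.
  by apply: bmeasM => //; apply: bmeas_prod => i; exact: bmeas_coord.
rewrite -ExZ; last exact: bmeasM.
congr (Ex mu _); apply/funext => x; rewrite /avg.
have E b : \prod_(i <- s) h i (upd j b x i) = \prod_(i <- s) h i (x i).
  rewrite !big_seq; apply: eq_bigr => i si; rewrite upd_other//.
  by apply: contraNneq js => <-.
rewrite !big_cons !upd_same !E !inds ?mem_head//; ring.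
Qed.

End one_measure.

Definition dep (s : seq int) (u : X -> R) :=
  forall x y : X, (forall i, i \in s -> x i = y i) -> u x = u y.

Fixpoint avgs (q : int -> bool -> R) (s : seq int) (u : X -> R) :=
  if s is j :: s' then avgs q s' (avg q j u) else u.

Lemma dep_avg q j s u : dep (j :: s) u -> dep s (avg q j u).
Proof.
move=> du x y xy; rewrite /avg.
have E b : u (upd j b x) = u (upd j b y).
  apply: du => i; rewrite inE; case: (eqVneq i j) => [->|ij /= si].
    by rewrite !upd_same.
  by rewrite !upd_other// xy.
by rewrite !E.
Qed.

Lemma dep_avgs q s u : dep s u -> dep [::] (avgs q s u).
Proof. by elim: s u => //= j s IH u du; apply: IH; exact: dep_avg. Qed.

Lemma Ex_avgs q mu s u : (forall i b, 0 <= q i b) ->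
  (forall i, q i true + q i false = 1) -> is_product_measure q mu ->
  bmeas u -> Ex mu u = Ex mu (avgs q s u).
Proof.
move=> q0 q1 hmu; elim: s u => //= j s IH u hu.
by rewrite [LHS](Ex_avg q0 q1 hmu j hu); apply: IH; exact: bmeas_avg.
Qed.

Section two_measures.
Context (q q' : int -> bool -> R).
Hypothesis q_gt0 : forall i b, 0 < q i b.
Hypothesis q'_gt0 : forall i b, 0 < q' i b.
Hypothesis q_sum : forall i, q i true + q i false = 1.
Hypothesis q'_sum : forall i, q' i true + q' i false = 1.
Context (mu mu' : probability X R).
Hypothesis hmu : is_product_measure q mu.
Hypothesis hmu' : is_product_measure q' mu'.

Let q_ge0 i b : 0 <= q i b. Proof. exact: ltW. Qed.
Let q'_ge0 i b : 0 <= q' i b. Proof. exact: ltW. Qed.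

Definition ratio (j : int) (b : bool) := q' j b / q j b.

(** Multiplying by [ratio] and averaging a coordinate with weights [q] is averaging it with weights
    [q']; the coordinates of [s] are treated one after the other. *)
Lemma Ex_ratio_avgs s u : uniq s -> bmeas u ->
  Ex mu (fun x => (\prod_(j <- s) ratio j (x j)) * u x) = Ex mu (avgs q' s u).
Proof.
elim: s u => [u _ _|j s IH u /= /andP[js us] hu].
  by under eq_Ex do rewrite big_nil mul1r.
have hp : bmeas (fun x : X => \prod_(j <- s) ratio j (x j)).
  by apply: bmeas_prod => i; exact: bmeas_coord.
rewrite -IH//; last exact: bmeas_avg.
rewrite [LHS](Ex_avg q_ge0 q_sum hmu j); last first.
  by apply: bmeasM => //; apply: bmeas_prod => i; exact: bmeas_coord.
congr (Ex mu _); apply/funext => x; rewrite /avg.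
have E b : \prod_(i <- s) ratio i (upd j b x i) = \prod_(i <- s) ratio i (x i).
  rewrite !big_seq; apply: eq_bigr => i si; rewrite upd_other//.
  by apply: contraNneq js => <-.
rewrite !big_cons !upd_same !E /ratio; field.
by rewrite !gt_eqF.
Qed.

(** Once all coordinates of [s] have been averaged with [q'], a constant is left, to which [mu] and
    [mu'] give the same expectation. *)
Lemma Ex_ratio s u : uniq s -> bmeas u -> dep s u ->
  Ex mu' u = Ex mu (fun x => (\prod_(j <- s) ratio j (x j)) * u x).
Proof.
move=> us hu du; rewrite Ex_ratio_avgs// (Ex_avgs s q'_ge0 q'_sum hmu')//.
have dc := dep_avgs q' du.
have -> : avgs q' s u = (fun=> avgs q' s u (fun=> true)).
  by apply/funext => x; exact: dc.
by rewrite !Ex_cst.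
Qed.

End two_measures.

End product_expectations.

(** * Comparison of product measures *)

Section finitely_determined.
Local Notation X := shift_space.

Definition sdep (s : seq int) (A : set X) :=
  forall x y : X, (forall i, i \in s -> x i = y i) -> A x -> A y.

Definition fdep : set (set X) := [set A | measurable A /\ exists s, sdep s A].

Lemma sdepS s s' A : {subset s <= s'} -> sdep s A -> sdep s' A.
Proof. by move=> ss' dA x y xy; apply: dA => i /ss'; exact: xy. Qed.

Lemma sdepC s A : sdep s A -> sdep s (~` A).
Proof. by move=> dA x y xy nAx Ay; apply: nAx; apply: dA Ay => i /xy. Qed.

Lemma sdepI s s' A B : sdep s A -> sdep s' B -> sdep (s ++ s') (A `&` B).
Proof.
move=> dA dB x y xy [Ax Bx]; split.
  by apply: dA Ax => i si; apply: xy; rewrite mem_cat si.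
by apply: dB Bx => i si; apply: xy; rewrite mem_cat si orbT.
Qed.

Lemma sdepU s s' A B : sdep s A -> sdep s' B -> sdep (s ++ s') (A `|` B).
Proof.
move=> dA dB x y xy [Ax|Bx]; [left|right].
  by apply: dA Ax => i si; apply: xy; rewrite mem_cat si.
by apply: dB Bx => i si; apply: xy; rewrite mem_cat si orbT.
Qed.

Lemma sdep_dep (R : realType) s A : sdep s A -> dep s (\1_A : X -> R).
Proof.
move=> dA x y xy; rewrite !indicE; congr (nat_of_bool _)%:R.
by apply/idP/idP; rewrite !inE; apply: dA => i /xy.
Qed.

Lemma fdepC : setC_closed fdep.
Proof.
by move=> A [mA [s dA]]; split; [exact: measurableC|exists s; exact: sdepC].
Qed.

Lemma fdepU : setU_closed fdep.
Proof.
move=> A B [mA [s dA]] [mB [s' dB]]; split; first exact: measurableU.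
by exists (s ++ s'); exact: sdepU.
Qed.

Lemma fdep0 : fdep set0.
Proof. by split => //; exists [::]. Qed.

Lemma fdep_cylinder F a : fdep (cylinder F a).
Proof.
split; first exact: measurable_cylinder.
by exists F => x y xy h i iF; rewrite -xy// h.
Qed.

Lemma fdep_gen : (@measurable _ X) `<=` <<s fdep >>.
Proof.
rewrite cylindersE; apply: sub_sigma_algebra2 => _ [F [a ->]].
exact: fdep_cylinder.
Qed.

Lemma fdep_approx (R : realType) (m : {measure set X -> \bar R}) :
  (m setT < +oo)%E -> forall A, measurable A -> forall e : R, 0 < e ->
  exists2 S, fdep S & (m ((A `\` S) `|` (S `\` A)) < e%:E)%E.
Proof.
move=> moo A mA e e0; apply: (algebra_approx moo) => //.
- by move=> S [].
- exact: fdep0.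
- exact: fdepC.
- exact: fdepU.
- exact: fdep_gen.
Qed.

End finitely_determined.

Lemma Ex_indic_dist d (T : measurableType d) (R : realType)
    (P : probability T R) (A B : set T) : measurable A -> measurable B ->
  `|Ex P \1_A - Ex P \1_B| <= Ex P \1_((A `\` B) `|` (B `\` A)).
Proof.
move=> mA mB; have hA := bmeas_indic R mA; have hB := bmeas_indic R mB.
have mY : measurable ((A `\` B) `|` (B `\` A)).
  by apply: measurableU; exact: measurableD.
rewrite -ExB//; apply: (le_trans (Ex_norm _ (bmeasB hA hB))).
apply: Ex_le.
- have [m [M hM]] := bmeasB hA hB; split; first exact: measurableT_comp m.
  by exists M => x; rewrite normr_id.
- exact: bmeas_indic.
- move=> x; rewrite !indicE in_setU !in_setD.
  by case: (x \in A); case: (x \in B); rewrite /= ?subrr ?subr0 ?sub0r ?normrN ?normr1 ?normr0.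
Qed.

Lemma Ex_indic_le d (T : measurableType d) (R : realType)
    (P : probability T R) (A B : set T) : measurable A -> measurable B ->
  A `<=` B -> Ex P \1_A <= Ex P \1_B.
Proof.
move=> mA mB AB; apply: Ex_le; [exact: bmeas_indic|exact: bmeas_indic|].
move=> x; rewrite !indicE ler_nat.
case: (boolP (x \in A)) => //; rewrite inE => /AB Bx; by rewrite mem_set.
Qed.

Section deviation.
Context (R : realType).
Local Notation X := shift_space.
Context (q q' : int -> bool -> R).
Hypothesis q_gt0 : forall i b, 0 < q i b.
Hypothesis q'_gt0 : forall i b, 0 < q' i b.
Hypothesis q_sum : forall i, q i true + q i false = 1.
Hypothesis q'_sum : forall i, q' i true + q' i false = 1.
Context (mu mu' : probability X R).
Hypothesis hmu : is_product_measure q mu.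
Hypothesis hmu' : is_product_measure q' mu'.

(** The chi-square divergence of [q' j] from [q j]. The second moment of [ratio] under [q j] is
    [1 + chi2 j], and it multiplies over independent coordinates. *)
Definition chi2 j := (q' j true - q j true) ^+ 2 / q j true +
                     (q' j false - q j false) ^+ 2 / q j false.

Let q_ge0 i b : 0 <= q i b. Proof. exact: ltW. Qed.

Context (B : set X) (mB : measurable B) (s0 : seq int) (us0 : uniq s0).
Context (kap : R).
Hypothesis dB : sdep s0 B.
Hypothesis ratioB : forall x, B x -> \prod_(j <- s0) ratio q q' j (x j) = 1.
Hypothesis hkap : forall s, uniq s -> (forall j, j \in s -> j \notin s0) ->
  \prod_(j <- s) (1 + chi2 j) <= 1 + kap.

(* With [P2] the density of [mu'] off [s0], AM-GM gives
   [\1_S |P2 - 1| <= c / 2 \1_S + \1_B (P2 - 1)^2 / (2 c)], and the integral of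
   [(P2 - 1)^2] over [B] is at most [kap mu(B)]. *)
Lemma deviation_fdep S c : S `<=` B -> fdep S -> 0 < c ->
  `|Ex mu' \1_S - Ex mu \1_S| <= c / 2 * Ex mu \1_S + kap / (2 * c) * Ex mu \1_B.
Proof.
move=> SB [mS [s1 dS]] c0.
pose s2 := [seq j <- undup s1 | j \notin s0].
have us2 : uniq s2 by rewrite filter_uniq// undup_uniq.
have s2s0 j : j \in s2 -> j \notin s0 by rewrite mem_filter => /andP[].
have us : uniq (s0 ++ s2).
  rewrite cat_uniq us0 us2 andbT/=; apply/hasPn => j; exact: s2s0.
have dS' : dep (s0 ++ s2) (\1_S : X -> R).
  apply: sdep_dep; apply: sdepS dS => j js1; rewrite mem_cat mem_filter mem_undup js1.
  by case: (j \in s0).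
have hS := bmeas_indic R mS; have hB := bmeas_indic R mB.
rewrite (Ex_ratio q_gt0 q'_gt0 q_sum q'_sum hmu hmu' us hS dS').
pose P2 (x : X) := \prod_(j <- s2) ratio q q' j (x j).
have hP2 : bmeas P2 by apply: bmeas_prod => i; exact: bmeas_coord.
have -> : Ex mu (fun x => (\prod_(j <- s0 ++ s2) ratio q q' j (x j)) * \1_S x) =
          Ex mu (fun x => P2 x * \1_S x).
  apply: eq_Ex => x; rewrite indicE; case: (boolP (x \in S)); last by rewrite !mulr0.
  by rewrite inE => /SB Bx; rewrite big_cat/= ratioB// mul1r.
have hPS := bmeasM hP2 hS.
rewrite -ExB//; apply: (le_trans (Ex_norm _ (bmeasB hPS hS))).
have iB : indep s2 (\1_B : X -> R).
  move=> j b x js2; apply: (sdep_dep R dB) => i is0; rewrite upd_other//.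
  by apply: contraTneq is0 => ->; exact: s2s0.
have hBP := bmeasM hB hP2.
have hBPP : bmeas (fun x => \1_B x * (P2 x * P2 x)) by apply: bmeasM => //; exact: bmeasM.
have E1 : Ex mu (fun x => \1_B x * P2 x) = Ex mu \1_B.
  rewrite (Ex_prod_indep q_ge0 q_sum hmu (fun j b => ratio q q' j b) hB us2 iB).
  rewrite big1 ?mulr1// => j _; rewrite /ratio -[RHS](q'_sum j); field.
  by rewrite !gt_eqF.
have E2 : Ex mu (fun x => \1_B x * (P2 x * P2 x)) <= (1 + kap) * Ex mu \1_B.
  rewrite (_ : (fun x => _) =
    (fun x => \1_B x * \prod_(j <- s2) (ratio q q' j (x j)) ^+ 2)); last first.
    by apply/funext => x; rewrite /P2 -big_split/=; congr (_ * _); apply: eq_bigr.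
  rewrite (Ex_prod_indep q_ge0 q_sum hmu (fun j b => ratio q q' j b ^+ 2) hB us2 iB).
  rewrite mulrC ler_wpM2r//; first by apply: Ex_ge0 => x; rewrite indicE.
  apply: le_trans (hkap us2 s2s0); rewrite le_eqVlt; apply/orP; left; apply/eqP.
  apply: eq_bigr => j _; rewrite /ratio /chi2.
  have -> : 1 + ((q' j true - q j true) ^+ 2 / q j true +
      (q' j false - q j false) ^+ 2 / q j false) =
    (q' j true ^+ 2 / q j true + q' j false ^+ 2 / q j false) +
    (1 + (q j true + q j false) - 2 * (q' j true + q' j false)).
    by field; rewrite !gt_eqF.
  by rewrite q_sum q'_sum; field; rewrite !gt_eqF.
pose V x := \1_B x * (P2 x * P2 x) - 2 * (\1_B x * P2 x) + \1_B x.
have hV : bmeas V by apply: bmeasD => //; apply: bmeasB => //; exact: bmeasZ.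
have EV : Ex mu V <= kap * Ex mu \1_B.
  rewrite /V ExD//; last by apply: bmeasB => //; exact: bmeasZ.
  rewrite ExB//; last exact: bmeasZ.
  by rewrite ExZ// E1; lra.
apply: (@le_trans _ _ (Ex mu (fun x => c / 2 * \1_S x + (2 * c)^-1 * V x))).
  apply: Ex_le.
  - have [m [M hM]] := bmeasB hPS hS; split; first exact: measurableT_comp m.
    by exists M => x; rewrite normr_id.
  - by apply: bmeasD; exact: bmeasZ.
  - move=> x; have Vx : V x = \1_B x * (P2 x - 1) ^+ 2 by rewrite /V; ring.
    rewrite Vx !indicE; case: (boolP (x \in S)); last first.
      move=> _; rewrite !mulr0 subrr normr0 add0r.
      by apply: mulr_ge0; [rewrite invr_ge0 mulr_ge0// ltW|rewrite mulr_ge0// sqr_ge0].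
    rewrite inE => /SB Bx; rewrite mem_set//= !mulr1 mul1r.
    have -> : c / 2 + (2 * c)^-1 * (P2 x - 1) ^+ 2 = (c ^+ 2 + (P2 x - 1) ^+ 2) / (2 * c).
      by field; rewrite gt_eqF.
    rewrite ler_pdivlMr ?mulr_gt0// -(@real_normK _ (P2 x - 1)) ?num_real//.
    have := sqr_ge0 (c - `|P2 x - 1|); lra.
rewrite ExD ?ExZ//; [|exact: bmeasZ|exact: bmeasZ].
rewrite lerD2l; apply: (le_trans (ler_wpM2l _ EV)).
  by rewrite invr_ge0 mulr_ge0// ltW.
by rewrite mulrA [_^-1 * _]mulrC.
Qed.

(** Extends the preceding bound to all measurable [S] by approximating [S] for the sum of both
    measures at once; intersecting the approximation with [B] keeps it inside [B]. *)
Lemma deviation S c : S `<=` B -> measurable S -> 0 < c ->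
  `|Ex mu' \1_S - Ex mu \1_S| <= c / 2 * Ex mu \1_S + kap / (2 * c) * Ex mu \1_B.
Proof.
move=> SB mS c0; apply/ler_addgt0Pr => e e0.
(* The error [e'] occurs once for each of [mu] and [mu'], and once more with the factor c / 2. *)
pose e' := e / (2 + c / 2).
have c2 : 0 < 2 + c / 2 by rewrite addr_gt0// divr_gt0.
have e'0 : 0 < e' by rewrite divr_gt0.
pose m : {measure set X -> \bar R} := measure_add mu mu'.
have mE A : m A = (mu A + mu' A)%E by exact: measure_addE.
have moo : (m setT < +oo)%E.
  rewrite mE; apply: lte_add_pinfty; apply: le_lt_trans (ltry 1).
    by rewrite (@probability_setT _ _ _ mu).
  by rewrite (@probability_setT _ _ _ mu').
have [S1 fS1 hS1] := fdep_approx moo mS e'0.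
have mS1 : measurable S1 by case: fS1.
pose S2 := S1 `&` B.
have fS2 : fdep S2.
  case: fS1 => _ [s dS1]; split; first exact: measurableI.
  by exists (s ++ s0); exact: sdepI.
have mS2 : measurable S2 by case: fS2.
have mY A A' : measurable A -> measurable A' -> measurable ((A `\` A') `|` (A' `\` A) : set X).
  by move=> *; apply: measurableU; exact: measurableD.
have bnd (P : probability X R) : (forall A, measurable A -> P A <= m A)%E ->
    `|Ex P \1_S - Ex P \1_S2| <= e'.
  move=> Pm; apply: (le_trans (Ex_indic_dist _ _ _)) => //.
  apply: (@le_trans _ _ (Ex P \1_((S `\` S1) `|` (S1 `\` S)))).
    apply: Ex_indic_le; [exact: mY|exact: mY|].
    by move=> x; rewrite /S2 /=; have := SB x; tauto.
  rewrite -lee_fin Ex_indic; last exact: mY.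
  by apply: le_trans (ltW hS1); apply: Pm; exact: mY.
have b1 : `|Ex mu \1_S - Ex mu \1_S2| <= e'.
  by apply: bnd => A mA; rewrite mE leeDl.
have b2 : `|Ex mu' \1_S - Ex mu' \1_S2| <= e'.
  by apply: bnd => A mA; rewrite mE leeDr.
have S2B : S2 `<=` B by move=> x [].
have D := deviation_fdep S2B fS2 c0.
have ee : e = 2 * e' + c / 2 * e' by rewrite -mulrDl mulrC divfK ?gt_eqF.
move: b1 b2 D; rewrite !ler_norml.
set EB := Ex mu \1_B; set k := kap / _.
move=> /andP[b1 b1'] /andP[b2 b2'] /andP[D1 D2].
have cc : c / 2 * Ex mu \1_S2 <= c / 2 * (Ex mu \1_S + e').
  by apply: ler_wpM2l; lra.
clearbody e' k; move: b1 b1' b2 b2' D1 D2 cc.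
move: (Ex mu \1_S) (Ex mu \1_S2) (Ex mu' \1_S) (Ex mu' \1_S2) EB => a1 a2 a3 a4 a5.
by move=> *; apply/andP; split; rewrite ee; lra.
Qed.

End deviation.

(** * The parameters of the procedure *)

Section procedure_arithmetic.
Context (R : realType) (lam : R) (eta : nat -> R).
Hypothesis eta_gt0 : forall n : nat, (0 < n)%N -> 0 < eta n.
Hypothesis eta_cvg0 : eta n @[n --> \oo] --> 0.
Hypothesis eta_l2 : cvgn (series (fun n : nat => eta n ^+ 2)).
Context (eps : int -> R) (L l : nat -> nat).
Hypothesis heps : inductive_procedure lam eta eps L l.
Hypothesis eps_le0 : forall i : int, i <= 0 -> eps i = 0.

Lemma procedure_ltLl n : (L n < l n.+1)%N.
Proof. by have [_ _ /(_ n.+1 isT)[[]]] := heps. Qed.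

Lemma procedure_ltlL n : (0 < n)%N -> (2 * l n < L n)%N.
Proof. by move=> n0; have [_ _ /(_ n n0)[_ []]] := heps. Qed.

Lemma procedure_ltL n : (L n < L n.+1)%N.
Proof. have := procedure_ltLl n; have := @procedure_ltlL n.+1 isT; lia. Qed.

Lemma procedure_leL m n : (m <= n)%N -> (L m <= L n)%N.
Proof.
elim: n => [|n IH]; first by rewrite leqn0 => /eqP ->.
rewrite leq_eqVlt => /orP[/eqP ->//|/IH h].
exact: leq_trans h (ltnW (procedure_ltL n)).
Qed.

Lemma procedure_L0 : L 0 = 1%N. Proof. by case: heps. Qed.

Lemma procedure_L_gt n : (n < L n)%N.
Proof. by elim: n => [|n IH]; [rewrite procedure_L0|have := procedure_ltL n; lia]. Qed.

(** The indices filled by step 2 of stage [m]; off the blocks [eps] vanishes. *)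
Definition block m j := (0 < m)%N && (l m < j <= L m)%N.

Lemma block_uniq m m' j : block m j -> block m' j -> m = m'.
Proof.
wlog : m m' / (m < m')%N.
  move=> h b b'; have [mm'|mm'|//] := ltngtP m m'; first exact: h.
  by apply/esym/h.
case: m' => // m' mm' /and3P[m0 b1 b2] /and3P[_ b3 b4].
have := procedure_ltLl m'; have := @procedure_leL m m'.
by rewrite -ltnS => /(_ mm'); lia.
Qed.

Lemma block_lt m j : block m j -> (m <= j)%N.
Proof.
case: m => // m /and3P[_ b1 b2]; have := procedure_ltLl m.
have := procedure_L_gt m; lia.
Qed.

Lemma eps_block j : eps j%:Z != 0 -> exists m, block m j.
Proof.
move=> ej; have [_ e1 H] := heps.
have j2 : (1 < j)%N.
  rewrite ltnNge; apply/negP; rewrite leq_eqVlt ltnS leqn0 => /orP[]/eqP jE.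
    by rewrite jE e1 eqxx in ej.
  by rewrite jE eps_le0 ?eqxx// in ej.
have [n] : exists n, (L n < j <= L n.+1)%N.
  have : (j <= L j)%N by exact/ltnW/procedure_L_gt.
  elim: {2}j => [|k IH]; first by rewrite procedure_L0; lia.
  by move=> jk; have [/IH//|h] := leqP j (L k); exists k; rewrite h.
move=> /andP[nj jn]; exists n.+1.
rewrite /block /= jn andbT ltnNge; apply/negP => jl.
have [[_ _ h0] _] := H n.+1 isT.
by rewrite h0 ?eqxx//= ?nj// in ej.
Qed.

(** For the last bound: on its block [eps] is at most its first value, which is one of the
    nonnegative terms of the sum over ]l m, 2 l m] that step 2 keeps below [eta m]. *)
Lemma block_step m : (0 < m)%N ->
  [/\ forall j, block m j -> 0 <= eps j%:Z,
      forall i j, block m i -> block m j -> (i <= j)%N -> eps j%:Z <= eps i%:Z &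
      forall j, block m j -> eps j%:Z < eta m].
Proof.
move=> m0; have [_ _ /(_ m m0)[_ [l2 [e0 ed] es _ _]]] := heps.
have ge0 j : block m j -> 0 <= eps j%:Z by move=> /andP[_]; exact: e0.
have dec i j : block m i -> block m j -> (i <= j)%N -> eps j%:Z <= eps i%:Z.
  move=> /and3P[_ bi1 bi2] /and3P[_ bj1 bj2] ij.
  have {bj1} : (j <= L m)%N by [].
  elim: j ij {bj2} => [|j IH]; first by rewrite leqn0 => /eqP ->.
  rewrite leq_eqVlt => /orP[/eqP ->//|]; rewrite ltnS => ij jL.
  apply: le_trans (IH ij (ltnW jL)); apply: ed; lia.
split => // j bj; have /and3P[_ bj1 bj2] := bj.
have b1 : block m (l m).+1 by rewrite /block m0 ltnSn /=; lia.
apply: (le_lt_trans (dec _ _ b1 bj _)); first lia.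
apply: le_lt_trans es; case: (posnP (l m)) => [l0|lp].
  by have := procedure_ltLl m.-1; rewrite prednK// l0.
rewrite big_nat_recl; last lia.
rewrite lerDl big_nat; apply: sumr_ge0 => i hi; apply: e0; lia.
Qed.

Lemma eps_ge0 i : 0 <= eps i.
Proof.
case: i => [j|j]; last by rewrite eps_le0.
have [->//|/eps_block[m bm]] := eqVneq (eps j) 0.
by have [+ _ _] := @block_step m (andP bm).1; apply.
Qed.

Lemma eps_small (d : R) : 0 < d -> exists N : nat, forall j : nat, (N <= j)%N -> eps j%:Z <= d.
Proof.
move=> d0; have /cvgrPdist_lt /(_ _ d0)[N _ hN] := eta_cvg0.
exists (L N) => j Nj.
have [->|/eps_block[m bm]] := eqVneq (eps j) 0; first exact: ltW.
have m0 := (andP bm).1; have [_ _ /(_ _ bm) lt] := block_step m0.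
have Nm : (N <= m)%N.
  rewrite leqNgt; apply/negP => mN; case: N mN Nj {hN} => // N; rewrite ltnS => mN.
  have := procedure_leL mN; have := procedure_ltL N; move: bm; rewrite /block; lia.
have := hN m Nm; rewrite /= sub0r normrN => h.
by apply/ltW/(lt_trans lt); apply: le_lt_trans h; exact: ler_norm.
Qed.

Lemma eps_bounded : exists M : R, 0 <= M /\ forall i, eps i <= M.
Proof.
have [N hN] := eps_small ltr01.
exists (1 + \sum_(i < N) eps i%:Z); split.
  by rewrite addr_ge0// sumr_ge0// => i _; exact: eps_ge0.
have S0 : 0 <= \sum_(i < N) eps i%:Z by rewrite sumr_ge0// => i _; exact: eps_ge0.
case=> [j|j]; last by rewrite eps_le0// addr_ge0.
have [/hN h|jN] := leqP N j; first by rewrite (le_trans h)// lerDl.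
rewrite (bigD1 (Ordinal jN))//= addrCA lerDl addr_ge0// sumr_ge0// => i _.
exact: eps_ge0.
Qed.

(** Cutting [eps] into blocks allows the stages to be estimated separately, each against its own
    [eta m]. *)
Definition eblock m j : R := if block m j then eps j%:Z else 0.

Lemma eblock_ge0 m j : 0 <= eblock m j.
Proof. by rewrite /eblock; case: ifP => // _; exact: eps_ge0. Qed.

Lemma eblock_le m j : eblock m j <= eps j%:Z.
Proof. by rewrite /eblock; case: ifP => // _; exact: eps_ge0. Qed.

Lemma eblock_lt m j : (0 < m)%N -> eblock m j < eta m.
Proof.
move=> m0; rewrite /eblock; case: ifP => [b|_]; last exact: eta_gt0.
by have [_ _ ->] := block_step m0.
Qed.

(** At most one term is non-zero, as the blocks are disjoint. [L n.-1 < j] excludes the blocks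
    before [n], and [j < N] those from [N] on, since no index of block [m] is below [m]. *)
Lemma sum_eblock (f : R -> R) n N j : f 0 = 0 -> (0 < n)%N ->
  (L n.-1 < j < N)%N -> \sum_(n <= m < N) f (eblock m j) = f (eps j%:Z).
Proof.
move=> f0 n0 /andP[nj jN].
have [e0|/eps_block[m bm]] := eqVneq (eps j) 0.
  by rewrite e0 f0 big1// => m _; rewrite /eblock; case: ifP => //; rewrite ?e0.
have nm : (n <= m)%N.
  rewrite leqNgt; apply/negP => mn; have : (m <= n.-1)%N by lia.
  by move/procedure_leL; move: bm; rewrite /block; lia.
have mN : (m < N)%N by have := block_lt bm; lia.
rewrite (bigD1_seq m) ?iota_uniq ?mem_index_iota ?nm//=.
rewrite big1 => [|i im]; first by rewrite addr0 /eblock bm.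
rewrite /eblock; case: ifP => // bi; move: im.
by rewrite (block_uniq bi bm) eqxx.
Qed.

(* The differences [eblock m (j - p) - eblock m j] are at most [eta m] in absolute value
   and have nonpositive sum. As [eps] decreases on the block and [p <= l m], they are
   negative only on ]l m, 2 l m], where [eps] sums to less than [eta m]. *)
Lemma block_jump m p N : (0 < m)%N -> (p <= l m)%N ->
  \sum_(0 <= j < N) (eblock m (j - p)%N - eblock m j) ^+ 2 <= 2 * eta m ^+ 2.
Proof.
move=> m0 pl; have [ge0 dec lt] := block_step m0.
have [_ _ /(_ m m0)[_ [l2 _ es _ _]]] := heps.
pose neg j : R := if (l m < j <= 2 * l m)%N then eps j%:Z else 0.
have neg0 j : 0 <= neg j by rewrite /neg; case: ifP => // _; exact: eps_ge0.
have e0 j : (j <= l m)%N -> eblock m j = 0.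
  by rewrite leqNgt /eblock => jl; case: ifP => // /and3P[_]; rewrite (negPf jl).
have hneg j : eblock m j - eblock m (j - p)%N <= neg j.
  have [jl|lj] := leqP j (l m).
    by rewrite !e0 ?subr0//; lia.
  have [j2|j2] := leqP j (2 * l m).
    by rewrite /neg lj j2 lerBlDr (le_trans (eblock_le _ _))// lerDl eblock_ge0.
  rewrite /neg lj leqNgt j2/= subr_le0.
  rewrite {1}/eblock; case: ifP => [bj|_]; last exact: eblock_ge0.
  have bjp : block m (j - p)%N by move: bj; rewrite /block; lia.
  by rewrite /eblock bjp; apply: dec => //; exact: leq_subr.
have sneg : \sum_(0 <= j < N) neg j <= eta m.
  apply: (@le_trans _ _ (\sum_(0 <= j < (2 * l m).+1) neg j)).
    have h i : (2 * l m < i)%N -> neg i = 0.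
      by move=> ?; rewrite /neg leqNgt; case: ifP => //; lia.
    have [NN|NN] := leqP N (2 * l m).+1.
      by rewrite [leRHS](big_cat_nat (n := N))//= lerDl sumr_ge0.
    rewrite (big_cat_nat (n := (2 * l m).+1))//=; last exact: ltnW.
    rewrite -[leRHS]addr0 lerD2l big_nat big1// => i hi; apply: h; lia.
  rewrite (big_cat_nat (n := (l m).+1))//=; last lia.
  rewrite big_nat big1 => [|i hi]; last by rewrite /neg ltnNge -ltnS; case: ifP => //; lia.
  rewrite add0r ltW//; apply: le_lt_trans es; apply: ler_sum_nat => i hi.
  by rewrite /neg; case: ifP => // _; exact: eps_ge0.
have ssum : \sum_(0 <= j < N) eblock m (j - p)%N <= \sum_(0 <= j < N) eblock m j.
  have [Np|pN] := leqP N p.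
    rewrite big_nat big1 => [|i hi]; first by rewrite sumr_ge0// => *; exact: eblock_ge0.
    by rewrite e0//; lia.
  rewrite (big_cat_nat (n := p))//=; last exact: ltnW.
  rewrite big_nat big1 => [|i hi]; last by rewrite e0//; lia.
  rewrite add0r -{1}[p]add0n big_addn.
  under eq_bigr do rewrite addnK.
  rewrite [leRHS](big_cat_nat (n := (N - p)%N))//=; last exact: leq_subr.
  by rewrite lerDl sumr_ge0// => *; exact: eblock_ge0.
(* For a difference x one has x^2 <= eta m |x|, and |x| is x plus twice its negative part, which is
   at most [neg j]. *)
apply: (@le_trans _ _ (\sum_(0 <= j < N) eta m *
   ((eblock m (j - p)%N - eblock m j) + 2 * neg j))).
  apply: ler_sum => j _.
  have a0 := eblock_ge0 m j; have b0 := eblock_ge0 m (j - p).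
  have a1 := ltW (eblock_lt j m0); have b1 := ltW (eblock_lt (j - p)%N m0).
  have h := hneg j; have n0 := neg0 j.
  move: a0 b0 a1 b1 h n0; move: (eblock m j) (eblock m (j - p)%N) (neg j) (eta m).
  move=> a b c e a0 b0 a1 b1 h n0.
  have [ab|ab] := leP a b.
    have : (b - a) * (b - a) <= e * (b - a) by apply: ler_wpM2r; lra.
    have : 0 <= e * c by apply: mulr_ge0; lra.
    lra.
  have : (a - b) * (a - b) <= e * (a - b) by apply: ler_wpM2r; lra.
  have : e * (a - b) <= e * c by apply: ler_wpM2l; lra.
  lra.
rewrite -mulr_sumr big_split/= -mulr_sumr sumrB expr2.
rewrite [leRHS]mulrCA; apply: ler_wpM2l; first exact/ltW/eta_gt0.
lra.
Qed.

(** Cutting into blocks only increases the squares: the pure squares agree, since an index lies in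
    at most one block, and the products across different blocks, which are nonnegative, are no
    longer subtracted. The condition on [p] keeps j - p beyond [L n.-1], where only blocks from [n]
    on matter. *)
Lemma jump_sum n p N : (0 < n)%N -> (p + L n.-1 <= l n)%N ->
  \sum_((l n).+1 <= j < N) (eps (j%:Z - p%:Z) - eps j%:Z) ^+ 2 <=
  2 * \sum_(n <= m < N) eta m ^+ 2.
Proof.
move=> n0 pl.
apply: (@le_trans _ _ (\sum_((l n).+1 <= j < N) \sum_(n <= m < N)
     (eblock m (j - p)%N - eblock m j) ^+ 2)).
  apply: ler_sum_nat => j /andP[lj jN].
  have -> : j%:Z - p%:Z = (j - p)%N%:Z by lia.
  have h1 : (L n.-1 < j - p < N)%N by lia.
  have h2 : (L n.-1 < j < N)%N by lia.
  under eq_bigr do rewrite sqrrB.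
  rewrite sqrrB big_split/= sumrB.
  rewrite (@sum_eblock (fun x => x ^+ 2) n N _ _ n0 h1) ?expr0n//.
  rewrite (@sum_eblock (fun x => x ^+ 2) n N _ _ n0 h2) ?expr0n//.
  rewrite lerD2r lerD2l lerN2 sumrMnl lerMn2r.
  rewrite -[X in _ <= X * _](@sum_eblock id n N _ erefl n0 h1) mulr_suml.
  apply: ler_sum => m _.
  by rewrite ler_wpM2l// ?eblock_ge0// eblock_le.
rewrite exchange_big/= mulr_sumr; apply: ler_sum_nat => m /andP[nm mN].
have m0 : (0 < m)%N by lia.
have plm : (p <= l m)%N.
  apply: (@leq_trans (l n)); first lia.
  case: m nm {mN} m0 => // m nm _; have [->//|nm'] := eqVneq n m.+1.
  have := procedure_ltLl m; have := @procedure_leL n m; have := procedure_ltlL n0; lia.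
apply: le_trans (block_jump N m0 plm).
have [NN|NN] := leqP (l n).+1 N.
  rewrite [leRHS](big_cat_nat (n := (l n).+1))//= lerDr sumr_ge0// => *.
  exact: sqr_ge0.
by rewrite big_geq ?(ltnW NN)// sumr_ge0// => *; exact: sqr_ge0.
Qed.

Lemma uniq_subseq_sum (g : int -> R) s t : (forall j, 0 <= g j) -> uniq s ->
  uniq t -> {subset s <= t} -> \sum_(j <- s) g j <= \sum_(j <- t) g j.
Proof.
move=> g0 us ut st; rewrite [leRHS](bigID (mem s))/= -[X in _ <= X + _]big_filter.
rewrite [X in _ <= X + _](perm_big s) ?lerDl ?sumr_ge0//.
apply: uniq_perm => //; first exact: filter_uniq.
by move=> j; rewrite mem_filter /=; apply/andP/idP => [[]//|js]; split => //; exact: st.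
Qed.

Lemma nat_sum_bound (g : int -> R) s a : (forall j, 0 <= g j) -> uniq s ->
  (forall j, j \in s -> j <= a%:Z -> g j = 0) ->
  exists N, \sum_(j <- s) g j <= \sum_(a.+1 <= j < N) g j%:Z.
Proof.
move=> g0 us gs; pose N := (\max_(j <- s) absz j).+1; exists N.
rewrite (bigID (fun j => j <= a%:Z))/= big_seq_cond big1 ?add0r => [|j /andP[]]; last exact: gs.
rewrite -big_filter -[leRHS](big_map Posz predT g); apply: uniq_subseq_sum => //.
- exact: filter_uniq.
- by rewrite map_inj_uniq ?iota_uniq// => i j [].
- move=> j; rewrite mem_filter -ltNge => /andP[aj js]; apply/mapP; exists (absz j); last by lia.
  rewrite mem_index_iota; apply/andP; split; first lia.
  by rewrite /N ltnS; exact: leq_bigmax_seq.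
Qed.

Lemma eta_tail (e : R) : 0 < e -> exists n0, forall n N, (n0 <= n)%N ->
  \sum_(n <= m < N) eta m ^+ 2 <= e.
Proof.
move=> e0; have /cauchy_cvgP/cauchy_seriesP/(_ _ e0) := eta_l2.
case=> -[A B] /= [[a _ hA] [b _ hB]] AB; exists (maxn a b) => n N nn.
have [Nn|nN] := leqP N n; first by rewrite big_geq// ltW.
have := AB (n, N); rewrite /= => /(_ _)/ltW h; apply: le_trans (h _).
  exact: ler_norm.
by split; [apply: hA|apply: hB] => /=; lia.
Qed.

(** One [n0] serves all [p] allowed at stage [n]: the return times of step 1 vary with the cylinder
    and with its pieces, so uniformity in [p] is essential. *)
Lemma jump_sum_small (e : R) : 0 < e -> exists n0, forall n p, (n0 <= n)%N ->
  (0 < n)%N -> (p + L n.-1 <= l n)%N -> forall s, uniq s ->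
  (forall j, j \in s -> j <= - (l n)%:Z \/ (l n)%:Z < j) ->
  \sum_(j <- s) (eps (j - p%:Z) - eps j) ^+ 2 <= e.
Proof.
move=> e0; have e20 : 0 < e / 2 by rewrite divr_gt0.
have [n0 hn0] := eta_tail e20.
exists n0 => n p nn npos pl s us hs.
have [N hN] : exists N, \sum_(j <- s) (eps (j - p%:Z) - eps j) ^+ 2 <=
  \sum_((l n).+1 <= j < N) (eps (j%:Z - p%:Z) - eps j%:Z) ^+ 2.
  apply: (@nat_sum_bound (fun j => (eps (j - p%:Z) - eps j) ^+ 2)) => //.
    by move=> j; exact: sqr_ge0.
  move=> j /hs hj jl; have j0 : j <= 0 by lia.
  by rewrite !eps_le0 ?subrr ?expr0n//; lia.
apply: (le_trans hN); apply: (le_trans (jump_sum N npos pl)).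
by have := hn0 n N nn; lra.
Qed.

(** The case [n = 1], [p = 1] of [jump_sum]. As [eps] vanishes up to [l 1], the indices below
    contribute nothing. *)
Lemma jump_sum_bounded : exists K, forall s, uniq s ->
  \sum_(j <- s) (eps (j - 1) - eps j) ^+ 2 <= K.
Proof.
have [n0 hn0] := eta_tail ltr01.
have l2 : (1 < l 1)%N by have := procedure_ltLl 0; rewrite procedure_L0.
exists (2 * (\sum_(1 <= m < n0.+1) eta m ^+ 2 + 1)) => s us.
have [N hN] : exists N, \sum_(j <- s) (eps (j - 1) - eps j) ^+ 2 <=
  \sum_((l 1).+1 <= j < N) (eps (j%:Z - 1%:Z) - eps j%:Z) ^+ 2.
  apply: (@nat_sum_bound (fun j => (eps (j - 1) - eps j) ^+ 2)) => //.
    by move=> j; exact: sqr_ge0.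
  have e0 i : (i <= l 1)%N -> eps i%:Z = 0.
    move=> il; apply/eqP; rewrite -[_ == _]negbK; apply/negP => /eps_block[m bm].
    case: m bm => // m bm; have := procedure_ltLl m; have := @procedure_leL 0 m (leq0n m).
    case: m bm => [|m] /and3P[_ b1 b2]; first lia.
    have := @procedure_leL 1 m.+1 isT; have := @procedure_ltlL 1 isT; lia.
  have e0' i : i <= (l 1)%:Z -> eps i = 0.
    by case: i => i il; [rewrite e0|rewrite eps_le0].
  by move=> j _ jl; rewrite !e0' ?subrr ?expr0n//; lia.
apply: (le_trans hN); apply: (le_trans (@jump_sum 1 1 N isT _)).
  by rewrite /= procedure_L0; lia.
rewrite ler_pM2l//; have [Nn|nN] := leqP N n0.+1.
  apply: (@le_trans _ _ (\sum_(1 <= m < n0.+1) eta m ^+ 2)); last by rewrite lerDl.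
  have [N0|N0] := leqP N 1; first by rewrite big_geq// sumr_ge0// => *; exact: sqr_ge0.
  rewrite [leRHS](big_cat_nat (n := N))//=; last exact: ltnW.
  by rewrite lerDl sumr_ge0// => *; exact: sqr_ge0.
rewrite (big_cat_nat (n := n0.+1))//=; last exact: ltnW.
by rewrite lerD2l hn0.
Qed.

(** Each stage adds more than 1 to the sum of squares, and the blocks from stage a + 1 on lie beyond
    [a]. *)
Lemma energy (a : nat) (V : R) : exists s : seq int,
  [/\ uniq s, forall j, j \in s -> a%:Z < j & V <= \sum_(j <- s) eps j ^+ 2].
Proof.
have [k hk] : exists k : nat, V <= k%:R.
  exists (Num.bound `|V|); apply: (le_trans (ler_norm V)).
  exact/ltW/archi_boundP.
pose n0 := a.+1.
have grow i : i%:R <= \sum_((l n0).+1 <= j < (L (n0 + i)).+1) eps j%:Z ^+ 2.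
  elim: i => [|i IH]; first by rewrite sumr_ge0// => *; exact: sqr_ge0.
  rewrite addnS -[i.+1]addn1 natrD; have [_ _ /(_ (n0 + i).+1 isT)[_ [l2 _ _ _ sq]]] := heps.
  have lt1 := procedure_ltLl (n0 + i).
  have lt2 := @procedure_ltlL n0 isT; have lt3 := @procedure_leL n0 (n0 + i) (leq_addr _ _).
  rewrite (big_cat_nat (n := (L (n0 + i)).+1))//=; [|lia|lia].
  rewrite lerD//; apply/ltW/(lt_le_trans sq).
  rewrite [leRHS](big_cat_nat (n := (l (n0 + i).+1).+1))//=; [|lia|lia].
  by rewrite lerDr sumr_ge0// => *; exact: sqr_ge0.
exists [seq Posz j | j <- index_iota (l n0).+1 (L (n0 + k)).+1]; split.
- by rewrite map_inj_uniq ?iota_uniq// => i j [].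
- move=> j /mapP[i]; rewrite mem_index_iota => /andP[h _] ->.
  have := procedure_ltLl a; have := procedure_L_gt a; rewrite /n0 in h; lia.
- by rewrite (le_trans hk)// big_map.
Qed.

End procedure_arithmetic.

(** * Radon-Nikodym cocycles and the measure t^-2 dt *)

Section radon_nikodym_version.
Context d (X : measurableType d) (R : realType) (mu : probability X R).
Context (T T' : X -> X) (mT : measurable_fun setT T) (mT' : measurable_fun setT T').
Hypothesis TK : cancel T T'.
Hypothesis T'K : cancel T' T.
Local Open Scope ereal_scope.

Lemma image_preimage_can A : T @` A = T' @^-1` A.
Proof.
apply/seteqP; split => [x [y Ay <-]|x Ax] /=; first by rewrite TK.
by exists (T' x) => //; rewrite T'K.
Qed.

Let mu' : probability X R := image_measure mu mT'.

Let mu'E A : mu' A = mu (T @` A).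
Proof. by rewrite image_preimage_can. Qed.

Section change_of_variables.
Context (f : X -> R) (hf : RN_version mu T f).

Let mf : measurable_fun setT f. Proof. by case: hf. Qed.
Let f_gt0 x : (0 < f x)%R. Proof. by case: hf. Qed.
Let muT A : measurable A -> mu (T @` A) = \int[mu]_(x in A) (f x)%:E.
Proof. by case: hf => _ _; apply. Qed.

Lemma RN_version_dominates : mu' `<< mu.
Proof.
apply/null_content_dominatesP => A mA A0.
by rewrite mu'E muT// null_set_integral//; apply/measurable_EFinP/measurable_funTS.
Qed.

Lemma RN_version_integrable : mu.-integrable setT (EFin \o f).
Proof.
apply/integrableP; split; first exact/measurable_EFinP.
under eq_integral do rewrite /= gtr0_norm//.
rewrite -muT// -mu'E; apply: le_lt_trans (ltry 1).
by rewrite (@probability_setT _ _ _ mu').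
Qed.

(** [f] agrees almost everywhere with the Radon-Nikodym derivative [g], as both have the same
    integral over every measurable set; for [g] the change of variables is known. *)
Lemma RN_version_change (u : X -> \bar R) : measurable_fun setT u ->
  (forall x, 0 <= u x) -> \int[mu]_x (u (T x) * (f x)%:E) = \int[mu]_x u x.
Proof.
move=> mu_ u0; have muT_ : measurable_fun setT (fun x => u (T x)).
  exact: measurableT_comp mu_ mT.
have dom := RN_version_dominates.
pose g := Radon_Nikodym_SigmaFinite.f mu' mu.
have mg : measurable_fun setT g.
  exact: measurable_int (Radon_Nikodym_SigmaFinite.f_integrable dom).
have fg : ae_eq mu setT (EFin \o f) g.
  apply: integral_ae_eq => //; first exact: RN_version_integrable.
  move=> E _ mE; rewrite -Radon_Nikodym_SigmaFinite.f_integral//.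
  by rewrite -muT// -mu'E.
transitivity (\int[mu]_x (u (T x) * g x)).
  apply: ge0_ae_eq_integral => //.
  - by apply: emeasurable_funM => //; exact/measurable_EFinP.
  - exact: emeasurable_funM.
  - by move=> x _; rewrite mule_ge0// lee_fin ltW.
  - by move=> x _; rewrite mule_ge0// Radon_Nikodym_SigmaFinite.f_ge0.
  - exact: (ae_eqe_mul2l _ fg).
rewrite (@Radon_Nikodym_SigmaFinite.change_of_variables _ _ _ mu' mu dom (fun x => u (T x)) setT)//.
rewrite (ge0_integral_pushforward mT')//=.
by apply: eq_integral => x _ /=; rewrite T'K.
Qed.

End change_of_variables.

(** The derivative [g] may vanish, but only on a null set: the image of its zero set [N] is null, so
    [H2] applies. Adding the indicator of [N] makes it positive everywhere. *)
Lemma RN_version_exists : (forall A, measurable A -> mu A = 0 -> mu (T @` A) = 0) ->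
  (forall A, measurable A -> mu (T @` A) = 0 -> mu A = 0) ->
  exists f, RN_version mu T f.
Proof.
move=> H1 H2.
have dom : mu' `<< mu.
  by apply/null_content_dominatesP => A mA A0; rewrite mu'E H1.
pose g := Radon_Nikodym_SigmaFinite.f mu' mu.
have ig := Radon_Nikodym_SigmaFinite.f_integrable dom.
have mg : measurable_fun setT g by exact: measurable_int ig.
have g0 x : 0 <= g x by exact: Radon_Nikodym_SigmaFinite.f_ge0.
have gfin x : g x \is a fin_num by exact: Radon_Nikodym_SigmaFinite.f_fin_num.
have gE A : measurable A -> mu (T @` A) = \int[mu]_(x in A) g x.
  by move=> mA; rewrite -mu'E; exact: Radon_Nikodym_SigmaFinite.f_integral.
pose N := [set x | g x = 0].
have mN : measurable N.
  rewrite (_ : N = setT `&` (g @^-1` [set 0])); last by rewrite setTI.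
  exact: mg.
have muN : mu N = 0.
  apply: H2 => //; rewrite gE//.
  by apply: integral0_eq => x.
pose f x := (fine (g x) + \1_N x)%R.
have mf : measurable_fun setT f.
  apply: measurable_funD; last exact: measurable_indic.
  exact: measurableT_comp mg.
exists f; split => //.
  move=> x; rewrite /f indicE; case: (boolP (x \in N)) => xN.
    by rewrite ltr_wpDl// fine_ge0.
  rewrite addr0 fine_gt0// lt0e g0 andbT; apply/andP; split.
    by apply/eqP => gx; move/negP: xN; apply; rewrite inE.
  by rewrite -ge0_fin_numE.
move=> A mA; rewrite gE//.
apply: ge0_ae_eq_integral => //.
- exact: measurable_funTS.
- by apply/measurable_EFinP; exact: measurable_funTS.
- by move=> x _; rewrite lee_fin /f addr_ge0// fine_ge0.
exists N; split => // x /= /not_implyP[_ gx]; apply: contrapT => xN; apply: gx.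
by rewrite /f indicE memNset// addr0 fineK.
Qed.

End radon_nikodym_version.

Section radon_nikodym_iterate.
Context d (X : measurableType d) (R : realType) (mu : probability X R).
Context (T T' : X -> X) (mT : measurable_fun setT T) (mT' : measurable_fun setT T').
Hypothesis TK : cancel T T'.
Hypothesis T'K : cancel T' T.
Context (f : X -> R) (hf : RN_version mu T f).
Local Open Scope ereal_scope.

Lemma measurable_iter (S : X -> X) i : measurable_fun setT S ->
  measurable_fun setT (iter i S).
Proof.
by move=> mS; elim: i => [|i IH]; [exact: measurable_id|exact: measurableT_comp mS IH].
Qed.

Lemma iter_can (S S' : X -> X) i : cancel S S' -> cancel (iter i S) (iter i S').
Proof. by move=> SK; elim: i => // i IH x; rewrite iterSr iterS SK IH. Qed.

(** The chain rule for densities. *)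
Lemma RN_version_iter p :
  RN_version mu (iter p T) (fun x => \prod_(i < p) f (iter i T x))%R.
Proof.
have [mf f0 hA] := hf.
elim: p => [|p IH].
  split.
  - by under eq_fun do rewrite big_ord0; exact: measurable_cst.
  - by move=> x; rewrite big_ord0.
  - move=> A mA; under eq_integral do rewrite big_ord0.
    by rewrite integral_cst// mul1e image_id.
have [mfp fp0 _] := IH.
split.
- by apply: measurable_prod => i _; exact: measurableT_comp mf (measurable_iter _ _).
- by move=> x; apply: prodr_gt0.
move=> A mA; have c1 := @iter_can _ _ p TK; have c2 := @iter_can _ _ p T'K.
have E : iter p.+1 T @` A = T @` (iter p T @` A) by rewrite -image_comp.
have mTA : measurable (iter p T @` A).
  by rewrite (image_preimage_can c1 c2) -[X in measurable X]setTI; exact: measurable_iter.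
rewrite E hA// integral_mkcond.
rewrite -(RN_version_change (measurable_iter p mT) (measurable_iter p mT') c1 c2 IH)//; last 2 first.
- by apply/measurable_restrict => //; rewrite setTI; apply/measurable_EFinP/measurable_funTS.
- by move=> x; rewrite /patch; case: ifP => // _; rewrite lee_fin ltW.
rewrite [RHS]integral_mkcond; apply: eq_integral => x _.
rewrite /patch; have -> : (iter p T x \in iter p T @` A) = (x \in A).
  rewrite (image_preimage_can c1 c2); apply/idP/idP; rewrite !inE /= ?c1//.
case: ifP => _; last by rewrite mul0e.
by rewrite big_ord_recr/= EFinM muleC.
Qed.

End radon_nikodym_iterate.

Section inverse_measure.
Context (R : realType).
Local Open Scope ereal_scope.
Local Notation TR := (measurableTypeR R).
Local Notation leb := (@lebesgue_measure R).

Lemma measurable_mulc (c : R) : measurable_fun setT ( *%R c : TR -> TR).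
Proof. exact: mulrl_measurable. Qed.

Lemma preimage_measurable d d' (T : measurableType d) (T' : measurableType d')
  (g : T -> T') A : measurable_fun setT g -> measurable A -> measurable (g @^-1` A).
Proof. by move=> mg mA; rewrite -[X in measurable X]setTI; exact: mg. Qed.

Lemma lebesgue_scale (c : R) (A : set TR) : (0 < c)%R -> measurable A ->
  leb ( *%R c @^-1` A) = (c^-1)%:E * leb A.
Proof.
move=> c0 mA.
have c0' : (0 <= c)%R by exact: ltW.
pose m : {measure set TR -> \bar R} :=
  mscale (NngNum c0') (image_measure leb (measurable_mulc c)).
have -> : leb A = m A; last first.
  by rewrite /m /mscale/= muleA -EFinM mulVf ?gt_eqF// mul1e.
apply: lebesgue_measure_unique => // _ [[a b] _ <-] /=.
rewrite /m /mscale /image_measure /pushforward/=.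
have -> : *%R c @^-1` `]a, b] = `](a / c)%R, (b / c)%R]%classic.
  by apply/seteqP; split => x /=; rewrite !in_itv/= ltr_pdivrMr// ler_pdivlMr// mulrC.
rewrite !lebesgue_measure_itv/= !lte_fin ltr_pM2r ?invr_gt0//.
case: ifP => _; last by rewrite mule0.
rewrite -!EFinB -EFinM -mulrBl mulrCA divff ?gt_eqF// mulr1//.
Qed.

(** Agrees with 1/t for t > 0, where all the mass lies; measurability is that of a power
    function. *)
Definition inv_pos (t : TR) : R := (t `^ (-1))%R.

Lemma measurable_inv_pos : measurable_fun setT inv_pos.
Proof. exact: measurable_powR. Qed.

(* The image of Lebesgue measure on ]0, +oo[ under t |-> 1/t, that is t^-2 dt. *)
Definition inv_leb : set R -> \bar R :=
  image_measure (mrestr leb (measurable_itv `]0%R, +oo[)) measurable_inv_pos.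

HB.instance Definition _ := Measure.copy inv_leb
  (image_measure (mrestr leb (measurable_itv `]0%R, +oo[)) measurable_inv_pos).

Lemma inv_lebE A : inv_leb A = leb [set u | (0 < u)%R /\ A (u^-1)%R].
Proof.
rewrite /inv_leb /image_measure /pushforward /mrestr; congr (leb _).
apply/seteqP; split => u /=; rewrite in_itv/= andbT /inv_pos.
  by move=> [Au u0]; split => //; rewrite -powR_inv1// ltW.
by move=> [u0 Au]; split => //; rewrite powR_inv1// ltW.
Qed.

Lemma inv_leb_nonpos : inv_leb `]-oo, 0%R] = 0.
Proof.
rewrite inv_lebE (_ : mkset _ = set0) ?measure0//; apply/seteqP; split => u //=.
by rewrite in_itv/= => -[u0]; rewrite leNgt invr_gt0 u0.
Qed.

Lemma inv_leb_ray (b : R) : (0 < b)%R -> inv_leb `]b, +oo[ = (b^-1)%:E.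
Proof.
move=> b0; rewrite inv_lebE (_ : mkset _ = `]0%R, (b^-1)%R[%classic); last first.
  apply/seteqP; split => u /=; rewrite !in_itv/= ?andbT.
    by move=> [u0 bu]; rewrite u0/= -[ltLHS]invrK ltf_pV2// posrE invr_gt0.
  by move=> /andP[u0 ub]; split => //; rewrite -[ltLHS]invrK ltf_pV2// posrE invr_gt0.
by rewrite lebesgue_measure_itv/= lte_fin invr_gt0 b0 -EFinB subr0.
Qed.

(** Inversion turns the dilation by [c] into that by 1/c, so the factor is [c] and not 1/c as for
    Lebesgue measure. This is what compensates for the density in the Maharam extension. *)
Lemma inv_leb_scale (c : R) (A : set R) : (0 < c)%R -> measurable A ->
  inv_leb ( *%R c @^-1` A) = c%:E * inv_leb A.
Proof.
move=> c0 mA; rewrite !inv_lebE.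
pose B : set TR := [set u | (0 < u)%R /\ A (u^-1)%R].
have mB : measurable B.
  have -> : B = inv_pos @^-1` A `&` `]0%R, +oo[.
    apply/seteqP; split => u /=; rewrite in_itv/= andbT /inv_pos.
      by move=> [u0 Au]; split => //; rewrite powR_inv1// ltW.
    by move=> [Au u0]; split => //; rewrite -powR_inv1// ltW.
  by apply: measurableI => //; exact: preimage_measurable measurable_inv_pos _.
rewrite -/B -[c in RHS]invrK -lebesgue_scale ?invr_gt0//; congr (leb _).
apply/seteqP; split => u; rewrite /B /=.
  by move=> [u0 Au]; rewrite mulr_gt0 ?invr_gt0// invfM invrK.
by rewrite pmulr_rgt0 ?invr_gt0// invfM invrK.
Qed.

Let inv_leb_sigma_finite : sigma_finite setT inv_leb.
Proof.
exists (fun n => `]-oo, 0%R] `|` `](n.+1%:R^-1)%R, +oo[).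
  apply/seteqP; split => // t _; have [t0|t0] := leP t 0%R.
    by exists 0%N => //; left; rewrite /= in_itv.
  exists (Num.trunc t^-1)%R => //; right; rewrite /= in_itv/= andbT.
  rewrite -[ltRHS]invrK ltf_pV2 ?posrE ?invr_gt0//.
  by apply: truncnS_gt.
move=> n; split; first exact: measurableU.
apply: (@le_lt_trans _ _ (inv_leb `]-oo, 0%R] + inv_leb `](n.+1%:R^-1)%R, +oo[)).
  exact: measureU2.
by rewrite inv_leb_nonpos add0e inv_leb_ray ?invr_gt0// ltry.
Qed.

HB.instance Definition _ :=
  Measure_isSigmaFinite.Build _ _ _ inv_leb inv_leb_sigma_finite.

(* Both measures are quasi-invariant under dilations; Fubini on
   {(t, c) | c t \in A} shows that they have the same null sets. *)
Lemma inv_leb_null (A : set R) : measurable A -> inv_leb A = 0 -> lebesgue_pos A = 0.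
Proof.
move=> mA A0; rewrite /lebesgue_pos /mrestr.
pose B : set TR := A `&` `]0%R, +oo[.
have mB : measurable B by exact: measurableI.
have B0 : inv_leb B = 0.
  apply/eqP; rewrite -measure_le0 -A0; apply: le_measure; rewrite ?inE//.
  by move=> x [].
pose D : set (R * TR) := [set z | B (z.2 * z.1)%R].
have mD : measurable D.
  have : measurable_fun setT (fun z : R * TR => z.2 * z.1)%R.
    exact: measurable_funM.
  by move=> h; exact: preimage_measurable h mB.
have H1 : \int[leb]_c inv_leb (ysection D c) = 0.
  apply: integral0_eq => c _; have [c0|c0] := ltP 0%R c.
    rewrite (_ : ysection D c = *%R c @^-1` B) ?inv_leb_scale ?B0 ?mule0//.
    by apply/seteqP; split => t; rewrite /ysection /= inE.
  apply/eqP; rewrite -measure_le0 -inv_leb_nonpos le_measure ?inE//.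
    exact: measurable_ysection.
  move=> t; rewrite /ysection /= inE /D /B/= !in_itv/= andbT => -[_ ct].
  by rewrite leNgt; apply: contraTN ct => t0; rewrite -leNgt pmulr_lle0.
have H2 : \int[inv_leb]_t leb (xsection D t) = 0.
  rewrite -[RHS]H1.
  have := @indic_fubini_tonelli _ _ _ _ _ inv_leb leb D mD.
  by rewrite indic_fubini_tonelli_FE// indic_fubini_tonelli_GE.
apply/eqP; apply: contrapT => /negP B1.
have lB : 0 < leb B by rewrite lt0e B1 measure_ge0.
have f0 t : (0 < t)%R -> 0 < leb (xsection D t).
  move=> t0; rewrite (_ : xsection D t = *%R t @^-1` B) ?lebesgue_scale//.
    by rewrite mule_gt0// lte_fin invr_gt0.
  by apply/seteqP; split => c; rewrite /xsection /= inE /D/= mulrC.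
have mf : measurable_fun setT (fun t : R => leb (xsection D t)).
  exact: (measurable_fun_xsection leb mD).
have [/(_ _)[]] := ae_eq_integral_abs inv_leb measurableT mf.
  by under eq_integral do rewrite gee0_abs//.
move=> N [mN N0 hN] _; have := inv_leb_ray ltr01.
have -> : inv_leb `]1%R, +oo[ = 0.
  apply/eqP; rewrite -measure_le0 -N0 le_measure ?inE//.
  move=> t; rewrite /= in_itv/= andbT => t1; apply: hN => /=; apply/not_implyP.
  by split => //; apply/eqP; rewrite gt_eqF// f0// (lt_trans ltr01).
by rewrite invr1 => /esym/eqP; rewrite onee_eq0.
Qed.

End inverse_measure.

(** * Maximal inequality and recurrence *)

Section measure_preserving.
Context d (Y : measurableType d) (R : realType) (m : {measure set Y -> \bar R}).
Context (S : Y -> Y) (mS : measurable_fun setT S).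
Hypothesis mpS : forall A, measurable A -> m (S @^-1` A) = m A.
Local Open Scope ereal_scope.

Let mSn n : measurable_fun setT (iter n S). Proof. exact: measurable_iter. Qed.

Let mpre n A : measurable A -> measurable (iter n S @^-1` A).
Proof. exact: preimage_measurable. Qed.

Lemma measure_preserving_iter n A : measurable A -> m (iter n S @^-1` A) = m A.
Proof.
elim: n A => // n IH A mA.
rewrite (_ : iter n.+1 S @^-1` A = iter n S @^-1` (S @^-1` A)).
  by rewrite IH ?mpS//; exact: preimage_measurable.
by [].
Qed.

Lemma measure_preserving_integral (g : Y -> \bar R) : measurable_fun setT g ->
  (forall y, 0 <= g y) -> \int[m]_y g (S y) = \int[m]_y g y.
Proof.
move=> mg g0.
rewrite [RHS](eq_measure_integral (image_measure m mS)); last first.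
  by move=> A mA _; rewrite -mpS.
by rewrite (ge0_integral_pushforward mS).
Qed.

Section hopf.
Context (V Q : set Y) (mV : measurable V) (mQ : measurable Q) (Voo : m V < +oo).

(** Off [hopf_set] an orbit spends at most a quarter of its visits to [Q] in [V]. The later
    comparison of two orbits needs a constant above 2; 4 keeps the count simple. *)
Let g (y : Y) : R := (4 * \1_V y - \1_Q y)%R.

(** The maximum of 0 and of the first [N] partial sums of [g] along the orbit. In this recursive
    form Garsia's identity holds by computation. *)
Fixpoint hopf_max N (y : Y) : R :=
  if N is N'.+1 then Num.max 0%R (g y + hopf_max N' (S y))%R else 0%R.

Definition hopf_set := \bigcup_N [set y | (0 < hopf_max N y)%R].

Lemma hopf_max_ge0 N y : (0 <= hopf_max N y)%R.
Proof. by case: N => //= N; rewrite le_max lexx. Qed.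

Let mg : measurable_fun setT g.
Proof.
by apply: measurable_funB; [apply: measurable_funM => //; exact: measurable_indic|
  exact: measurable_indic].
Qed.

Lemma measurable_hopf_max N : measurable_fun setT (hopf_max N).
Proof.
elim: N => [|N IH]; first exact: measurable_cst.
apply: measurable_maxr; first exact: measurable_cst.
by apply: measurable_funD => //; exact: measurableT_comp IH mS.
Qed.

Lemma hopf_max_nd N y : (hopf_max N y <= hopf_max N.+1 y)%R.
Proof.
elim: N y => [|N IH] y; first exact: hopf_max_ge0.
rewrite /= ge_max le_max lexx/= le_max; apply/orP; right.
by rewrite lerD2l; exact: IH.
Qed.

Lemma hopf_sum N y : (\sum_(n < N) g (iter n S y) <= hopf_max N y)%R.
Proof.
elim: N y => [|N IH] y; first by rewrite big_ord0.
rewrite big_ord_recl /= le_max; apply/orP; right; rewrite lerD2l.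
apply: le_trans (IH (S y)); rewrite le_eqVlt; apply/orP; left; apply/eqP.
by apply: eq_bigr => i _; rewrite -iterSr.
Qed.

Lemma measurable_hopf_pos N : measurable [set y | (0 < hopf_max N y)%R].
Proof.
rewrite (_ : mkset _ = hopf_max N @^-1` `]0%R, +oo[).
  exact: preimage_measurable (measurable_hopf_max N) _.
by apply/seteqP; split => y /=; rewrite in_itv/= andbT.
Qed.

Lemma measurable_hopf_set : measurable hopf_set.
Proof. by apply: bigcupT_measurable => N; exact: measurable_hopf_pos. Qed.

Let I N := \int[m]_y (hopf_max N y)%:E.

Let indic_int (A : set Y) : measurable A -> \int[m]_y (\1_A y)%:E = m A.
Proof. by move=> mA; rewrite integral_indic// setIT. Qed.

Let bound_int N : \int[m]_y (hopf_max N (S y) + 4 * \1_V y)%:E = I N + 4%:E * m V.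
Proof.
under eq_integral do rewrite EFinD.
have h0 y : setT y -> 0 <= (hopf_max N (S y))%:E by rewrite lee_fin hopf_max_ge0.
have hm : measurable_fun setT (fun y => (hopf_max N (S y))%:E).
  by apply/measurable_EFinP; exact: measurableT_comp (measurable_hopf_max N) mS.
have v0 y : setT y -> 0 <= (4 * \1_V y : R)%:E by rewrite lee_fin mulr_ge0.
have vm : measurable_fun setT (fun y => (4 * \1_V y : R)%:E).
  by apply/measurable_EFinP; apply: measurable_funM => //; exact: measurable_indic.
rewrite (ge0_integralD m measurableT h0 hm v0 vm).
congr (_ + _).
  rewrite (measure_preserving_integral (g := fun y => (hopf_max N y)%:E))//.
    by apply/measurable_EFinP; exact: measurable_hopf_max.
  by move=> y; rewrite lee_fin hopf_max_ge0.
under eq_integral do rewrite EFinM.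
by rewrite ge0_integralZl_EFin ?indic_int//; apply/measurable_EFinP; exact: measurable_indic.
Qed.

Let mbound N : measurable_fun setT (fun y => (hopf_max N (S y) + 4 * \1_V y)%:E).
Proof.
apply/measurable_EFinP; apply: measurable_funD.
  exact: measurableT_comp (measurable_hopf_max N) mS.
by apply: measurable_funM => //; exact: measurable_indic.
Qed.

Let I_fin N : I N \is a fin_num.
Proof.
rewrite ge0_fin_numE; last by apply: integral_ge0 => y _; rewrite lee_fin hopf_max_ge0.
elim: N => [|N IH]; first by rewrite /I integral0_eq// ltry.
apply: (@le_lt_trans _ _ (I N + 4%:E * m V)); last first.
  by apply: lte_add_pinfty => //; apply: lte_mul_pinfty.
rewrite -bound_int; apply: ge0_le_integral => //.
- by move=> y _; rewrite lee_fin hopf_max_ge0.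
- by apply/measurable_EFinP; exact: measurable_hopf_max.
move=> y _; rewrite lee_fin /= ge_max; apply/andP; split.
  by rewrite addr_ge0 ?hopf_max_ge0// mulr_ge0.
by have q0 : (0 <= \1_Q y :> R)%R by []; rewrite /g; lra.
Qed.

(* Garsia's argument: where [hopf_max N.+1] is positive it equals
   [g + hopf_max N \o S], so [hopf_max N + \1_Q <= hopf_max N \o S + 4 * \1_V]
   there; integrate, and cancel the integral of [hopf_max N]. *)
Let hopf_step N : m (Q `&` [set y | (0 < hopf_max N.+1 y)%R]) <= 4%:E * m V.
Proof.
have mM := measurable_hopf_pos N.+1; set M := mkset _ in mM *.
have mQM : measurable (Q `&` M) by exact: measurableI.
rewrite -(leeD2lE (x := I N))// -bound_int.
have -> : I N + m (Q `&` M) = \int[m]_y (hopf_max N y + \1_(Q `&` M) y)%:E.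
  rewrite -(indic_int mQM) /I -ge0_integralD//.
  - by move=> y _; rewrite lee_fin hopf_max_ge0.
  - by apply/measurable_EFinP; exact: measurable_hopf_max.
  - by apply/measurable_EFinP; exact: measurable_indic.
apply: ge0_le_integral => //.
- by move=> y _; rewrite lee_fin addr_ge0 ?hopf_max_ge0.
- by apply/measurable_EFinP; apply: measurable_funD;
    [exact: measurable_hopf_max|exact: measurable_indic].
move=> y _; rewrite lee_fin; have nd := hopf_max_nd N y.
have h0 := hopf_max_ge0 N (S y).
rewrite indicE in_setI; have [yM|yM] := boolP (y \in M); last first.
  move: yM; rewrite /M notin_setE /= => /negP; rewrite -leNgt => yM.
  rewrite andbF addr0; apply: (le_trans nd); apply: (le_trans yM).
  by rewrite addr_ge0// mulr_ge0.
move: yM; rewrite inE /M /= lt_max ltxx/= => yM.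
have E : hopf_max N.+1 y = (g y + hopf_max N (S y))%R.
  by rewrite /=; apply/max_idPr; exact: ltW.
move: nd; rewrite E /g andbT !indicE; lra.
Qed.

Lemma hopf_maximal : m (Q `&` hopf_set) <= 4%:E * m V.
Proof.
pose F N := Q `&` [set y | (0 < hopf_max N.+1 y)%R].
have mF N : measurable (F N) by apply: measurableI => //; exact: measurable_hopf_pos.
have -> : Q `&` hopf_set = \bigcup_N F N.
  apply/seteqP; split => [y [Qy [N _ hN]]|y [N _ [Qy hN]]].
    by exists N => //; split => //=; exact: lt_le_trans hN (hopf_max_nd N y).
  by split => //; exists N.+1.
have : m \o F @ \oo --> m (\bigcup_N F N).
  apply: nondecreasing_cvg_mu => //; first exact: bigcupT_measurable.
  apply/nondecreasing_seqP => N; apply/subsetPset => y [Qy hN]; split => //=.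
  exact: lt_le_trans hN (hopf_max_nd N.+1 y).
move/cvg_lim => <- //; apply: lime_le.
  apply: ereal_nondecreasing_is_cvgn; apply/nondecreasing_seqP => N /=.
  apply: le_measure; rewrite ?inE//.
  move=> y [Qy hN]; split => //=; exact: lt_le_trans hN (hopf_max_nd N.+1 y).
by apply: nearW => N; exact: hopf_step.
Qed.

Lemma hopf_setN y : ~ hopf_set y -> forall N,
  (4 * \sum_(n < N) \1_V (iter n S y) <= \sum_(n < N) \1_Q (iter n S y) :> R)%R.
Proof.
move=> yH N; rewrite -subr_le0 mulr_sumr -sumrB.
apply: le_trans (hopf_sum N y) _.
by rewrite leNgt; apply/negP => h; apply: yH; exists N.
Qed.

End hopf.

Section recurrence.
Context (Q : set Y) (mQ : measurable Q).

Definition returns : set Y := \bigcup_n (iter n.+1 S @^-1` Q).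

Definition infinitely_often : set Y := lim_sup_set (fun n => iter n S @^-1` Q).

Lemma infinitely_oftenP y : infinitely_often y <->
  forall N, exists2 n, (N <= n)%N & Q (iter n S y).
Proof.
split=> [h N|h N _]; first by have [n Nn Qn] := h N I; exists n.
by have [n Nn Qn] := h N; exists n.
Qed.

Lemma measurable_infinitely_often : measurable infinitely_often.
Proof.
apply: bigcapT_measurable => N; apply: bigcup_measurable => n _.
exact: mpre.
Qed.

Hypothesis recQ : m (Q `\` returns) = 0.

(** A point of [Q] with finitely many visits has a last one, so some iterate lies in [Q] minus
    [returns]; the preimages of this null set are null. *)
Lemma recurrent_infinitely_often : m (Q `\` infinitely_often) = 0.
Proof.
have mret : measurable returns by apply: bigcupT_measurable => n; exact: mpre.
have mW : measurable (Q `\` returns) by exact: measurableD.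
have mU : measurable (\bigcup_n (iter n S @^-1` (Q `\` returns))).
  by apply: bigcupT_measurable => n; exact: mpre.
apply/eqP; rewrite -measure_le0.
apply: (@le_trans _ _ (m (\bigcup_n (iter n S @^-1` (Q `\` returns))))).
  apply: le_measure; rewrite ?inE//.
    by apply: measurableD => //; exact: measurable_infinitely_often.
  move=> y [Qy nio]; apply: contrapT => nU; apply: nio; apply/infinitely_oftenP.
  elim=> [|N [n Nn Qn]]; first by exists 0%N.
  have [k _ Qk] : returns (iter n S y).
    by apply: contrapT => nr; apply: nU; exists n.
  exists (k.+1 + n)%N; first lia.
  by rewrite iterD.
apply: (le_trans (measure_sigma_subadditive m (fun n => mpre n mW) mU (@subset_refl _ _))).
rewrite eseries0// => n _ _ /=.
by rewrite measure_preserving_iter// recQ.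
Qed.

Hypothesis Qoo : m Q < +oo.

(** Up to the null set [B], [V] is a set [W] that never returns to itself. The parts of [W] that are
    in [Q] at time n have summable measure, so by Borel-Cantelli almost no point of [W] visits [Q]
    infinitely often, while recurrence says that almost all do. *)
Lemma wandering_null (V : set Y) : measurable V -> V `<=` Q ->
  (forall n, m (V `&` iter n.+1 S @^-1` V) = 0) -> m V = 0.
Proof.
move=> mV VQ nV.
pose B := \bigcup_n (V `&` iter n.+1 S @^-1` V).
have mB0 n : measurable (V `&` iter n.+1 S @^-1` V) by apply: measurableI => //; exact: mpre.
have mB : measurable B by exact: bigcupT_measurable.
have B0 : m B = 0.
  apply/eqP; rewrite -measure_le0.
  apply: (le_trans (measure_sigma_subadditive m mB0 mB (@subset_refl _ B))).
  by rewrite eseries0.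
pose W := V `\` B.
have mW : measurable W by exact: measurableD.
have WQ : W `<=` Q by move=> y [/VQ].
have Wn n y : W y -> ~ W (iter n.+1 S y).
  by move=> [Vy nB] [Vn _]; apply: nB; exists n.
have sumW N : \sum_(n < N) m (W `&` iter n S @^-1` Q) <= m Q.
  (* Pulling the n-th part back by N - n moves all of them into the preimage of [Q] under the N-th
     iterate, where they are disjoint because [W] never returns. *)
  pose F (n : nat) := iter (N - n) S @^-1` (W `&` iter n S @^-1` Q).
  have mF n : measurable (F n) by apply/mpre/measurableI => //; exact: mpre.
  have -> : \sum_(n < N) m (W `&` iter n S @^-1` Q) = \sum_(n < N) m (F n).
    apply: eq_bigr => n _; rewrite /F measure_preserving_iter//.
    by apply: measurableI => //; exact: mpre.
  rewrite -measure_bigsetU_ord//; last first.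
    apply/trivIsetP => i j _ _; rewrite neq_ltn.
    have disj (a b : 'I_N) : (a < b)%N -> F a `&` F b = set0.
      move=> ab; apply/seteqP; split => // y [[Wa _] [Wb _]].
      apply: (@Wn (b - a).-1 (iter (N - b) S y)) => //.
      rewrite prednK ?subn_gt0// -iterD.
      by have -> : (b - a + (N - b) = N - a)%N by have := ltn_ord b; lia.
    by move=> /orP[/disj//|/disj]; rewrite setIC.
  rewrite -(measure_preserving_iter N mQ); apply: le_measure; rewrite ?inE.
  - exact: bigsetU_measurable.
  - exact: mpre.
  rewrite -(bigcup_mkord N F) => y [n /= nN [_ Qn]].
  by move: Qn; rewrite /= -iterD subnKC// ltnW.
have W0 : m W = 0.
  pose F n := W `&` iter n S @^-1` Q.
  have mF n : measurable (F n) by apply: measurableI => //; exact: mpre.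
  have Foo : \sum_(n <oo) m (F n) < +oo.
    apply: le_lt_trans Qoo; apply: lime_le; first exact: is_cvg_nneseries.
    by apply: nearW => N; rewrite big_mkord; exact: sumW.
  have lim0 := lim_sup_set_cvg0 mF Foo.
  apply/eqP; rewrite -measure_le0.
  apply: (@le_trans _ _ (m (lim_sup_set F `|` (Q `\` infinitely_often)))).
    have mL : measurable (lim_sup_set F).
      by apply: bigcapT_measurable => N; apply: bigcup_measurable.
    apply: le_measure; rewrite ?inE//.
      by apply: measurableU => //; apply: measurableD => //; exact: measurable_infinitely_often.
    move=> y Wy; have [/infinitely_oftenP io|] := pselect (infinitely_often y); last first.
      by move=> nio; right; split => //; exact: WQ.
    by left => N _; have [n Nn Qn] := io N; exists n.
  rewrite measureU0 ?lim0 ?recurrent_infinitely_often//.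
    by apply: bigcapT_measurable => N; apply: bigcup_measurable.
  by apply: measurableD => //; exact: measurable_infinitely_often.
apply/eqP; rewrite -measure_le0.
apply: (@le_trans _ _ (m (W `|` B))).
  apply: le_measure; rewrite ?inE//; first exact: measurableU.
  by move=> y Vy; have [By|nB] := pselect (B y); [right|left].
by rewrite measureU0 ?W0.
Qed.

End recurrence.

End measure_preserving.

(** * The Maharam extension and its invariant measure *)

Section maharam_measure.
Context d (X : measurableType d) (R : realType) (mu : probability X R).
Local Open Scope ereal_scope.
Local Notation m := (mu \x inv_leb (R := R)).

Lemma maharam_measureE S : m S = \int[mu]_x inv_leb (xsection S x).
Proof. by []. Qed.

(** Ergodicity is stated with Lebesgue measure on the fibers and proved for t^-2 dt. Almost every
    fiber of a null set is null, and [inv_leb_null] applies to it. *)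
Lemma maharam_null_lebesgue (E : set (X * R)) : measurable E -> m E = 0 ->
  (mu \x lebesgue_pos (R := R)) E = 0.
Proof.
move=> mE E0.
have mf : measurable_fun setT (fun x => inv_leb (xsection E x)).
  exact: (measurable_fun_xsection (inv_leb (R := R)) mE).
have [/(_ _)[]] := ae_eq_integral_abs mu measurableT mf.
  by under eq_integral do rewrite gee0_abs//.
move=> N [mN N0 hN] _.
rewrite /product_measure1.
have EN x : ~ N x -> lebesgue_pos (xsection E x) = 0.
  move=> Nx; apply: inv_leb_null; first exact: measurable_xsection.
  by apply: contrapT => h; apply: Nx; apply: hN => /= /(_ I).
rewrite -(integral0 mu setT).
apply: ae_eq_integral => //.
  have mE' : measurable (E `&` snd @^-1` `]0%R, +oo[).
    by apply: measurableI => //; exact: preimage_measurable measurable_snd _.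
  have := measurable_fun_xsection (@lebesgue_measure R) mE'.
  congr measurable_fun; apply/funext => x /=; rewrite /lebesgue_pos /mrestr.
  by congr (lebesgue_measure _); apply/seteqP; split => t; rewrite /xsection /= !inE.
exists N; split => // x /= /not_implyP[_ h]; apply: contrapT => Nx.
by apply: h; exact: EN.
Qed.

Section transformation.
Context (T T' : X -> X) (mT : measurable_fun setT T) (mT' : measurable_fun setT T').
Hypothesis TK : cancel T T'.
Hypothesis T'K : cancel T' T.
Context (f : X -> R) (hf : RN_version mu T f).

Lemma measurable_maharam : measurable_fun setT (maharam T f).
Proof.
apply/measurable_fun_pairP; split => /=.
  exact: measurableT_comp mT measurable_fst.
apply: measurable_funM; last exact: measurable_snd.
by case: hf => mf _ _; exact: measurableT_comp mf measurable_fst.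
Qed.

(** The fiber of the preimage over [x] is the fiber over T x dilated by 1 / f x, which multiplies
    its mass by f x; the change of variables removes this factor. *)
Lemma maharam_preserving (S : set (X * R)) : measurable S ->
  m (maharam T f @^-1` S) = m S.
Proof.
move=> mS; rewrite !maharam_measureE.
have mf : measurable_fun setT (fun x => inv_leb (xsection S x)).
  exact: (measurable_fun_xsection (inv_leb (R := R)) mS).
rewrite -(RN_version_change mT mT' TK T'K hf mf)//.
apply: eq_integral => x _.
rewrite (_ : xsection _ x = *%R (f x) @^-1` xsection S (T x)).
  rewrite inv_leb_scale 1?muleC//; first by case: hf.
  exact: measurable_xsection.
by apply/seteqP; split => t; rewrite /xsection /= !inE.
Qed.

Lemma iter_maharam n x t :
  iter n (maharam T f) (x, t) = (iter n T x, (\prod_(i < n) f (iter i T x) * t)%R).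
Proof.
elim: n => [|n IH]; first by rewrite big_ord0 mul1r.
by rewrite iterS IH /maharam/= big_ord_recr/= mulrCA mulrA.
Qed.

End transformation.

End maharam_measure.

(** * Nonsingularity of the shift *)

Section coordinate_law.
Context (R : realType) (lam : R).
Hypothesis hlam : 0 < lam < 1.

Let lam0 : 0 < lam. Proof. by case/andP: hlam. Qed.

Let den_gt0 e : 0 < 1 + lam * expR e.
Proof. by rewrite addr_gt0// mulr_gt0// expR_gt0. Qed.

Lemma coord_law_gt0 e b : 0 < coord_law lam e b.
Proof. by case: b; rewrite /coord_law divr_gt0// mulr_gt0// expR_gt0. Qed.

Lemma coord_law_sum e : coord_law lam e true + coord_law lam e false = 1.
Proof. by rewrite /coord_law -mulrDl addrC divff// gt_eqF. Qed.

Lemma expR_lipschitz (M a b : R) : a <= M -> b <= M ->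
  (expR a - expR b) ^+ 2 <= expR M ^+ 2 * (a - b) ^+ 2.
Proof.
wlog ab : a b / b <= a.
  move=> h aM bM; have [/h|/ltW/h] := leP b a; first exact.
  by rewrite -sqrrN opprB -[X in _ * X]sqrrN opprB; apply.
move=> aM bM; rewrite -exprMn ler_sqr ?nnegrE; last 2 first.
- by rewrite subr_ge0 ler_expR.
- by rewrite mulr_ge0 ?expR_ge0// subr_ge0.
apply: (@le_trans _ _ (expR a * (a - b))); last first.
  by rewrite ler_wpM2r ?subr_ge0// ler_expR.
have := expR_ge1Dx (b - a); rewrite expRD expRN => h.
have ea := expR_gt0 a.
have : expR a * (1 + (b - a)) <= expR a * (expR b * (expR a)^-1) by rewrite ler_wpM2l// ltW.
by rewrite mulrCA divff ?gt_eqF// mulr1; lra.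
Qed.

(** The left-hand side is (expR e' - expR e)^2 times a factor that is at most 1 because lam < 1 and
    e >= 0. *)
Lemma chi2_coord_law (M e e' : R) : 0 <= e -> 0 <= e' -> e <= M -> e' <= M ->
  (coord_law lam e' true - coord_law lam e true) ^+ 2 / coord_law lam e true +
  (coord_law lam e' false - coord_law lam e false) ^+ 2 / coord_law lam e false
  <= expR M ^+ 2 * (e' - e) ^+ 2.
Proof.
move=> e0 e'0 eM e'M.
apply: le_trans (expR_lipschitz e'M eM).
have E1 : 1 <= expR e by rewrite -expR0 ler_expR.
have E2 : 1 <= expR e' by rewrite -expR0 ler_expR.
have -> : (coord_law lam e' true - coord_law lam e true) ^+ 2 / coord_law lam e true +
  (coord_law lam e' false - coord_law lam e false) ^+ 2 / coord_law lam e false =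
  (expR e' - expR e) ^+ 2 * (lam / (expR e * (1 + lam * expR e') ^+ 2)).
  by rewrite /coord_law; field; rewrite !gt_eqF ?expR_gt0.
apply: ler_piMr; first exact: sqr_ge0.
have d1 : 1 <= (1 + lam * expR e') ^+ 2.
  by rewrite exprn_ege1// lerDl mulr_ge0 ?expR_ge0// ltW.
rewrite ler_pdivrMr ?mulr_gt0 ?expR_gt0 ?exprn_gt0// mul1r.
case/andP: hlam => _ /ltW l1; apply: (le_trans l1).
by rewrite -[leLHS]mulr1 ler_pM.
Qed.

End coordinate_law.

Section two_sided_shift.
Local Notation X := shift_space.

Definition shiftn (k : int) (x : X) : X := fun i => x (i + k).

Lemma measurable_shiftn k : measurable_fun setT (shiftn k).
Proof. by apply: measurable_to_shift => i b; exact: measurable_coord. Qed.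

Lemma shiftnD k k' x : shiftn k (shiftn k' x) = shiftn (k + k') x.
Proof. by apply/funext => i; rewrite /shiftn addrA. Qed.

Lemma shiftn0 x : shiftn 0 x = x.
Proof. by apply/funext => i; rewrite /shiftn addr0. Qed.

Lemma bshiftE : bshift = shiftn 1. Proof. by []. Qed.

Lemma iter_bshift p : iter p bshift = shiftn p%:Z.
Proof.
apply/funext => x; elim: p => [|p IH]; first by rewrite shiftn0.
by rewrite iterS IH bshiftE shiftnD; congr shiftn; lia.
Qed.

Lemma shiftnK k : cancel (shiftn k) (shiftn (- k)).
Proof. by move=> x; rewrite shiftnD addNr shiftn0. Qed.

Lemma shiftnVK k : cancel (shiftn (- k)) (shiftn k).
Proof. by move=> x; rewrite shiftnD subrr shiftn0. Qed.

Lemma image_shiftn k A : shiftn k @` A = shiftn (- k) @^-1` A.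
Proof. exact: image_preimage_can (shiftnK k) (shiftnVK k) A. Qed.

(** The image under the inverse shift gives [A] the mass of T^k A; it is the measure whose density
    the cocycle describes. *)
Lemma shifted_product (R : realType) (q : int -> bool -> R) (mu : probability X R) k :
  is_product_measure q mu ->
  is_product_measure (fun i => q (i - k)) (image_measure mu (measurable_shiftn (- k))).
Proof.
move=> hmu F a; rewrite -[LHS]/(mu (shiftn (- k) @^-1` cylinder F a)).
have -> : shiftn (- k) @^-1` cylinder F a =
    cylinder [fset (i - k)%R | i in F]%fset (fun i => a (i + k)).
  apply/seteqP; split => x h i.
    by move=> /imfsetP[j /= jF ->]; rewrite subrK -(h j jF).
  move=> iF; rewrite /shiftn h ?subrK//.
  by apply/imfsetP; exists i.
rewrite hmu big_imfset/=; last by move=> i j _ _ /addIr.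
by congr (_%:E); apply: eq_bigr => i _; rewrite subrK.
Qed.

End two_sided_shift.

Lemma prod_chi2_coord_law (R : realType) (lam M : R) (e e' : int -> R) s :
  0 < lam < 1 -> (forall i, 0 <= e i <= M) -> (forall i, 0 <= e' i <= M) ->
  \prod_(j <- s) (1 + chi2 (fun i => coord_law lam (e i)) (fun i => coord_law lam (e' i)) j)
  <= expR (expR M ^+ 2 * \sum_(j <- s) (e' j - e j) ^+ 2).
Proof.
move=> hlam he he'; rewrite mulr_sumr expR_sum; apply: ler_prod => j _.
have /andP[e0 eM] := he j; have /andP[e'0 e'M] := he' j.
have ch := chi2_coord_law hlam e0 e'0 eM e'M.
apply/andP; split.
  rewrite addr_ge0// /chi2 addr_ge0// divr_ge0 ?sqr_ge0// ltW//; exact: coord_law_gt0.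
by apply: (@le_trans _ _ (1 + expR M ^+ 2 * (e' j - e j) ^+ 2));
  [rewrite lerD2l|exact: expR_ge1Dx].
Qed.

Section domination.
Context (R : realType).
Local Notation X := shift_space.
Context (q q' : int -> bool -> R).
Hypothesis q_gt0 : forall i b, 0 < q i b.
Hypothesis q'_gt0 : forall i b, 0 < q' i b.
Hypothesis q_sum : forall i, q i true + q i false = 1.
Hypothesis q'_sum : forall i, q' i true + q' i false = 1.
Context (mu mu' : probability X R).
Hypothesis hmu : is_product_measure q mu.
Hypothesis hmu' : is_product_measure q' mu'.

(** On a [mu]-null set the deviation bound leaves (K - 1) / (2 c), with [c] as large as desired.
    This is the absolute continuity half of Kakutani's criterion, in chi-square form. *)
Lemma product_dominates (K : R) :
  (forall s, uniq s -> \prod_(j <- s) (1 + chi2 q q' j) <= K) ->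
  forall A, measurable A -> mu A = 0%E -> mu' A = 0%E.
Proof.
move=> hK A mA A0.
have E0 : Ex mu \1_A = 0 by apply: EFin_inj; rewrite Ex_indic.
rewrite -(Ex_indic mu' mA); congr (_%:E); apply/eqP; rewrite -normr_le0.
have K1 : 0 <= K - 1 by have := hK [::] isT; rewrite big_nil; lra.
have D c : 0 < c -> `|Ex mu' \1_A| <= (K - 1) / (2 * c).
  move=> c0; have := @deviation R q q' q_gt0 q'_gt0 q_sum q'_sum mu mu' hmu hmu'
    setT measurableT [::] isT (K - 1) _ _ _ A c (@subsetT _ A) mA c0.
  rewrite E0 subr0 mulr0 add0r indicT Ex_cst mulr1; apply => //.
  - by move=> x _; rewrite big_nil.
  - by move=> s us _; rewrite subrKC; exact: hK.
apply/ler_addgt0Pr => e e0; rewrite add0r.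
have c0 : 0 < K / (2 * e) by rewrite divr_gt0 ?mulr_gt0//; lra.
apply: (le_trans (D _ c0)).
rewrite (_ : 2 * (K / (2 * e)) = K / e); last by field; rewrite gt_eqF.
rewrite invf_div mulrA ler_pdivrMr; last by lra.
by rewrite mulrC ler_wpM2l ?ltW//; lra.
Qed.

Lemma product_agree s A : uniq s -> measurable A -> sdep s A ->
  (forall j, j \in s -> q j = q' j) -> mu A = mu' A.
Proof.
move=> us mA dA qq'; rewrite -!Ex_indic//; congr (_%:E).
rewrite (Ex_ratio q_gt0 q'_gt0 q_sum q'_sum hmu hmu' us (bmeas_indic R mA) (sdep_dep R dA)).
apply: eq_Ex => x; rewrite big_seq big1 ?mul1r// => j js.
by rewrite /ratio qq'// divff// gt_eqF.
Qed.

End domination.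

Section shift_nonsingularity.
Context (R : realType) (lam : R) (hlam : 0 < lam < 1) (eta : nat -> R).
Hypothesis eta_gt0 : forall n : nat, (0 < n)%N -> 0 < eta n.
Hypothesis eta_cvg0 : eta n @[n --> \oo] --> 0.
Hypothesis eta_l2 : cvgn (series (fun n : nat => eta n ^+ 2)).
Context (eps : int -> R) (L l : nat -> nat).
Hypothesis heps : inductive_procedure lam eta eps L l.
Hypothesis eps_le0 : forall i : int, i <= 0 -> eps i = 0.
Context (mu : probability shift_space R).
Let q (i : int) := coord_law lam (eps i).
Hypothesis hmu : is_product_measure q mu.
Local Notation X := shift_space.

Let q_gt0 i b : 0 < q i b. Proof. exact: coord_law_gt0. Qed.
Let q_sum i : q i true + q i false = 1. Proof. exact: coord_law_sum. Qed.

Let sh (k : int) : probability X R := image_measure mu (measurable_shiftn (- k)).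
Let qs (k i : int) := q (i - k).

Let qs_gt0 k i b : 0 < qs k i b. Proof. exact: coord_law_gt0. Qed.
Let qs_sum k i : qs k i true + qs k i false = 1. Proof. exact: coord_law_sum. Qed.

Let hsh k : is_product_measure (qs k) (sh k).
Proof. exact: shifted_product. Qed.

Let shE k A : sh k A = mu (shiftn k @` A).
Proof. by rewrite image_shiftn. Qed.

Lemma eps_range : exists M, forall i, 0 <= eps i <= M.
Proof.
have [M [M0 hM]] := eps_bounded eta_cvg0 heps eps_le0.
exists M => i; rewrite hM andbT; exact: (eps_ge0 heps eps_le0).
Qed.

Lemma shift_dominates A : measurable A -> mu A = 0%E -> mu (bshift @` A) = 0%E.
Proof.
have [M hM] := eps_range.
have [K hK] := jump_sum_bounded eta_gt0 eta_l2 heps eps_le0.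
move=> mA A0; rewrite bshiftE -shE.
apply: (product_dominates q_gt0 (qs_gt0 1) q_sum (qs_sum 1) hmu (hsh 1)
  (K := expR (expR M ^+ 2 * K)) _ mA A0) => s us.
apply: le_trans (prod_chi2_coord_law s hlam hM (fun i => hM (i - 1))) _.
by rewrite ler_expR ler_wpM2l ?sqr_ge0//; exact: hK.
Qed.

Lemma shift_dominates' A : measurable A -> mu (bshift @` A) = 0%E -> mu A = 0%E.
Proof.
have [M hM] := eps_range.
have [K hK] := jump_sum_bounded eta_gt0 eta_l2 heps eps_le0.
move=> mA; rewrite bshiftE -shE => A0.
apply: (product_dominates (qs_gt0 1) q_gt0 (qs_sum 1) q_sum (hsh 1) hmu
  (K := expR (expR M ^+ 2 * K)) _ mA A0) => s us.
apply: le_trans (prod_chi2_coord_law s hlam (fun i => hM (i - 1)) hM) _.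
rewrite ler_expR ler_wpM2l ?sqr_ge0//; apply: le_trans (hK s us).
by apply: ler_sum => j _; rewrite -sqrrN opprB.
Qed.

Lemma shift_nonsingular : nonsingular mu bshift.
Proof.
have mb A : measurable A -> measurable (bshift @^-1` A).
  by move=> mA; apply: preimage_measurable mA; exact: (measurable_shiftn 1).
have bK A : bshift @` (bshift @^-1` A) = A.
  rewrite bshiftE image_shiftn; apply/seteqP; split => x /=; by rewrite shiftnVK.
split.
  apply/null_content_dominatesP => A mA A0; rewrite /pushforward.
  by apply: shift_dominates'; [exact: mb|rewrite bK].
move=> A nA B mB BA; rewrite -[B]bK; apply: shift_dominates; first exact: mb.
exact: nA.
Qed.

End shift_nonsingularity.

(** * Conservativity *)

Section central_boxes.
Local Notation X := shift_space.

Definition box (l : nat) : seq int := [seq i%:Z - l%:Z | i <- iota 0 (2 * l).+1].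

Lemma mem_box l j : (j \in box l) = (- l%:Z <= j <= l%:Z).
Proof.
apply/mapP/idP => [[i]|jl]; first by rewrite mem_iota => ? ->; lia.
exists (absz (j + l%:Z)); last by lia.
rewrite mem_iota; lia.
Qed.

Lemma uniq_box l : uniq (box l).
Proof. by rewrite map_inj_uniq ?iota_uniq// => i j; lia. Qed.

Lemma sdep_central l A : central_cylinders l A -> sdep (box l) A.
Proof.
move=> [a ->] x y xy h i il; rewrite -xy ?mem_box//; exact: h.
Qed.

Lemma sdep_union_of l A : union_of (central_cylinders l) A -> sdep (box l) A.
Proof.
move=> [H HC ->] x y xy [C HC' Cx]; exists C => //.
exact: (sdep_central (HC _ HC')) xy Cx.
Qed.

Lemma measurable_central l A : central_cylinders l A -> measurable A.
Proof.
move=> [a ->].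
have -> : [set x : X | forall i : int, - l%:Z <= i <= l%:Z -> x i = a i] =
    \bigcap_(i in [set` box l]) [set x : X | x i = a i].
  apply/seteqP; split => x h i.
    by rewrite /= mem_box => /h.
  by move=> il; apply: h; rewrite /= mem_box.
by apply: fin_bigcap_measurable => [|i _]; [exact: finite_seq|exact: measurable_coord].
Qed.

(** [S] is a finite disjoint union of central cylinders. The induction fixes one coordinate of the
    box at a time: [t] lists those still to be fixed, [s'] those on which [S'] is already
    constant. *)
Lemma central_split (R : realType) (m1 m2 : {measure set X -> \bar R}) l S :
  (forall A, central_cylinders l A -> (m1 A <= m2 A)%E) ->
  measurable S -> sdep (box l) S -> (m1 S <= m2 S)%E.
Proof.
move=> h mS dS.
suff G t s' S' : measurable S' -> sdep (t ++ s') S' -> {subset box l <= t ++ s'} ->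
    {subset s' <= box l} -> {subset t <= box l} ->
    (forall y z, S' y -> S' z -> forall i, i \in s' -> y i = z i) -> (m1 S' <= m2 S')%E.
  by apply: (G (box l) [::] S) => //; rewrite ?cats0.
elim: t s' S' => [|j t IH] s' S' mS' dS' sub sub' subt agr.
  have [->|/set0P[y Sy]] := eqVneq S' set0; first by rewrite !measure0.
  apply: h; exists y; apply/seteqP; split => z.
    by move=> Sz i il; apply: agr => //; apply: sub; rewrite mem_box.
  move=> zy; apply: dS' Sy => i si; apply/esym/zy.
  by rewrite -mem_box; apply: sub'.
have E : S' = (S' `&` [set x | x j = true]) `|` (S' `&` [set x | x j = false]).
  by apply/seteqP; split => [x Sx|x [[]|[]]//]; case xj : (x j); [left|right].
have mj b : measurable (S' `&` [set x : X | x j = b]).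
  by apply: measurableI => //; exact: measurable_coord.
have Hj b : (m1 (S' `&` [set x : X | x j = b]) <= m2 (S' `&` [set x : X | x j = b]))%E.
  apply: (IH (j :: s')) => //.
  - move=> x y xy [Sx xj]; split.
      apply: dS' Sx => i; rewrite mem_cat inE => /orP[/orP[/eqP ->|it]|it].
      + by apply: xy; rewrite mem_cat inE eqxx orbT.
      + by apply: xy; rewrite mem_cat it.
      + by apply: xy; rewrite mem_cat inE it !orbT.
    by rewrite -xj; apply/esym/xy; rewrite mem_cat inE eqxx orbT.
  - move=> i /sub; rewrite !mem_cat !inE => /orP[/orP[->|->]|->]; by rewrite ?orbT.
  - move=> i; rewrite inE => /orP[/eqP ->|/sub'//]; by apply: subt; rewrite inE eqxx.
  - by move=> i it; apply: subt; rewrite inE it orbT.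
  - move=> y z [Sy yj] [Sz zj] i; rewrite inE => /orP[/eqP ->|is']; last exact: agr.
    by rewrite yj zj.
have dis : (S' `&` [set x : X | x j = true]) `&` (S' `&` [set x | x j = false]) = set0.
  by apply/seteqP; split => x // [[_ xt] [_ xf]]; move: xt; rewrite /= xf.
rewrite E (measureU m1 (mj true) (mj false) dis) (measureU m2 (mj true) (mj false) dis).
by apply: leeD; exact: Hj.
Qed.

End central_boxes.

Lemma uniq_prod_support (R : realType) (g : int -> R) s t : uniq s -> uniq t ->
  {subset t <= s} -> (forall j, j \in s -> j \notin t -> g j = 1) ->
  \prod_(j <- s) g j = \prod_(j <- t) g j.
Proof.
move=> us ut ts g1; rewrite (bigID (mem t))/= [X in _ * X]big_seq_cond.
rewrite [X in _ * X]big1 ?mulr1; last by move=> j /andP[]; exact: g1.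
rewrite -big_filter; apply: perm_big; apply: uniq_perm => //; first exact: filter_uniq.
by move=> j; rewrite mem_filter /=; apply/andP/idP => [[]//|jt]; split => //; exact: ts.
Qed.

Section close_returns.
Context (R : realType) (lam : R) (hlam : 0 < lam < 1) (eta : nat -> R).
Hypothesis eta_gt0 : forall n : nat, (0 < n)%N -> 0 < eta n.
Hypothesis eta_cvg0 : eta n @[n --> \oo] --> 0.
Hypothesis eta_l2 : cvgn (series (fun n : nat => eta n ^+ 2)).
Context (eps : int -> R) (L l : nat -> nat).
Hypothesis heps : inductive_procedure lam eta eps L l.
Hypothesis eps_le0 : forall i : int, i <= 0 -> eps i = 0.
Context (mu : probability shift_space R).
Let q (i : int) := coord_law lam (eps i).
Hypothesis hmu : is_product_measure q mu.
Local Notation X := shift_space.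
Context (f : X -> R) (hf : RN_version mu bshift f).

Let q_gt0 i b : 0 < q i b. Proof. exact: coord_law_gt0. Qed.
Let q_sum i : q i true + q i false = 1. Proof. exact: coord_law_sum. Qed.

Let sh (k : int) : probability X R := image_measure mu (measurable_shiftn (- k)).
Let qs (k i : int) := q (i - k).

Let qs_gt0 k i b : 0 < qs k i b. Proof. exact: coord_law_gt0. Qed.
Let qs_sum k i : qs k i true + qs k i false = 1. Proof. exact: coord_law_sum. Qed.

Let hsh k : is_product_measure (qs k) (sh k).
Proof. exact: shifted_product. Qed.

Definition cocycle p (x : X) : R := \prod_(i < p) f (iter i bshift x).

Lemma cocycle_RN p : RN_version mu (iter p bshift) (cocycle p).
Proof.
exact: (RN_version_iter (measurable_shiftn 1) (measurable_shiftn (- 1))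
  (shiftnK 1) (shiftnVK 1) hf).
Qed.

Lemma measurable_cocycle p : measurable_fun setT (cocycle p).
Proof. by case: (cocycle_RN p). Qed.

Lemma Ex_shift p S : measurable S ->
  ((Ex (sh p%:Z) \1_S)%:E = \int[mu]_(x in S) (cocycle p x)%:E)%E.
Proof.
move=> mS; have [_ _ <-//] := cocycle_RN p.
by rewrite Ex_indic// iter_bshift image_shiftn.
Qed.

Lemma measurable_cocycle_ge p (B : set X) (c : R) : measurable B ->
  measurable (B `&` [set x | c <= cocycle p x]) /\
  measurable (B `&` [set x | cocycle p x <= c]).
Proof.
move=> mB; split; apply: measurableI => //.
  rewrite (_ : mkset _ = cocycle p @^-1` `[c, +oo[).
    exact: preimage_measurable (measurable_cocycle p) _.
  by apply/seteqP; split => x /=; rewrite in_itv/= andbT.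
rewrite (_ : mkset _ = cocycle p @^-1` `]-oo, c]).
  exact: preimage_measurable (measurable_cocycle p) _.
by apply/seteqP; split => x /=; rewrite in_itv.
Qed.

(** A Chebyshev bound for the density. Where it is at least 1 + del, or at most 1 - del, the two
    measures differ by at least [del] times [mu]; [deviation] with c = del absorbs half of this and
    leaves kap / del^2 times the mass of [B] on each side. *)
Lemma concentration p (B : set X) s0 (kap del : R) : measurable B -> uniq s0 ->
  sdep s0 B ->
  (forall x, B x -> \prod_(j <- s0) ratio q (qs p%:Z) j (x j) = 1) ->
  (forall s, uniq s -> (forall j, j \in s -> j \notin s0) ->
    \prod_(j <- s) (1 + chi2 q (qs p%:Z) j) <= 1 + kap) ->
  0 < del ->
  (mu (B `&` [set x | (del <= `|cocycle p x - 1|)%R]) <= (2 * kap / del ^+ 2)%:E * mu B)%E.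
Proof.
move=> mB us0 dB rB hk d0.
have [mP _] := measurable_cocycle_ge p (1 + del) mB.
have [_ mN] := measurable_cocycle_ge p (1 - del) mB.
set P := _ `&` _ in mP; set N := _ `&` _ in mN.
have dev S : S `<=` B -> measurable S -> `|Ex (sh p%:Z) \1_S - Ex mu \1_S| <=
    del / 2 * Ex mu \1_S + kap / (2 * del) * Ex mu \1_B.
  move=> SB mS; exact: (deviation q_gt0 (qs_gt0 p) q_sum (qs_sum p) hmu (hsh p)
    mB us0 dB rB hk SB mS d0).
have dd : 0 < del / 2 by rewrite divr_gt0.
have fin S : measurable S -> S `<=` B ->
   del * Ex mu \1_S <= `|Ex (sh p%:Z) \1_S - Ex mu \1_S| ->
   Ex mu \1_S <= kap / del ^+ 2 * Ex mu \1_B.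
  move=> mS SB h; have h2 := le_trans h (dev S SB mS).
  have h3 : del / 2 * Ex mu \1_S <= kap / (2 * del) * Ex mu \1_B by lra.
  rewrite -(ler_pM2l dd); apply: (le_trans h3); rewrite le_eqVlt; apply/orP; left.
  by apply/eqP; field; rewrite gt_eqF.
have cst_int (c : R) S : measurable S -> (\int[mu]_(x in S) c%:E = (c * Ex mu \1_S)%:E)%E.
  by move=> mS; rewrite integral_cst// EFinM Ex_indic.
have mc S : measurable S -> measurable_fun S (EFin \o cocycle p).
  by move=> mS; apply/measurable_EFinP/measurable_funTS; exact: measurable_cocycle.
have [_ c0 _] := cocycle_RN p.
have bP : Ex mu \1_P <= kap / del ^+ 2 * Ex mu \1_B.
  apply: fin => //; first by move=> x [].
  have : (1 + del) * Ex mu \1_P <= Ex (sh p%:Z) \1_P.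
    rewrite -lee_fin Ex_shift// -cst_int//; apply: ge0_le_integral => //.
    - by move=> x _; rewrite lee_fin; lra.
    - exact: mc.
    - by move=> x [_]; rewrite /= lee_fin.
  move=> h; apply: le_trans (ler_norm _); lra.
have bN : Ex mu \1_N <= kap / del ^+ 2 * Ex mu \1_B.
  apply: fin => //; first by move=> x [].
  have : Ex (sh p%:Z) \1_N <= (1 - del) * Ex mu \1_N.
    rewrite -lee_fin Ex_shift// -cst_int//; apply: ge0_le_integral => //.
    - by move=> x _; rewrite lee_fin ltW.
    - exact: mc.
    - by move=> x [_]; rewrite /= lee_fin.
  by move=> h; rewrite distrC; apply: le_trans (ler_norm _); lra.
apply: (@le_trans _ _ (mu (P `|` N))).
  apply: le_measure; rewrite ?inE.
  - apply: measurableI => //.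
    rewrite (_ : mkset _ = (fun x => `|cocycle p x - 1|) @^-1` `[del, +oo[).
      apply: preimage_measurable => //; apply: measurableT_comp => //.
      by apply: measurable_funB => //; exact: measurable_cocycle.
    by apply/seteqP; split => x /=; rewrite in_itv/= andbT.
  - exact: measurableU.
  - move=> x [Bx] /=; rewrite ler_normr => /orP[h|h]; [left|right]; split => //=; lra.
have hU : (mu (P `|` N) <= mu P + mu N)%E := measureU2 mu mP mN.
apply: (le_trans hU).
rewrite -(Ex_indic mu mP) -(Ex_indic mu mN) -(Ex_indic mu mB) -EFinD -EFinM lee_fin.
have -> : 2 * kap / del ^+ 2 * Ex mu \1_B =
  kap / del ^+ 2 * Ex mu \1_B + kap / del ^+ 2 * Ex mu \1_B by ring.
exact: lerD.
Qed.

Section stage.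
Context (n : nat) (n0 : (0 < n)%N).
Let K := L n.-1.
Let l' := l n.

Lemma stage_eps_gap (j : int) : K%:Z < j <= l'%:Z -> eps j = 0.
Proof.
have [_ _ /(_ n n0)[[_ _ h] _]] := heps.
case: j => j hj; [apply: h; lia|exact: eps_le0].
Qed.

(** On the image of [B] the coordinate - (K + p) is prescribed, being the coordinate - K of a point
    of [A]. The image depends on the box only, so this coordinate cannot lie outside it. *)
Lemma stage_power (A B : set X) (p : nat) : central_cylinders K A -> B `<=` A ->
  iter p bshift @` B `<=` A -> sdep (box l') (iter p bshift @` B) ->
  B !=set0 -> (p + K <= l')%N.
Proof.
move=> [a ->] BA TBA dTB [x Bx]; rewrite leqNgt; apply/negP => lp.
pose j : int := - (K + p)%:Z.
pose y := iter p bshift x.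
have By : (iter p bshift @` B) y by exists x.
have By' : (iter p bshift @` B) (upd j (~~ y j) y).
  apply: dTB By => i il; rewrite upd_other//; apply: contraTneq il => ->.
  rewrite mem_box /j; lia.
have [z Bz zE] := By'.
have zK : z (- K%:Z) = a (- K%:Z) by apply: BA Bz _ _; lia.
have xK : x (- K%:Z) = a (- K%:Z) by apply: BA Bx _ _; lia.
have jE (w : X) : iter p bshift w j = w (- K%:Z).
  by rewrite iter_bshift /shiftn /j; congr w; lia.
have := congr1 (fun w : X => w j) zE; rewrite /= upd_same jE zK /y jE xK.
by case: (a _).
Qed.

(** Relative to the law for eps = 0, the weights [w] met in the box differ from 1 only at the
    indices 1 to [K]. Numerator and denominator read these coordinates off T^p x and off [x], both
    in [A], hence read the same word [a]. *)
Lemma stage_ratio (A B : set X) (p : nat) x : central_cylinders K A -> B `<=` A ->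
  iter p bshift @` B `<=` A -> (p + K <= l')%N -> B x ->
  \prod_(j <- box l') ratio q (qs p%:Z) j (x j) = 1.
Proof.
move=> [a ->] BA TBA pl Bx.
pose q1 := coord_law lam 0; have q1_gt0 b : 0 < q1 b by exact: coord_law_gt0.
pose w (i : int) b := q i b / q1 b.
have w_gt0 i b : 0 < w i b by rewrite divr_gt0.
(* The translate by [c] of the indices 1 to [K], used for c = p and for c = 0. *)
pose t (c : int) := [seq i%:Z + c | i <- iota 1 K].
have ut c : uniq (t c) by rewrite map_inj_uniq ?iota_uniq// => i j; lia.
have mt c j : (j \in t c) = (1 <= j - c <= K%:Z).
  apply/mapP/idP => [[i]|jK]; first by rewrite mem_iota => ? ->; lia.
  by exists (absz (j - c)); [rewrite mem_iota|]; lia.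
have prod_w (c : nat) : (c + K <= l')%N ->
    (forall i : int, 1 <= i <= K%:Z -> x (i + c%:Z) = a i) ->
    \prod_(j <- box l') w (j - c%:Z) (x j) = \prod_(i <- iota 1 K) w i%:Z (a i%:Z).
  move=> cl xa; rewrite (@uniq_prod_support _ _ _ (t c%:Z))//.
  - rewrite big_map [LHS]big_seq [RHS]big_seq; apply: eq_bigr => i; rewrite mem_iota => iK.
    by rewrite addrK xa//; lia.
  - exact: uniq_box.
  - by move=> j; rewrite mt mem_box; lia.
  move=> j; rewrite mt mem_box => jl jt.
  suff e0 : eps (j - c%:Z) = 0 by rewrite /w /q e0 divff// gt_eqF.
  have [h|h] := leP (j - c%:Z) 0; first exact: eps_le0.
  by apply: stage_eps_gap; lia.
have rE j b : ratio q (qs p%:Z) j b = w (j - p%:Z) b / w j b.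
  by rewrite /ratio /qs /w; field; rewrite !gt_eqF.
under eq_bigr do rewrite rE.
rewrite prodf_div (prod_w p)//; last first.
  move=> i iK; have : (iter p bshift @` B) (iter p bshift x) by exists x.
  by move/TBA => /(_ i); rewrite iter_bshift /shiftn => -> //; lia.
have := prod_w 0%N; under eq_bigr do rewrite subr0; move=> -> //.
- by rewrite divff// gt_eqF// prodr_gt0.
- lia.
- by move=> i iK; rewrite addr0; apply: BA Bx _ _; lia.
Qed.

End stage.

Definition close_return (del : R) : set X :=
  \bigcup_p [set x | `|cocycle p.+1 x - 1| < del].

Lemma measurable_close_return del : measurable (close_return del).
Proof.
apply: bigcupT_measurable => p.
rewrite (_ : mkset _ = (fun x => `|cocycle p.+1 x - 1|) @^-1` `]-oo, del[).
  apply: preimage_measurable => //; apply: measurableT_comp => //.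
  by apply: measurable_funB => //; exact: measurable_cocycle.
by apply/seteqP; split => x /=; rewrite in_itv.
Qed.

(* Along the return times given by step 1 the density is exactly 1 on the coordinates in
   [- l n, l n]; [jump_sum_small] controls the remaining ones. *)
Lemma stage_bound (del : R) : 0 < del -> exists n0, forall n, (n0 <= n)%N -> (0 < n)%N ->
  forall A, central_cylinders (L n.-1) A ->
  (mu (A `\` close_return del) <= (1 / 2)%:E * mu A)%E.
Proof.
move=> d0; have [M hM] := eps_range eta_cvg0 heps eps_le0.
(* With this value [concentration] loses 2/5 of each piece; together with the tenth of [A] not
   covered by the pieces this is one half. *)
pose kap := del ^+ 2 / 5.
have k0 : 0 < kap by rewrite divr_gt0// exprn_gt0.
have k1 : 1 < 1 + kap by rewrite ltrDl.
have eM : 0 < expR M ^+ 2 by rewrite exprn_gt0// expR_gt0.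
(* The bound for the jumps at which the exponential estimate of the chi-square product equals 1 +
   kap. *)
have e0 : 0 < ln (1 + kap) / expR M ^+ 2 by rewrite divr_gt0// ln_gt0.
have [n0 hn0] := jump_sum_small eta_gt0 eta_l2 heps eps_le0 e0.
exists n0 => n nn npos A cA.
have [_ _ /(_ n npos)[[Kl [nu hnu /(_ A cA) good] _] _]] := heps.
have [m [B [p [hB tB tTB big dBs]]]] := good.
have mA := measurable_central cA.
pose U := \bigcup_i B i.
have mB i : measurable (B i) by have [[F [a E]] _ _ _] := hB i; rewrite E; exact: measurable_cylinder.
have mU : measurable U by apply: fin_bigcup_measurable => [|i _]; [exact: finite_finset|exact: mB].
have sdB i : sdep (box (l n)) (B i) by have [/sdep_union_of] := dBs i.
have sdU : sdep (box (l n)) U.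
  by move=> x y xy [i _ Bx]; exists i => //; exact: sdB xy Bx.
(* Step 1 speaks of the measure [nu] of the stage, but on the box both laws coincide, because [eps]
   vanishes between [L n.-1] and [l n], as does [eps 1]. *)
have agree j : j \in box (l n) -> q j = stage_law lam eps (L n.-1) j.
  rewrite mem_box /stage_law => jl; case: ifP => // jK; rewrite /q.
  have [_ -> _] := heps; congr coord_law; apply: (stage_eps_gap npos); lia.
have sg0 i b : 0 < stage_law lam eps (L n.-1) i b.
  by rewrite /stage_law; case: ifP => _; exact: coord_law_gt0.
have sg1 i : stage_law lam eps (L n.-1) i true + stage_law lam eps (L n.-1) i false = 1.
  by rewrite /stage_law; case: ifP => _; exact: coord_law_sum.
have muU : mu U = nu U.
  exact: (product_agree q_gt0 sg0 q_sum sg1 hmu hnu (uniq_box (l n)) mU sdU agree).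
have muA : mu A = nu A.
  apply: (product_agree q_gt0 sg0 q_sum sg1 hmu hnu (uniq_box (l n)) mA _ agree).
  apply: sdepS (sdep_central cA) => j; rewrite !mem_box; lia.
have mR := measurable_close_return del.
have mRC : measurable (~` close_return del) by exact: measurableC.
have Bi i : (mu (B i `&` ~` close_return del) <= (2 / 5)%:E * mu (B i))%E.
  have [B0|/set0P Bne] := eqVneq (B i) set0.
    by rewrite B0 set0I measure0 mule0.
  have [_ BA pi TBA] := hB i.
  have pl : (p i + L n.-1 <= l n)%N.
    by apply: (stage_power npos cA BA TBA _ Bne); have [_ /sdep_union_of] := dBs i.
  have -> : 2 / 5 = 2 * kap / del ^+ 2 by rewrite /kap; field; rewrite gt_eqF.
  have rB x : B i x -> \prod_(j <- box (l n)) ratio q (qs (p i)%:Z) j (x j) = 1.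
    exact: (stage_ratio npos cA BA TBA pl).
  have hk s : uniq s -> (forall j, j \in s -> j \notin box (l n)) ->
      \prod_(j <- s) (1 + chi2 q (qs (p i)%:Z) j) <= 1 + kap.
    move=> us hs.
    apply: le_trans (prod_chi2_coord_law s hlam hM (fun j => hM (j - (p i)%:Z))) _.
    rewrite -[leRHS]lnK ?posrE ?(lt_trans _ k1)// ler_expR mulrC -ler_pdivlMr//.
    apply: (hn0 n (p i)) => // j /hs; rewrite mem_box; lia.
  apply: le_trans (concentration (mB i) (uniq_box (l n)) (sdB i) rB hk d0).
  apply: le_measure; rewrite ?inE.
  - exact: measurableI.
  - apply: measurableI => //.
    rewrite (_ : mkset _ = (fun x => `|cocycle (p i) x - 1|) @^-1` `[del, +oo[).
      apply: preimage_measurable => //; apply: measurableT_comp => //.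
      by apply: measurable_funB => //; exact: measurable_cocycle.
    by apply/seteqP; split => x /=; rewrite in_itv/= andbT.
  - move=> x [Bx nR]; split => //=; rewrite leNgt; apply/negP => h; apply: nR.
    by exists (p i).-1 => //=; rewrite prednK.
have finU : finite_set [set: 'I_m] by exact: finite_finset.
pose m1 : {measure set X -> \bar R} := mrestr mu mRC.
have c0 : 0 <= 2 / 5 :> R by rewrite divr_ge0.
pose m2 : {measure set X -> \bar R} := mscale (NngNum c0) mu.
have UR : (mu (U `&` ~` close_return del) <= (2 / 5)%:E * mu U)%E.
  rewrite -[leRHS]/(m2 U) -[leLHS]/(m1 U) /U !measure_fin_bigcup//.
  rewrite lee_fsum// => i _; exact: Bi.
have UA : U `<=` A by move=> x [i _ Bx]; have [_ h _ _] := hB i; exact: h.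
have hAU : (mu (A `\` U) + mu U = mu A)%E.
  rewrite -[in RHS](setDUK UA) measureU//; first by rewrite addeC.
    exact: measurableD.
  by rewrite setDE setICA setICr setI0.
have hAR : (mu (A `\` close_return del) <= mu (A `\` U) + mu (U `&` ~` close_return del))%E.
  apply: le_trans (measureU2 _ _ _); last 2 first.
  - exact: measurableD.
  - exact: measurableI.
  apply: le_measure; rewrite ?inE; [exact: measurableD| |].
    by apply: measurableU; [exact: measurableD|exact: measurableI].
  by move=> x [Ax nR]; have [Ux|nU] := pselect (U x); [right|left].
apply: (le_trans hAR); move: big; rewrite -muU -muA -/U.
move: UR hAU {hAR}; rewrite -!Ex_indic//; last 2 first.
- exact: measurableD.
- exact: measurableI.
rewrite -!EFinD -!EFinM !lee_fin lte_fin => h1 [h2] h3.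
have := @Ex_ge0 _ _ _ mu (\1_A) (fun=> ler0n _ _); lra.
Qed.

(** A density argument: the exceptional set [N] fills at most half of any set [S] that depends on a
    large enough box. If [S] approximates [N] within e / 3, then mu N <= (mu N + e / 3) / 2 + e / 3,
    that is mu N <= e. *)
Lemma close_return_ae (del : R) : 0 < del -> mu (~` close_return del) = 0%E.
Proof.
move=> d0; have [n0 hn0] := stage_bound d0.
have mR := measurable_close_return del.
set N := ~` close_return del; have mN : measurable N by exact: measurableC.
rewrite -(Ex_indic mu mN); congr (_%:E); apply/eqP; rewrite eq_le; apply/andP; split; last first.
  exact: Ex_ge0.
apply/ler_addgt0Pr => e e0; rewrite add0r.
have e30 : 0 < e / 3 by rewrite divr_gt0.
have muoo : (mu setT < +oo)%E.
  by apply: le_lt_trans (ltry 1); rewrite (@probability_setT _ _ _ mu).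
have [S [mS [s dS]] hS] := fdep_approx muoo mN e30.
pose n := (maxn n0 (\max_(j <- s) absz j).+1).+1.
have sL : {subset s <= box (L n.-1)}.
  move=> j js; rewrite mem_box.
  have := @leq_bigmax_seq _ s xpredT absz j js isT.
  by have := procedure_L_gt heps n.-1; rewrite /n /=; lia.
have dS' : sdep (box (L n.-1)) S by exact: sdepS dS.
have nn : (n0 <= n)%N by rewrite /n; lia.
pose m1 : {measure set X -> \bar R} := mrestr mu mN.
have c0 : 0 <= 1 / 2 :> R by rewrite divr_ge0.
pose m2 : {measure set X -> \bar R} := mscale (NngNum c0) mu.
have hSN : (mu (S `&` N) <= (1 / 2)%:E * mu S)%E.
  exact: (@central_split R m1 m2 _ _ (hn0 n nn isT) mS dS').
have mD1 : measurable (N `\` S) by exact: measurableD.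
have mD2 : measurable (S `\` N) by exact: measurableD.
have mSN : measurable (S `&` N) by exact: measurableI.
have mDD : measurable ((N `\` S) `|` (S `\` N)) by exact: measurableU.
have e1 : Ex mu \1_N <= Ex mu \1_(S `&` N) + Ex mu \1_(N `\` S).
  rewrite -lee_fin EFinD !Ex_indic//.
  apply: le_trans (measureU2 _ _ _) => //; apply: le_measure; rewrite ?inE//.
    exact: measurableU.
  by move=> x Nx; have [Sx|nS] := pselect (S x); [left|right].
have e2 : Ex mu \1_S <= Ex mu \1_N + Ex mu \1_(S `\` N).
  rewrite -lee_fin EFinD !Ex_indic//.
  apply: le_trans (measureU2 _ _ _) => //; apply: le_measure; rewrite ?inE//.
    exact: measurableU.
  by move=> x Sx; have [Nx|nN] := pselect (N x); [left|right].
have e3 : Ex mu \1_(N `\` S) <= Ex mu \1_((N `\` S) `|` (S `\` N)).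
  by apply: Ex_indic_le => // x; left.
have e4 : Ex mu \1_(S `\` N) <= Ex mu \1_((N `\` S) `|` (S `\` N)).
  by apply: Ex_indic_le => // x; right.
have hS' : (mu ((N `\` S) `|` (S `\` N)) < (e / 3)%:E)%E := hS.
move: hS' hSN; rewrite -!Ex_indic// lte_fin -EFinM lee_fin; lra.
Qed.

End close_returns.

(** * Invariance under flips *)

Section flips.
Context (R : realType).
Local Notation X := shift_space.

Definition flip (k : int) (x : X) : X := upd k (~~ x k) x.

Lemma flip_same k x : flip k x k = ~~ x k. Proof. by rewrite /flip upd_same. Qed.

Lemma flip_other k x i : i != k -> flip k x i = x i.
Proof. exact: upd_other. Qed.

Lemma flipK k : involutive (flip k).
Proof. by move=> x; rewrite /flip upd_same negbK upd_upd upd_id. Qed.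

Lemma flip_upd k b x : flip k (upd k b x) = upd k (~~ b) x.
Proof. by rewrite /flip upd_same upd_upd. Qed.

Lemma measurable_flip k : measurable_fun setT (flip k).
Proof.
apply: measurable_to_shift => i b; have [->|ik] := eqVneq i k.
  rewrite (_ : mkset _ = [set x : X | x k = ~~ b]); first exact: measurable_coord.
  by apply/seteqP; split => x /=; rewrite flip_same; [move=> <-|move=> ->]; rewrite negbK.
rewrite (_ : mkset _ = [set x : X | x i = b]); first exact: measurable_coord.
by apply/seteqP; split => x /=; rewrite flip_other.
Qed.

Lemma shiftn_flip p k x : shiftn p (flip k x) = flip (k - p) (shiftn p x).
Proof.
apply/funext => i; rewrite /shiftn /flip /upd subrK.
by rewrite (_ : (i == k - p) = (i + p == k))//; apply/eqP/eqP; lia.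
Qed.

Context (q : int -> bool -> R).
Hypothesis q_gt0 : forall i b, 0 < q i b.
Hypothesis q_sum : forall i, q i true + q i false = 1.
Context (mu : probability X R) (hmu : is_product_measure q mu).

(** The density of mu o flip k with respect to mu, as a function of the coordinate [k]. *)
Definition flip_ratio (k : int) (b : bool) : R := q k (~~ b) / q k b.

Lemma flip_ratio_gt0 k b : 0 < flip_ratio k b. Proof. exact: divr_gt0. Qed.

Lemma measurable_flip_ratio k : measurable_fun setT (fun x : X => flip_ratio k (x k)).
Proof. by case: (bmeas_coord k (flip_ratio k)). Qed.

Local Open Scope ereal_scope.

Lemma flip_change k (u : X -> \bar R) : measurable_fun setT u -> (forall x, 0 <= u x) ->
  \int[mu]_x (u (flip k x) * (flip_ratio k (x k))%:E) = \int[mu]_x u x.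
Proof.
move=> mu_ u0; have q_ge0 i b : (0 <= q i b)%R by exact: ltW.
have g0 k' b := flip_ratio_gt0 k' b.
rewrite [LHS](ge0_integral_resample q_ge0 q_sum hmu k).
- rewrite [RHS](ge0_integral_resample q_ge0 q_sum hmu k)//.
  apply: eq_integral => x _; rewrite !flip_upd !upd_same/= addeC.
  by congr (_ + _); rewrite muleC -muleA -EFinM /flip_ratio/= divfK ?gt_eqF// muleC.
- apply: emeasurable_funM; first exact: measurableT_comp mu_ (measurable_flip k).
  by apply/measurable_EFinP; exact: measurable_flip_ratio.
- by move=> x; rewrite mule_ge0// lee_fin ltW.
Qed.

Context (f : X -> R) (p : nat) (hf : RN_version mu (iter p bshift) f).

(** T^p after the flip of [k] is the flip of k - p after T^p; the chain rule for both sides and the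
    uniqueness of densities give the identity. The coordinate k - p of T^p x is x k, which therefore
    occurs in both factors. *)
Lemma flip_RN k : {ae mu, forall x,
  (f (flip k x) * flip_ratio k (x k) = flip_ratio (k - p%:Z) (x k) * f x)%R}.
Proof.
have [mf f0 _] := hf.
have mT : measurable_fun setT (iter p bshift) by rewrite iter_bshift; exact: measurable_shiftn.
have mT' := measurable_shiftn (- p%:Z).
have TK : cancel (iter p bshift) (shiftn (- p%:Z)) by rewrite iter_bshift; exact: shiftnK.
have T'K : cancel (shiftn (- p%:Z)) (iter p bshift) by rewrite iter_bshift; exact: shiftnVK.
have change := RN_version_change mT mT' TK T'K hf.
have mfl := measurable_flip k.
pose u (x : X) := (f (flip k x) * flip_ratio k (x k))%:E.
pose v (x : X) := (flip_ratio (k - p%:Z) (x k) * f x)%:E.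
have mfr k' i : measurable_fun setT (fun x : X => flip_ratio k' (x i)).
  by case: (bmeas_coord i (flip_ratio k')).
have mfE : measurable_fun setT (fun x => (f x)%:E) by apply/measurable_EFinP.
have mu_ : measurable_fun setT u.
  apply/measurable_EFinP; apply: measurable_funM => //.
  exact: measurableT_comp mf mfl.
have mv : measurable_fun setT v.
  by apply/measurable_EFinP; apply: measurable_funM.
have u0 x : 0 <= u x by rewrite lee_fin mulr_ge0 ?ltW// flip_ratio_gt0.
have v0 x : 0 <= v x by rewrite lee_fin mulr_ge0 ?ltW// flip_ratio_gt0.
have : ae_eq mu setT u v; last first.
  move=> [N [mN N0 hN]]; exists N; split => // x /= nx.
  by apply: hN => /= h; apply: nx; case: (h I).
have int_u E : measurable E -> \int[mu]_(x in E) u x = \int[mu]_x (\1_E (flip k x) * f x)%:E.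
  move=> mE; rewrite -(flip_change k (u := fun x : X => (\1_E (flip k x) * f x)%:E)); last 2 first.
  - apply/measurable_EFinP; apply: measurable_funM => //.
    by apply: measurableT_comp mfl; exact: measurable_indic.
  - by move=> x; rewrite lee_fin mulr_ge0// ltW.
  rewrite integral_mkcond; apply: eq_integral => x _.
  by rewrite flipK -EFinM -mulrA epatch_indic /= indicE muleC -EFinM.
apply: integral_ae_eq => //.
  apply/integrableP; split => //; under eq_integral do rewrite gee0_abs//.
  rewrite int_u//; under eq_integral do rewrite indicT mul1r.
  have /integrableP[_ h] := RN_version_integrable mT' TK T'K hf.
  apply: le_lt_trans h; rewrite le_eqVlt; apply/orP; left; apply/eqP.
  by apply: eq_integral => x _; rewrite /= gtr0_norm.
move=> E _ mE; rewrite int_u//.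
have mE' : measurable_fun setT (\1_E : X -> R) by exact: measurable_indic.
transitivity (\int[mu]_x (\1_E (flip k (shiftn (- p%:Z) x)))%:E).
  rewrite -(change (fun x : X => (\1_E (flip k (shiftn (- p%:Z) x)))%:E)); last 2 first.
  - apply/measurable_EFinP; apply: (measurableT_comp mE').
    exact: measurableT_comp mfl mT'.
  - by move=> x; rewrite lee_fin.
  by apply: eq_integral => x _; rewrite TK -EFinM.
transitivity (\int[mu]_x ((\1_E (shiftn (- p%:Z) x))%:E *
                           (flip_ratio (k - p%:Z) (x (k - p%:Z)))%:E)).
  rewrite -(flip_change (k - p%:Z) (u := fun x : X => (\1_E (flip k (shiftn (- p%:Z) x)))%:E)).
  - apply: eq_integral => x _; rewrite shiftn_flip opprK subrK flipK//.
  - apply/measurable_EFinP; apply: (measurableT_comp mE').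
    exact: measurableT_comp mfl mT'.
  - by move=> x; rewrite lee_fin.
rewrite -change; last 2 first.
- apply: emeasurable_funM; last by apply/measurable_EFinP.
  by apply/measurable_EFinP; exact: measurableT_comp mE' mT'.
- by move=> x; rewrite mule_ge0// lee_fin// ltW// flip_ratio_gt0.
rewrite [RHS]integral_mkcond; apply: eq_integral => x _.
rewrite TK epatch_indic /= -!EFinM; congr (_%:E).
by rewrite iter_bshift /shiftn subrK; ring.
Qed.

End flips.

Section past_independent_sets.
Context (R : realType).
Local Notation X := shift_space.

(** T^n moves the flipped coordinate [k] to k - n, so such sets cannot tell apart, at equal heights,
    the late orbits of a point and of its flip. *)
Definition pdep (M : nat) (S : set (X * R)) := forall (x y : X) (t : R),
  (forall i : int, - M%:Z <= i -> x i = y i) -> S (x, t) -> S (y, t).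

Definition past_free : set (set (X * R)) := [set S | measurable S /\ exists M, pdep M S].

Lemma past_freeC : setC_closed past_free.
Proof.
move=> S [mS [M dS]]; split; first exact: measurableC.
exists M => x y t xy nSx Sy; apply: nSx; apply: dS Sy => i /xy //.
Qed.

Lemma past_freeU : setU_closed past_free.
Proof.
move=> S S' [mS [M dS]] [mS' [M' dS']]; split; first exact: measurableU.
exists (maxn M M') => x y t xy [Sx|Sx]; [left|right].
  by apply: dS Sx => i iM; apply: xy; lia.
by apply: dS' Sx => i iM; apply: xy; lia.
Qed.

Lemma past_free_gen : (@measurable _ (X * R)%type) `<=` <<s past_free >>.
Proof.
apply: smallest_sub; first exact: smallest_sigma_algebra.
move=> _ [[A mA <-]|[A mA <-]]; last first.
  apply: sub_sigma_algebra; split; last by exists 0%N => x y t xy [].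
  by rewrite setTI; exact: preimage_measurable measurable_snd _.
rewrite setTI.
have : <<s cylinders >> `<=` image_set_system setT (@fst X R) <<s past_free >>.
  apply: smallest_sub; first exact/sigma_algebra_image/smallest_sigma_algebra.
  move=> _ [F [a ->]]; rewrite /image_set_system /= setTI.
  apply: sub_sigma_algebra; split.
    apply: preimage_measurable measurable_fst _; exact: measurable_cylinder.
  have [M hM] : exists M : nat, forall i : int, i \in F -> (absz i <= M)%N.
    exists (\max_(i <- F) absz i) => i iF.
    exact: (@leq_bigmax_seq _ (enum_fset F) xpredT absz i iF isT).
  exists M => x y t xy h i iF; rewrite -[LHS]/(y i) -xy; first exact: h.
  by have := hM i iF; lia.
by move=> /(_ A mA); rewrite /image_set_system /= setTI.
Qed.

End past_independent_sets.

Lemma far_past (k : int) (M n : nat) : ((absz k + M).+1 <= n)%N ->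
  k - n%:Z <= 0 /\ forall i : int, - M%:Z <= i -> i != k - n%:Z.
Proof. by move=> h; split=> [|i iM]; [lia|apply/eqP; lia]. Qed.

(** [E] separates [z] from [z'] and [P] does not, so exactly one of them lies in the symmetric
    difference. *)
Lemma indic_symdiff (R : realType) (T : Type) (E P Q : set T) (z z' : T) :
  E z -> ~ E z' -> (P z <-> P z') -> (Q z <-> Q z') ->
  \1_(((E `\` P) `|` (P `\` E)) `&` Q) z + \1_(((E `\` P) `|` (P `\` E)) `&` Q) z' =
  \1_Q z :> R.
Proof.
move=> e1 e2 hp hq; have eQ : (z' \in Q) = (z \in Q).
  by apply/idP/idP; rewrite !inE => /hq.
have eP : (z' \in P) = (z \in P) by apply/idP/idP; rewrite !inE => /hp.
rewrite !indicE !in_setI !in_setU !in_setD (mem_set e1) (memNset e2) eP eQ.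
by case: (_ \in P); case: (_ \in Q); rewrite /= ?addr0 ?add0r.
Qed.

(** [r] counts the late visits to [Q], common to two orbits; [b1], [b2] their early visits to [Q],
    [a1], [a2] and [v1], [v2] their early and late visits to [V]. Adding the two inequalities gives
    4 r <= 2 n + 2 r. *)
Lemma visit_count (R : realFieldType) (r b1 b2 a1 a2 v1 v2 n : R) :
  4 * (a1 + v1) <= b1 + r -> 4 * (a2 + v2) <= b2 + r ->
  0 <= a1 -> 0 <= a2 -> b1 <= n -> b2 <= n -> v1 + v2 = r -> r <= n.
Proof. lra. Qed.

Section maharam_of_shift.
Context (R : realType) (lam : R) (hlam : 0 < lam < 1) (eta : nat -> R).
Hypothesis eta_gt0 : forall n : nat, (0 < n)%N -> 0 < eta n.
Hypothesis eta_cvg0 : eta n @[n --> \oo] --> 0.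
Hypothesis eta_l2 : cvgn (series (fun n : nat => eta n ^+ 2)).
Context (eps : int -> R) (L l : nat -> nat).
Hypothesis heps : inductive_procedure lam eta eps L l.
Hypothesis eps_le0 : forall i : int, i <= 0 -> eps i = 0.
Context (mu : probability shift_space R).
Let q (i : int) := coord_law lam (eps i).
Hypothesis hmu : is_product_measure q mu.
Local Notation X := shift_space.
Context (f : X -> R) (hf : RN_version mu bshift f).

Let q_gt0 i b : 0 < q i b. Proof. exact: coord_law_gt0. Qed.
Let q_sum i : q i true + q i false = 1. Proof. exact: coord_law_sum. Qed.
Let mT := measurable_shiftn 1.
Let mT' := measurable_shiftn (- 1).
Let TK := shiftnK 1.
Let T'K := shiftnVK 1.

Local Notation m := (mu \x inv_leb (R := R))%E.
Local Notation S := (maharam bshift f).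

Let mS : measurable_fun setT S.
Proof. exact: (measurable_maharam mT hf). Qed.

Let mpS A : measurable A -> m (S @^-1` A) = m A.
Proof. exact: (maharam_preserving mT mT' TK T'K hf). Qed.

Definition ray_set (a : R) : set (X * R) := setT `*` `]a, +oo[.

Lemma measurable_ray_set a : measurable (ray_set a).
Proof. exact: measurableX. Qed.

Lemma ray_setP a z : ray_set a z <-> a < z.2.
Proof.
by split; [move=> [_]; rewrite /= in_itv/= andbT|move=> h; split => //=; rewrite in_itv/= h].
Qed.

Lemma measure_ray_set a A : 0 < a -> measurable A ->
  m (A `*` `]a, +oo[) = (mu A * (a^-1)%:E)%E.
Proof. by move=> a0 mA; rewrite product_measure1E//; congr (_ * _)%E; exact: inv_leb_ray. Qed.

Lemma measure_ray_setT a : 0 < a -> m (ray_set a) = (a^-1)%:E.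
Proof.
move=> a0; rewrite /ray_set measure_ray_set//.
by rewrite (@probability_setT _ _ _ mu) mul1e.
Qed.

Lemma null_fiber N : measurable N -> mu N = 0%E -> m (N `*` setT) = 0%E.
Proof.
move=> mN N0; rewrite product_measure1E// -[RHS](mul0e (inv_leb (R := R) setT)).
by congr (_ * _)%E.
Qed.

(** A point at height t > a stays above [a] at any time where the cocycle is within (t - a) / t of
    1; almost every [x] has such a time for each tolerance 1 / (k + 1). *)
Lemma ray_recurrent a : 0 < a -> m (ray_set a `\` returns S (ray_set a)) = 0%E.
Proof.
move=> a0; pose N := \bigcup_k ~` close_return f (k.+1%:R^-1).
have mN k : measurable (~` close_return f (k.+1%:R^-1)).
  by apply: measurableC; exact: (measurable_close_return hf).
have mNN : measurable N by exact: bigcupT_measurable.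
have N0 : mu N = 0%E.
  apply/eqP; rewrite -measure_le0.
  apply: (le_trans (measure_sigma_subadditive mu mN mNN (@subset_refl _ N))).
  rewrite eseries0// => k _ _ /=.
  by apply: (close_return_ae hlam eta_gt0 eta_cvg0 eta_l2 heps eps_le0 hmu hf); rewrite invr_gt0.
apply/eqP; rewrite -measure_le0 -(null_fiber mNN N0); apply: le_measure; rewrite ?inE.
- apply: measurableD; first exact: measurable_ray_set.
  apply: bigcupT_measurable => n.
  by apply: preimage_measurable (measurable_ray_set a); exact: measurable_iter.
- exact: measurableX.
move=> [x t] [/ray_setP/= at_ nret]; split => //=; apply: contrapT => nN; apply: nret.
have t0 : 0 < t by exact: lt_trans at_.
have dt : 0 < (t - a) / t by rewrite divr_gt0// subr_gt0.
pose k := Num.truncn ((t - a) / t)^-1.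
have [p _ /= hp] : close_return f (k.+1%:R^-1) x.
  by apply: contrapT => h; apply: nN; exists k.
exists p => //=; apply/ray_setP; rewrite -iterS iter_maharam /=.
have {}hp : `|cocycle f p.+1 x - 1| < (t - a) / t.
  apply: (lt_trans hp); rewrite -[ltRHS]invrK ltf_pV2 ?posrE ?invr_gt0//.
  exact: truncnS_gt.
move: hp; rewrite ltr_pdivlMr// => hp.
have : (1 - cocycle f p.+1 x) * t <= `|cocycle f p.+1 x - 1| * t.
  by rewrite ler_pM2r// distrC ler_norm.
rewrite /cocycle; lra.
Qed.

Lemma null_on_ray_sets A : measurable A -> (forall b, 0 < b -> m (A `&` ray_set b) = 0%E) ->
  m A = 0%E.
Proof.
move=> mA h; pose Y0 : set (X * R) := setT `*` `]-oo, 0%R].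
have Y00 : m Y0 = 0%E.
  rewrite product_measure1E// -[RHS](mule0 (mu setT)); congr (_ * _)%E.
  exact: inv_leb_nonpos.
have mY0 : measurable Y0 by exact: measurableX.
pose B j := A `&` ray_set (j.+1%:R^-1).
have mB j : measurable (B j) by apply: measurableI => //; exact: measurable_ray_set.
have mBU : measurable (\bigcup_j B j) by exact: bigcupT_measurable.
have B0 : m (\bigcup_j B j) = 0%E.
  apply/eqP; rewrite -measure_le0.
  apply: (le_trans (measure_sigma_subadditive m mB mBU (@subset_refl _ _))).
  by rewrite eseries0// => j _ _; apply: h; rewrite invr_gt0.
apply/eqP; rewrite -measure_le0 -(_ : m (Y0 `|` \bigcup_j B j) = 0%E); last by rewrite measureU0.
apply: le_measure; rewrite ?inE//; first exact: measurableU.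
move=> [x t] Ez; have [t0|t0] := leP t 0; first by left; split => //=; rewrite in_itv.
right; exists (Num.truncn t^-1) => //; split => //; apply/ray_setP => /=.
by rewrite -[ltRHS]invrK ltf_pV2 ?posrE ?invr_gt0//; exact: truncnS_gt.
Qed.

(** If [A] had only null returns, A x ]1, +oo[ would be wandering inside the recurrent set
    [ray_set 1] of finite measure, hence null; but its measure is that of [A]. *)
Lemma shift_conservative : conservative mu bshift.
Proof.
move=> A mA A0; apply: contrapT => nret.
have mb n : measurable (iter n bshift @^-1` A `&` A).
  apply: measurableI => //; apply: preimage_measurable mA.
  by rewrite iter_bshift; exact: measurable_shiftn.
have An n : mu (iter n.+1 bshift @^-1` A `&` A) = 0%E.
  apply/eqP; rewrite -measure_le0 leNgt; apply/negP => h; apply: nret.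
  by exists n.+1.
have r1 : (0 : R) < 1 by [].
pose V := A `*` `]1%R, +oo[ : set (X * R).
have mV : measurable V by exact: measurableX.
have V0 : m V = 0%E.
  apply: (wandering_null mS mpS (measurable_ray_set 1)) => //.
  - exact: ray_recurrent.
  - by rewrite [ltLHS](measure_ray_setT r1) ltry.
  - by move=> z [_ h]; split.
  move=> n; apply/eqP; rewrite -measure_le0.
  apply: (@le_trans _ _ (m ((iter n.+1 bshift @^-1` A `&` A) `*` setT))).
    apply: le_measure; rewrite ?inE.
    - apply: measurableI => //; apply: preimage_measurable mV.
      exact: measurable_iter.
    - exact: measurableX.
    move=> [x t] [[Ax _]] /=; rewrite -[S (iter n S _)]/(iter n.+1 S (x, t)) iter_maharam.
    by move=> [].
  by rewrite le_eqVlt; apply/orP; left; apply/eqP; exact: null_fiber.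
move: A0; have := measure_ray_set r1 mA; rewrite invr1 mule1 => <-.
by rewrite [ltRHS]V0 ltxx.
Qed.

(** This is [flip_ratio] without its factor lam or 1/lam. That factor depends on the value of the
    coordinate but not on [k], so it cancels from [flip_RN]; what remains is 1 for k <= 0. *)
Definition flip_weight (k : int) (b : bool) : R := expR (if b then - eps k else eps k).

Definition flip_ext (k : int) (z : X * R) : X * R :=
  (flip k z.1, flip_weight k (z.1 k) * z.2).

Lemma flip_weight_gt0 k b : 0 < flip_weight k b. Proof. exact: expR_gt0. Qed.

Lemma flip_weight_le0 k b : k <= 0 -> flip_weight k b = 1.
Proof. by move=> k0; rewrite /flip_weight eps_le0// oppr0; case: b; rewrite expR0. Qed.

Let lam0 : 0 < lam. Proof. by case/andP: hlam. Qed.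

Lemma flip_ratioE k b :
  flip_ratio q k b = flip_weight k b * (if b then lam^-1 else lam).
Proof.
have d0 : 0 < 1 + lam * expR (eps k) by rewrite addr_gt0// mulr_gt0// expR_gt0.
rewrite /flip_ratio /q /coord_law /flip_weight; case: b => /=.
  by rewrite expRN; field; rewrite !gt_eqF ?expR_gt0.
by field; rewrite gt_eqF.
Qed.

Lemma flip_cocycle n k : {ae mu, forall x,
  cocycle f n (flip k x) * flip_weight k (x k) =
  flip_weight (k - n%:Z) (x k) * cocycle f n x}.
Proof.
have := flip_RN q_gt0 q_sum hmu (cocycle_RN hf n) k.
apply: filterS => x; rewrite !flip_ratioE => h.
have c0 : (if x k then lam^-1 else lam) != 0 by case: (x k); rewrite gt_eqF ?invr_gt0.
by apply: (mulIf c0); rewrite -[LHS]mulrA h; ring.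
Qed.

Lemma measurable_flip_ext k : measurable_fun setT (flip_ext k).
Proof.
apply/measurable_fun_pairP; split => /=.
  exact: measurableT_comp (measurable_flip k) measurable_fst.
apply: measurable_funM; last exact: measurable_snd.
by case: (bmeas_coord k (flip_weight k)) => h _; exact: measurableT_comp h measurable_fst.
Qed.

(** The dilation of the fiber contributes [flip_weight], the change of variables [flip_ratio]; their
    quotient is lam or 1/lam, at most 1/lam. *)
Lemma flip_ext_bound k A : measurable A ->
  (m (flip_ext k @^-1` A) <= (lam^-1)%:E * m A)%E.
Proof.
move=> mA; rewrite !maharam_measureE.
have mf : measurable_fun setT (fun x => inv_leb (xsection A x)).
  exact: (measurable_fun_xsection (inv_leb (R := R)) mA).
have mff : measurable_fun setT (fun x => inv_leb (xsection A (flip k x))).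
  exact: measurableT_comp mf (measurable_flip k).
have il : (0 <= lam^-1)%R by rewrite invr_ge0 ltW.
have mr : measurable_fun setT (fun x : X => (flip_ratio q k (x k))%:E).
  by apply/measurable_EFinP; exact: measurable_flip_ratio.
rewrite -(flip_change q_gt0 q_sum hmu k mf)// -ge0_integralZl//; last 2 first.
- exact: emeasurable_funM.
- by move=> x _; rewrite mule_ge0// lee_fin ltW// flip_ratio_gt0.
apply: ge0_le_integral => //.
- exact: measurable_fun_xsection (preimage_measurable (measurable_flip_ext k) mA).
- apply: measurable_funeM; exact: emeasurable_funM.
move=> x _; rewrite (_ : xsection _ x = *%R (flip_weight k (x k)) @^-1` xsection A (flip k x)).
  rewrite inv_leb_scale ?flip_weight_gt0//; last exact: measurable_xsection.
  rewrite muleCA muleC; apply: lee_wpmul2l => //.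
  rewrite -EFinM lee_fin flip_ratioE mulrCA ler_pMr ?flip_weight_gt0//.
  case/andP: hlam => _ l1; case: (x k); last by rewrite mulVf// gt_eqF.
  by rewrite -invfM invf_ge1 ?mulr_gt0//; apply: mulr_ile1; rewrite ltW.
by apply/seteqP; split => t; rewrite /xsection /= !inE.
Qed.

(** * Invariant sets are invariant under flips *)

Section hopf_argument.
Context (E : set (X * R)) (mE : measurable E) (SE : S @^-1` E = E) (k : int).

Let iterE n z : E (iter n S z) <-> E z.
Proof.
elim: n => // n IH; rewrite -IH iterS; move: (iter n S z) => w.
by rewrite -[in X in _ <-> X]SE.
Qed.

Let bad (a : R) :=
  E `&` flip_ext k @^-1` (~` E) `&` (ray_set a `&` flip_ext k @^-1` ray_set a).

Let mflip := measurable_flip_ext k.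

Let mbad a : measurable (bad a).
Proof.
have mr := measurable_ray_set a.
by apply: measurableI; apply: measurableI => //; apply: preimage_measurable mflip _ => //;
  exact: measurableC.
Qed.

(* Let P, free of the past, approximate E up to a small error V inside Q. The orbits of a bad
   z and of its flip z' end up with the same coordinates, hence together in P or out of
   it, while z stays in E and z' out of E: each late visit to Q puts z or z' in V. By the
   maximal inequality this contradicts the recurrence of z unless z or z' lies in a set of
   measure O(m V). *)
Let bad_null a : 0 < a -> m (bad a) = 0%E.
Proof.
move=> a0; set Q := ray_set a; have mQ : measurable Q by exact: measurable_ray_set.
have Qoo : (m Q < +oo)%E by rewrite [ltLHS](measure_ray_setT a0) ltry.
pose J := infinitely_often S Q.
have mJ : measurable J by exact: measurable_infinitely_often.
have J0 : m (Q `\` J) = 0%E.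
  apply: (recurrent_infinitely_often mS mpS mQ).
  exact: ray_recurrent.
have /choice[N hN] : forall n, exists N : set X, [/\ measurable N, mu N = 0%E &
    forall x, ~ N x -> cocycle f n (flip k x) * flip_weight k (x k) =
      flip_weight (k - n%:Z) (x k) * cocycle f n x].
  move=> n; have [N [mN N0 h]] := flip_cocycle n k.
  by exists N; split => // x Nx; apply: contrapT => h'; apply: Nx; exact: h.
pose NN := \bigcup_n N n.
have mN n : measurable (N n) by have [] := hN n.
have mNN : measurable NN by exact: bigcupT_measurable.
have NN0 : mu NN = 0%E.
  apply/eqP; rewrite -measure_le0.
  apply: (le_trans (measure_sigma_subadditive mu mN mNN (@subset_refl _ NN))).
  by rewrite eseries0// => n _ _ /=; have [] := hN n.
have C0 : 0 < 4 * (1 + lam^-1) by rewrite mulr_gt0// addr_gt0// invr_gt0.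
apply/eqP; rewrite -measure_le0; apply/lee_addgt0Pr => e e0; rewrite add0e.
(* The maximal inequality costs 4 d for the point and, through [flip_ext_bound], 4 d / lam for its
   flip. *)
pose d := e / (4 * (1 + lam^-1)).
have d0 : 0 < d by rewrite divr_gt0.
pose mQm : {measure set (X * R) -> \bar R} := mrestr m mQ.
have [P [mP [M dP]] hP] : exists2 P, past_free P & (mQm ((E `\` P) `|` (P `\` E)) < d%:E)%E.
  apply: (algebra_approx (G := @past_free R)) => //.
  - by rewrite -[ltLHS]/(m (setT `&` Q)) setTI.
  - by move=> P [].
  - by split => //; exists 0%N => x y t _ [].
  - exact: past_freeC.
  - exact: past_freeU.
  - exact: past_free_gen.
pose V := ((E `\` P) `|` (P `\` E)) `&` Q.
have mV : measurable V by apply: measurableI => //; apply: measurableU; exact: measurableD.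
have Vd : (m V < d%:E)%E by [].
have Voo : (m V < +oo)%E by apply: lt_trans Vd (ltry _).
pose H := hopf_set R S V Q.
have mH : measurable H by exact: measurable_hopf_set.
have mQH : measurable (Q `&` H) by exact: measurableI.
have hH : (m (Q `&` H) <= (4 * d)%:E)%E.
  apply: le_trans (hopf_maximal mS mpS mV mQ Voo) _.
  by rewrite EFinM; apply: lee_wpmul2l => //; exact: ltW.
have hH' : (m (flip_ext k @^-1` (Q `&` H)) <= (lam^-1 * (4 * d))%:E)%E.
  apply: (le_trans (flip_ext_bound k mQH)).
  by rewrite EFinM; apply: lee_wpmul2l => //; rewrite lee_fin invr_ge0 ltW.
pose Z := (Q `\` J) `|` (NN `*` setT).
have mQJ : measurable (Q `\` J) by exact: measurableD.
have mZ : measurable Z by apply: measurableU => //; exact: measurableX.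
have Z0 : m Z = 0%E.
  rewrite /Z measureU0//; first exact: measurableX.
  exact: null_fiber.
have mF : measurable (flip_ext k @^-1` (Q `&` H)) by exact: preimage_measurable mflip _.
have hb : (m (bad a) <= m (((Q `&` H) `|` flip_ext k @^-1` (Q `&` H)) `|` Z))%E.
  apply: le_measure; rewrite ?inE.
  - exact: mbad.
  - by apply: measurableU => //; exact: measurableU.
  move=> [x t] [[Ez nEz'] [Qz Qz']]; set z := (x, t) in Ez Qz *.
  set z' := flip_ext k z in nEz' Qz'.
  have [Hz|nHz] := pselect (H z); first by left; left.
  have [Hz'|nHz'] := pselect (H z'); first by left; right.
  have [Nx|nNx] := pselect (NN x); first by right; right.
  have [Jz|nJz] := pselect (J z); last by right; left.
  exfalso.
  (* From this time on the flipped coordinate is below - M, so [P] does not see it, and [eps]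
     vanishes there. *)
  pose n0 := (absz k + M).+1.
  have far n : (n0 <= n)%N -> (P (iter n S z) <-> P (iter n S z')) /\
                             (Q (iter n S z) <-> Q (iter n S z')).
    move=> n0n; have [_ _ h] := hN n.
    have hx := h x (fun Nn => nNx (ex_intro2 _ _ n I Nn)).
    have [kn ki] := far_past n0n.
    (* The two late orbits have the same height, as the weight of a flip in the past is 1. *)
    have t' : cocycle f n (flip k x) * (flip_weight k (x k) * t) = cocycle f n x * t.
      by rewrite mulrA hx flip_weight_le0// mul1r.
    rewrite /z' /z /flip_ext/= !iter_maharam -!/(cocycle f n _) t'.
    split; last by split=> /ray_setP h1; apply/ray_setP.
    have agree i : - M%:Z <= i -> iter n bshift x i = iter n bshift (flip k x) i.
      by move=> iM; rewrite iter_bshift shiftn_flip flip_other// ki.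
    by split; apply: dP => i /agree.
  have hV w N' : ~ H w -> 4 * \sum_(0 <= n < N') \1_V (iter n S w) <=
      \sum_(0 <= n < N') (\1_Q (iter n S w) : R).
    by move=> nHw; rewrite !big_mkord; exact: hopf_setN.
  pose RN N' := \sum_(n0 <= n < N') (\1_Q (iter n S z) : R).
  have RNb N' : (n0 <= N')%N -> RN N' <= n0%:R.
    move=> nN; have := hV _ N' nHz; have := hV _ N' nHz'.
    rewrite !(big_cat_nat (m := 0) (n := n0) (p := N'))//=.
    set a1 := \sum_(0 <= i < n0) \1_V (iter i S z).
    set a2 := \sum_(0 <= i < n0) \1_V (iter i S z').
    have a1p : 0 <= a1 by apply: sumr_ge0 => i _; rewrite indicE.
    have a2p : 0 <= a2 by apply: sumr_ge0 => i _; rewrite indicE.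
    have le1 w : \sum_(0 <= i < n0) (\1_Q (iter i S w) : R) <= n0%:R.
      apply: (@le_trans _ _ (\sum_(0 <= i < n0) 1)).
        by apply: ler_sum => i _; rewrite indicE lern1; case: (_ \in _).
      by rewrite sumr_const_nat subn0.
    have le1z := le1 z; have le1z' := le1 z'.
    have EQ : \sum_(n0 <= i < N') (\1_Q (iter i S z') : R) = RN N'.
      apply: eq_big_nat => i /andP[ni _]; have [_ h] := far i ni.
      by rewrite !indicE; congr (nat_of_bool _)%:R; apply/idP/idP; rewrite !inE => /h.
    have EV : \sum_(n0 <= i < N') (\1_V (iter i S z) : R) +
              \sum_(n0 <= i < N') (\1_V (iter i S z') : R) = RN N'.
      rewrite -big_split/=; apply: eq_big_nat => i /andP[ni _]; have [hp hq] := far i ni.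
      have e1 : E (iter i S z) by apply/iterE.
      have e2 : ~ E (iter i S z') by move/iterE.
      exact: indic_symdiff e1 e2 hp hq.
    rewrite EQ -/(RN N') => h' h.
    exact: visit_count h h' a1p a2p le1z le1z' EV.
  have RNinf (K : nat) : exists N', (n0 <= N')%N /\ K%:R <= RN N'.
    elim: K => [|K [N' [nN IH]]].
      by exists n0; split => //; rewrite /RN big_geq.
    have /infinitely_oftenP/(_ N')[n Nn Qn] := Jz.
    exists n.+1; split; first exact: leq_trans nN (leqW Nn).
    rewrite /RN big_nat_recr/=; last exact: leq_trans nN Nn.
    rewrite indicE mem_set//= -natr1 lerD2r; apply: (le_trans IH).
    by rewrite /RN [leRHS](big_cat_nat (n := N'))//= lerDl sumr_ge0.
  have [N' [nN]] := RNinf n0.+1; have := RNb N' nN; rewrite -natr1 => h1 h2.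
  by have := le_trans h2 h1; rewrite -subr_ge0 opprD addrA subrr add0r oppr_ge0 ler10.
apply: (le_trans hb); rewrite measureU0//; last exact: measurableU.
have hU := measureU2 m mQH mF; apply: (le_trans hU).
apply: (le_trans (leeD hH hH')); rewrite -EFinD lee_fin.
rewrite (_ : 4 * d + _ = d * (4 * (1 + lam^-1))); last by ring.
by rewrite /d divfK ?gt_eqF.
Qed.

Lemma flip_invariant : m (E `&` flip_ext k @^-1` (~` E)) = 0%E.
Proof.
have mD : measurable (E `&` flip_ext k @^-1` (~` E)).
  by apply: measurableI => //; apply: preimage_measurable mflip _; exact: measurableC.
apply: null_on_ray_sets => // b b0.
(* A flip lowers the height by at most the factor e^(- eps_k), so from a height above [b] both
   points stay above this level. *)
have a0 : 0 < expR (- eps k) * b by rewrite mulr_gt0// expR_gt0.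
have mDb : measurable (E `&` flip_ext k @^-1` (~` E) `&` ray_set b).
  by apply: measurableI => //; exact: measurable_ray_set.
apply/eqP; rewrite -measure_le0 -(bad_null a0).
apply: le_measure (mem_set mDb) (mem_set (mbad _)) _ => -[x t] [Dz /ray_setP/= bt].
have e0 : 0 <= eps k by exact: (eps_ge0 heps eps_le0).
have wk : expR (- eps k) <= flip_weight k (x k).
  by rewrite /flip_weight ler_expR; case: (x k) => //; rewrite (le_trans _ e0)// oppr_le0.
split => //; split; apply/ray_setP => /=.
  apply: le_lt_trans bt; apply: ler_piMl; first exact: ltW.
  by rewrite -expR0 ler_expR oppr_le0.
apply: (@lt_le_trans _ _ (expR (- eps k) * t)); first by rewrite ltr_pM2l// expR_gt0.
by apply: ler_wpM2r => //; exact/ltW/(lt_trans b0).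
Qed.

End hopf_argument.

End maharam_of_shift.

(** * Ergodicity of the flips *)

Section ray_integrals.
Context (R : realType).
Local Notation nu := (@inv_leb R).
Implicit Types B : set R.

Definition ray_mass (b : R) B : R := fine (nu (B `&` `]b, +oo[)).

Section fixed_set.
Context (B : set R) (mB : measurable B).

Lemma ray_massE b : 0 < b -> nu (B `&` `]b, +oo[) = (ray_mass b B)%:E.
Proof.
move=> b0; rewrite /ray_mass fineK// ge0_fin_numE//.
apply: (@le_lt_trans _ _ (nu `]b, +oo[)); last by rewrite inv_leb_ray// ltry.
by apply: le_measure; rewrite ?inE//; exact: measurableI.
Qed.

Lemma ray_mass_ge0 b : 0 <= ray_mass b B.
Proof. exact: fine_ge0. Qed.

Lemma ray_mass_le b : 0 < b -> ray_mass b B <= b^-1.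
Proof.
move=> b0; rewrite -lee_fin -ray_massE// -inv_leb_ray//.
by apply: le_measure; rewrite ?inE//; exact: measurableI.
Qed.

Lemma ray_mass_nincr b b' : 0 < b -> b <= b' -> ray_mass b' B <= ray_mass b B.
Proof.
move=> b0 bb'; rewrite -lee_fin -!ray_massE//; last exact: lt_le_trans bb'.
apply: le_measure; rewrite ?inE; [exact: measurableI|exact: measurableI|].
move=> t [Bt]; rewrite /= !in_itv/= !andbT => h; split => //.
exact: le_lt_trans h.
Qed.

End fixed_set.

Lemma ray_massC B b : measurable B -> 0 < b ->
  ray_mass b B + ray_mass b (~` B) = b^-1.
Proof.
move=> mB b0; apply: EFin_inj; rewrite EFinD -!ray_massE//; last exact: measurableC.
rewrite -inv_leb_ray// -measureU.
- by congr (nu _); rewrite -setIUl setUv setTI.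
- exact: measurableI.
- by apply: measurableI => //; exact: measurableC.
- by rewrite setIACA setICr set0I.
Qed.

(** The masses of [B] and of its complement add up to 1/b, and that of the complement decreases in b
    too. *)
Lemma ray_mass_lip B b b' : measurable B -> 0 < b -> b <= b' ->
  ray_mass b B - ray_mass b' B <= b^-1 - b'^-1.
Proof.
move=> mB b0 bb'; have b'0 := lt_le_trans b0 bb'.
have := ray_mass_nincr (measurableC mB) b0 bb'.
have := ray_massC mB b0; have := ray_massC mB b'0; lra.
Qed.

Lemma ray_mass_null B B' b : measurable B -> measurable B' ->
  nu (B `\` B') = 0%E -> nu (B' `\` B) = 0%E -> ray_mass b B = ray_mass b B'.
Proof.
move=> mB mB' h h'; rewrite /ray_mass; congr fine.
have sub A A' : measurable A -> measurable A' -> nu (A `\` A') = 0%E ->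
    (nu (A `&` `]b, +oo[) <= nu (A' `&` `]b, +oo[))%E.
  move=> mA mA' A0; apply: (@le_trans _ _ (nu ((A' `&` `]b, +oo[) `|` (A `\` A')))).
    apply: le_measure; rewrite ?inE.
    - exact: measurableI.
    - by apply: measurableU; [exact: measurableI|exact: measurableD].
    - by move=> t [At bt]; have [A't|nA't] := pselect (A' t); [left|right].
  rewrite measureU0//; [exact: measurableI|exact: measurableD].
by apply/eqP; rewrite eq_le !sub.
Qed.

Section dilation.
Context (B : set R) (mB : measurable B) (c : R) (c1 : 1 <= c).

Let c0 : 0 < c. Proof. exact: lt_le_trans c1. Qed.
Let B' : set R := *%R c @^-1` B.
Let mB' : measurable B'.
Proof. by apply: preimage_measurable mB; exact: mulrl_measurable. Qed.

Lemma ray_mass_dilation b : 0 < b -> ray_mass b B' = c * ray_mass (c * b) B.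
Proof.
move=> b0; apply: EFin_inj; rewrite EFinM -!ray_massE ?mulr_gt0//.
rewrite -inv_leb_scale//; last exact: measurableI.
congr (nu _); apply/seteqP; split => t [Bt bt]; split => //=; move: bt;
  by rewrite /= !in_itv/= !andbT ltr_pM2l.
Qed.

(** With u and v the masses above c b and above b, the change is (c - 1) b u - b (v - u), a
    difference of two numbers in [0, 1 - 1/c]. *)
Lemma ray_mass_dilation_dist b : 0 < b ->
  `|b * ray_mass b B' - b * ray_mass b B| <= c - 1.
Proof.
move=> b0; rewrite ray_mass_dilation//.
have cb0 : 0 < c * b by rewrite mulr_gt0.
have bcb : b <= c * b by rewrite ler_pMl.
have h1 := ray_mass_lip mB b0 bcb; have h2 := ray_mass_nincr mB b0 bcb.
have h3 := ray_mass_ge0 B (c * b); have h4 := ray_mass_le mB cb0.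
move: h1 h2 h3 h4; move: (ray_mass (c * b) B) (ray_mass b B) => u v h1 h2 h3 h4.
have e1 : b * b^-1 = 1 by rewrite divff// gt_eqF.
have e2 : c * b * (c * b)^-1 = 1 by rewrite divff// gt_eqF.
have ci : b * (c * b)^-1 = c^-1 by field; rewrite !gt_eqF.
have ci0 : 0 < c^-1 by rewrite invr_gt0.
have cc : c * c^-1 = 1 by rewrite divff// gt_eqF.
have g1 : b * (v - u) <= 1 - c^-1 by rewrite -e1 -ci -mulrBr ler_wpM2l// ltW.
have g2 : b * u <= c^-1 by rewrite -ci ler_wpM2l// ltW.
have g3 : 0 <= b * u by rewrite mulr_ge0// ltW.
have g4 : 0 <= b * (v - u) by rewrite mulr_ge0 ?subr_ge0// ltW.
have g5 : 1 - c^-1 <= c - 1.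
  have : 0 <= (c - 1) ^+ 2 * c^-1 by rewrite mulr_ge0 ?sqr_ge0// ltW.
  have -> : (c - 1) ^+ 2 * c^-1 = c - 2 + c^-1 by field; rewrite gt_eqF.
  lra.
have g6 : (c - 1) * (b * u) <= (c - 1) * c^-1 by rewrite ler_wpM2l// subr_ge0.
have g7 : 0 <= (c - 1) * (b * u) by rewrite mulr_ge0// subr_ge0.
have g8 : (c - 1) * c^-1 = 1 - c^-1 by rewrite mulrBl cc mul1r.
rewrite ler_norml; apply/andP; split; lra.
Qed.

Lemma integral_dilation (u : R -> \bar R) : measurable_fun setT u -> (forall t, 0 <= u t)%E ->
  (\int[nu]_t u (c * t)%R = c%:E * \int[nu]_t u t)%E.
Proof.
move=> mu u0.
have mc : measurable_fun setT ( *%R c : R -> R) by exact: mulrl_measurable.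
have c0' : 0 <= c by exact: ltW.
rewrite -(ge0_integral_mscale nu measurableT (NngNum c0'))//.
rewrite [RHS](eq_measure_integral (image_measure nu mc)); last first.
  by move=> A mA _; have := inv_leb_scale c0 mA.
by rewrite (ge0_integral_pushforward mc).
Qed.

Context (b1 b2 : R) (b20 : 0 < b2) (b21 : b2 <= b1).

Let b10 : 0 < b1. Proof. exact: lt_le_trans b21. Qed.

(* The integral over [b] in [b2, b1] of the indicator of ]b, +oo[. Averaging over [b]
   gives [trapezoid_mass] a first order expansion under dilations of the set, which
   [ray_mass] lacks. *)
Definition trapezoid (t : R) : R := Num.min b1 t - Num.min b2 t.

Lemma measurable_minl (b : R) : measurable_fun setT (fun t : R => Num.min b t).
Proof. by apply: measurable_minr; [exact: measurable_cst|exact: measurable_id]. Qed.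

Lemma measurable_trapezoid : measurable_fun setT trapezoid.
Proof. by apply: measurable_funB; exact: measurable_minl. Qed.

Lemma min_dist (x y t : R) : x <= y ->
  0 <= Num.min y t - Num.min x t <= (y - x) * \1_(`]x, +oo[%classic : set R) t /\
  (y - x) * \1_(`]y, +oo[%classic : set R) t <= Num.min y t - Num.min x t.
Proof.
move=> xy; rewrite !indicE !mem_setE !in_itv/= !andbT.
rewrite /Num.min; case: (ltP x t) => xt; case: (ltP y t) => yt; rewrite /= ?mulr1 ?mulr0.
- by split; [apply/andP; split|]; lra.
- by split; [apply/andP; split|]; lra.
- by exfalso; lra.
- by split; [apply/andP; split|]; lra.
Qed.

Lemma trapezoid_ge0 t : 0 <= trapezoid t.
Proof. by have [/andP[]] := min_dist t b21. Qed.

Definition trapezoid_mass A : R := fine (\int[nu]_(t in A) (trapezoid t)%:E).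

Let ray_int (a b : R) A : measurable A -> 0 <= a -> 0 < b ->
  (\int[nu]_(t in A) (a * \1_(`]b, +oo[%classic : set R) t)%:E = (a * ray_mass b A)%:E)%E.
Proof.
move=> mA a0 b0; under eq_integral do rewrite EFinM.
rewrite ge0_integralZl_EFin//; last by apply/measurable_EFinP; exact: measurable_indic.
by rewrite integral_indic// EFinM -(ray_massE mA b0) setIC.
Qed.

Let min_int (x y : R) A : measurable A -> 0 < x -> x <= y ->
  let D := (\int[nu]_(t in A) (Num.min y t - Num.min x t)%:E)%E in
  (((y - x) * ray_mass y A)%:E <= D <= ((y - x) * ray_mass x A)%:E)%E.
Proof.
move=> mA x0 xy; lazy zeta; have y0 := lt_le_trans x0 xy.
have yx : 0 <= y - x by rewrite subr_ge0.
have mm : measurable_fun A (fun t => (Num.min y t - Num.min x t)%:E).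
  by apply/measurable_EFinP/measurable_funTS/measurable_funB; exact: measurable_minl.
have mi b : measurable_fun A (fun t => ((y - x) * \1_(`]b, +oo[%classic : set R) t)%:E).
  by apply/measurable_EFinP/measurable_funTS/measurable_funM;
    [exact: measurable_cst|exact: measurable_indic].
rewrite -!ray_int//; apply/andP; split; apply: ge0_le_integral => //.
- by move=> t _; rewrite lee_fin mulr_ge0.
- by move=> t _; rewrite lee_fin; have [_] := min_dist t xy.
- by move=> t _; rewrite lee_fin; have [/andP[]] := min_dist t xy.
- by move=> t _; rewrite lee_fin; have [/andP[]] := min_dist t xy.
Qed.

Lemma trapezoid_massE A : measurable A ->
  (\int[nu]_(t in A) (trapezoid t)%:E = (trapezoid_mass A)%:E)%E.
Proof.
move=> mA; rewrite /trapezoid_mass fineK// ge0_fin_numE; last first.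
  by apply: integral_ge0 => t _; rewrite lee_fin trapezoid_ge0.
by have /andP[_ h] := min_int mA b20 b21; apply: le_lt_trans h (ltry _).
Qed.

Lemma trapezoid_mass_range A : measurable A -> 0 <= trapezoid_mass A <= (b1 - b2) / b2.
Proof.
move=> mA; apply/andP; split.
  by apply/fine_ge0/integral_ge0 => t _; rewrite lee_fin trapezoid_ge0.
rewrite -lee_fin -trapezoid_massE//.
have /andP[_ h] := min_int mA b20 b21; apply: (le_trans h).
by rewrite lee_fin ler_wpM2l ?subr_ge0// ray_mass_le.
Qed.

Lemma trapezoid_mass_null A A' : measurable A -> measurable A' ->
  nu (A `\` A') = 0%E -> nu (A' `\` A) = 0%E -> trapezoid_mass A = trapezoid_mass A'.
Proof.
have half A1 A2 : measurable A1 -> measurable A2 -> nu (A1 `\` A2) = 0%E ->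
    (\int[nu]_(t in A1) (trapezoid t)%:E = \int[nu]_(t in A1 `&` A2) (trapezoid t)%:E)%E.
  move=> mA1 mA2 h; rewrite (@ge0_negligible_integral _ _ _ nu A1 (A1 `\` A2))//.
  - by rewrite setDD.
  - exact: measurableD.
  - by apply/measurable_EFinP/measurable_funTS; exact: measurable_trapezoid.
  - by move=> t _; rewrite lee_fin trapezoid_ge0.
by move=> mA mA' h h'; rewrite /trapezoid_mass (half A A')// (half A' A)// setIC.
Qed.

(** Rescaling turns the mass of the dilated set into the integral over [B] of the trapezoid between
    c b2 and c b1. The change is then [D b1 - D b2], where [D b] integrates [ray_mass] over the
    levels from b to c b: it is (c - 1) b times [ray_mass] at b, less at most (c - 1)^2. *)
Lemma trapezoid_mass_dilation :
  `|trapezoid_mass B' - trapezoid_mass B -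
    (c - 1) * (b1 * ray_mass b1 B - b2 * ray_mass b2 B)| <= (c - 1) ^+ 2.
Proof.
have b1c : b1 <= c * b1 by rewrite ler_pMl.
have b2c : b2 <= c * b2 by rewrite ler_pMl.
have cb21 : c * b2 <= c * b1 by rewrite ler_pM2l.
pose phic t := Num.min (c * b1) t - Num.min (c * b2) t.
have phicE t : c * trapezoid t = phic (c * t).
  by rewrite /trapezoid /phic mulrBr !minr_pMr ?ltW.
have mphic : measurable_fun setT phic by apply: measurable_funB; exact: measurable_minl.
have JB' : (trapezoid_mass B')%:E = (\int[nu]_(t in B) (phic t)%:E)%E.
  rewrite -trapezoid_massE// integral_mkcond.
  have cE : (c^-1 * c)%:E = 1%E :> \bar R by rewrite mulVf// gt_eqF.
  rewrite -[LHS]mul1e -cE EFinM -muleA.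
  rewrite -ge0_integralZl//; last 3 first.
  - apply/measurable_restrict => //; rewrite setTI; apply/measurable_EFinP/measurable_funTS.
    exact: measurable_trapezoid.
  - by move=> t _; rewrite /patch; case: ifP => // _; rewrite lee_fin trapezoid_ge0.
  - by rewrite lee_fin ltW.
  rewrite [in RHS]integral_mkcond.
  have -> : (\int[nu]_x (c%:E * ((fun t => (trapezoid t)%:E) \_ B') x) =
             \int[nu]_x ((fun t => (phic t)%:E) \_ B) (c * x)%R)%E.
    apply: eq_integral => t _; rewrite /patch.
    have -> : (t \in B') = (c * t \in B) by apply/idP/idP; rewrite !inE.
    by case: ifP => _; rewrite ?mule0// -EFinM phicE.
  rewrite integral_dilation; last 2 first.
  - by apply/measurable_restrict => //; rewrite setTI; apply/measurable_EFinP/measurable_funTS.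
  - move=> t; rewrite /patch; case: ifP => // _; rewrite lee_fin.
    by have [/andP[]] := min_dist t cb21.
  by rewrite muleA -EFinM cE mul1e.
pose D b := (\int[nu]_(t in B) (Num.min (c * b) t - Num.min b t)%:E)%E.
have mD b : measurable_fun B (fun t => (Num.min (c * b) t - Num.min b t)%:E).
  by apply/measurable_EFinP/measurable_funTS/measurable_funB; exact: measurable_minl.
have sumE : (\int[nu]_(t in B) (phic t)%:E + D b2 =
             \int[nu]_(t in B) (trapezoid t)%:E + D b1)%E.
  rewrite /D -!ge0_integralD//.
  - apply: eq_integral => t _; rewrite -!EFinD; congr (_%:E).
    by rewrite /phic /trapezoid; ring.
  - by move=> t _; rewrite lee_fin trapezoid_ge0.
  - by apply/measurable_EFinP/measurable_funTS; exact: measurable_trapezoid.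
  - by move=> t _; rewrite lee_fin; have [/andP[]] := min_dist t b1c.
  - by move=> t _; rewrite lee_fin; have [/andP[]] := min_dist t cb21.
  - by apply/measurable_EFinP/measurable_funTS.
  - by move=> t _; rewrite lee_fin; have [/andP[]] := min_dist t b2c.
have key b : 0 < b -> exists d, [/\ D b = d%:E,
    (c - 1) * (b * ray_mass b B) - (c - 1) ^+ 2 <= d & d <= (c - 1) * (b * ray_mass b B)].
  move=> b0; have bc : b <= c * b by rewrite ler_pMl.
  have /andP[h1 h2] := min_int mB b0 bc.
  have Dfin : D b \is a fin_num.
    rewrite ge0_fin_numE; first exact: le_lt_trans h2 (ltry _).
    by apply: integral_ge0 => t _; rewrite lee_fin; have [/andP[]] := min_dist t bc.
  exists (fine (D b)); rewrite fineK//; split => //; rewrite -lee_fin fineK//.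
    apply: le_trans h1; rewrite lee_fin.
    have hl := ray_mass_lip mB b0 bc.
    have cb0 : 0 < c * b by rewrite mulr_gt0.
    have cb : b * (b^-1 - (c * b)^-1) = (c - 1) * c^-1 by field; rewrite !gt_eqF.
    have ci1 : c^-1 <= 1 by rewrite invf_le1.
    have h3 : b * (ray_mass b B - ray_mass (c * b) B) <= c - 1.
      apply: (@le_trans _ _ ((c - 1) * c^-1)); first by rewrite -cb ler_wpM2l// ltW.
      by apply: ler_piMr => //; rewrite subr_ge0.
    have : (c - 1) * (b * (ray_mass b B - ray_mass (c * b) B)) <= (c - 1) * (c - 1).
      by rewrite ler_wpM2l// subr_ge0.
    rewrite expr2; lra.
  by apply: le_trans h2 _; rewrite lee_fin le_eqVlt; apply/orP; left; apply/eqP; ring.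
have [d1 [D1 l1 u1]] := key b1 b10; have [d2 [D2 l2 u2]] := key b2 b20.
move: sumE; rewrite -JB' trapezoid_massE// D1 D2 -!EFinD => -[sumE].
rewrite ler_norml; apply/andP; split; lra.
Qed.

End dilation.

End ray_integrals.

Section almost_everywhere.
Context d (T : measurableType d) (R : realType) (P : probability T R).

Lemma Ex_ae_norm (u v : T -> R) N : bmeas u -> bmeas v -> measurable N -> P N = 0%E ->
  (forall x, ~ N x -> `|u x| <= v x) -> `|Ex P u| <= Ex P v.
Proof.
move=> hu hv mN N0 h; have [mu [M uM]] := hu; have [mv [K vK]] := hv.
have hN : bmeas (\1_N : T -> R) by exact: bmeas_indic.
have -> : Ex P v = Ex P (fun x => v x + (M + K) * \1_N x).
  rewrite ExD//; last exact: bmeasZ.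
  rewrite ExZ// (_ : Ex P \1_N = 0) ?mulr0 ?addr0//.
  by apply: EFin_inj; rewrite Ex_indic.
have hb : bmeas (fun x => v x + (M + K) * \1_N x) by apply: bmeasD => //; exact: bmeasZ.
have hle x : `|u x| <= v x + (M + K) * \1_N x.
  rewrite indicE; have [Nx|Nx] := pselect (N x).
    have := uM x; have := vK x; rewrite mem_set//= mulr1 ler_norml => /andP[h1 _]; lra.
  by rewrite memNset//= mulr0 addr0 h.
rewrite ler_norml; apply/andP; split.
  rewrite lerNl -[leLHS]mulN1r -ExZ//; apply: Ex_le => //; first exact: bmeasZ.
  by move=> x; rewrite mulN1r (le_trans _ (hle x))// -normrN ler_norm.
by apply: Ex_le => // x; rewrite (le_trans _ (hle x))// ler_norm.
Qed.

Lemma Ex_ae_eq (u v : T -> R) N : bmeas u -> bmeas v -> measurable N -> P N = 0%E ->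
  (forall x, ~ N x -> u x = v x) -> Ex P u = Ex P v.
Proof.
move=> hu hv mN N0 h; apply/eqP; rewrite -subr_eq0 -ExB// -normr_le0.
rewrite -(Ex_cst P 0); apply: (Ex_ae_norm _ _ mN N0).
- exact: bmeasB.
- exact: bmeas_cst.
- by move=> x /h ->; rewrite subrr normr0.
Qed.

Lemma null_sections (D : set (T * R)) : measurable D -> (P \x inv_leb (R := R))%E D = 0%E ->
  exists N, [/\ measurable N, P N = 0%E & forall x, ~ N x -> inv_leb (xsection D x) = 0%E].
Proof.
move=> mD D0.
have mf : measurable_fun setT (fun x => inv_leb (R := R) (xsection D x)).
  exact: (measurable_fun_xsection (inv_leb (R := R)) mD).
have [/(_ _)[]] := ae_eq_integral_abs P measurableT mf.
  by under eq_integral do rewrite gee0_abs//.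
move=> N [mN N0 hN] _; exists N; split => // x Nx.
by apply: contrapT => h; apply: Nx; apply: hN => /= /(_ I).
Qed.

End almost_everywhere.

Section section_masses.
Context d (T : measurableType d) (R : realType) (E : set (T * R)) (mE : measurable E).
Local Notation nu := (@inv_leb R).

Lemma bmeas_ray_mass b : 0 < b -> bmeas (fun x => ray_mass b (xsection E x)).
Proof.
move=> b0; split; last first.
  exists b^-1 => x; rewrite ger0_norm ?ray_mass_ge0//.
  by apply: ray_mass_le => //; exact: measurable_xsection.
have mE' : measurable (E `&` snd @^-1` `]b, +oo[).
  by apply: measurableI => //; exact: preimage_measurable measurable_snd _.
apply/measurable_EFinP; have := measurable_fun_xsection nu mE'.
congr measurable_fun; apply/funext => x /=; rewrite -ray_massE//; last exact: measurable_xsection.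
by congr (nu _); apply/seteqP; split => t; rewrite /xsection /= !inE.
Qed.

Lemma bmeas_trapezoid_mass b1 b2 : 0 < b2 -> b2 <= b1 ->
  bmeas (fun x => trapezoid_mass b1 b2 (xsection E x)).
Proof.
move=> b20 b21; split; last first.
  exists ((b1 - b2) / b2) => x.
  have /andP[h0 h1] := trapezoid_mass_range b20 b21 (measurable_xsection x mE).
  by rewrite ger0_norm.
apply/measurable_EFinP.
pose g (z : T * R) : \bar R := ((trapezoid b1 b2 z.2)%:E * (\1_E z)%:E)%E.
have mg : measurable_fun setT g.
  apply: emeasurable_funM; apply/measurable_EFinP.
    exact: measurableT_comp (measurable_trapezoid b1 b2) measurable_snd.
  exact: measurable_indic.
have g0 z : (0 <= g z)%E by rewrite mule_ge0// lee_fin ?trapezoid_ge0// indicE.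
have := measurable_fun_fubini_tonelli_F (m2 := nu) g mg g0.
congr measurable_fun; apply/funext => x /=.
rewrite -trapezoid_massE//; last exact: measurable_xsection.
rewrite [RHS]integral_mkcond /fubini_F; apply: eq_integral => t _.
rewrite /g patchE/= indicE (_ : (t \in xsection E x) = ((x, t) \in E)); last first.
  by apply/idP/idP; rewrite /xsection !inE/= inE.
by case: ifP; rewrite ?mule1 ?mule0.
Qed.

End section_masses.

Section product_generators.
Context (R : realType).
Local Notation X := shift_space.

(** Negative levels are allowed so that countably many of these sets cover the space; the empty set
    makes the family stable under intersection. *)
Definition cylinder_rays : set (set (X * R)) :=
  [set A | A = set0 \/ exists F a b, A = cylinder F a `*` `]b, +oo[].

Lemma measurable_cylinder_rays A : cylinder_rays A -> measurable A.
Proof.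
move=> [->//|[F [a [b ->]]]]; apply: measurableX => //; exact: measurable_cylinder.
Qed.

Lemma cylinder_rays_setI : setI_closed cylinder_rays.
Proof.
move=> A B [->|[F [a [b ->]]]]; first by rewrite set0I; left.
move=> [->|[F' [a' [b' ->]]]]; first by rewrite setI0; left.
have hc F1 a1 : cylinders0 (cylinder F1 a1) by left; exists F1, a1.
rewrite -setXI; have [[F'' [a'' ->]]|->] := cylinders0_setI (hc F a) (hc F' a').
- right; exists F'', a'', (Num.max b b'); congr (_ `*` _).
  by apply/seteqP; split => t; rewrite /= !in_itv/= !andbT gt_max => /andP.
- by left; rewrite set0X.
Qed.

Lemma rays_cover : \bigcup_k (setT `*` `](- k%:R), +oo[) = [set: X * R].
Proof.
apply/seteqP; split => // -[x t] _; exists (Num.truncn `|t|).+1 => //; split => //=.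
rewrite in_itv/= andbT ltrNl; apply: le_lt_trans (truncnS_gt _).
by rewrite -normrN ler_norm.
Qed.

Lemma cylinder_rays_gen : @measurable _ (X * R)%type = <<s cylinder_rays >>.
Proof.
apply/seteqP; split; last first.
  by apply: smallest_sub; [exact: sigma_algebra_measurable|exact: measurable_cylinder_rays].
have genU (B : nat -> set (X * R)) : (forall k, <<s cylinder_rays >> (B k)) ->
    <<s cylinder_rays >> (\bigcup_k B k).
  by have [_ _] := smallest_sigma_algebra setT cylinder_rays; apply.
apply: smallest_sub; first exact: smallest_sigma_algebra.
move=> _ [[A mA <-]|[A mA <-]]; rewrite setTI.
  have : <<s cylinders >> `<=` image_set_system setT (@fst X R) <<s cylinder_rays >>.
    apply: smallest_sub; first exact/sigma_algebra_image/smallest_sigma_algebra.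
    move=> _ [F [a ->]]; rewrite /image_set_system /= setTI.
    have -> : (@fst X R) @^-1` cylinder F a =
        \bigcup_k (cylinder F a `*` `](- k%:R), +oo[).
      apply/seteqP; split => [[x t] Fx|[x t] [k _ []]//].
      have : (\bigcup_k (setT `*` `](- k%:R), +oo[)) (x, t) by rewrite rays_cover.
      by move=> [k _ [_ kt]]; exists k.
    by apply: genU => k; apply: sub_sigma_algebra; right; exists F, a, (- k%:R).
  by move=> /(_ A mA); rewrite /image_set_system /= setTI.
have : <<s @RGenOInfty.G R >> `<=` image_set_system setT (@snd X R) <<s cylinder_rays >>.
  apply: smallest_sub; first exact/sigma_algebra_image/smallest_sigma_algebra.
  move=> _ [b ->]; rewrite /image_set_system /= setTI.
  apply: sub_sigma_algebra; right; exists fset0, (fun=> true), b.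
  by rewrite cylinder_fset0; apply/seteqP; split => [z bz|z []//].
move=> /(_ A); rewrite /image_set_system /= setTI; apply.
have RE : @measurable _ R = <<s @RGenOInfty.G R >> := RGenOInfty.measurableE R.
by rewrite -RE.
Qed.

End product_generators.

Lemma coord_split (R : comPzRingType) (qt qf c u A0 A1 S : R) :
  A0 = qf * (c * u) -> c * (qt * u) = A1 -> S = A1 + A0 -> qt + qf = 1 ->
  A1 = qt * S /\ A0 = qf * S.
Proof.
move=> -> <- -> h; split; rewrite -[LHS]mul1r -h; ring.
Qed.

(** [A] is the covariance with the combined score and [V] its energy. The second bound comes from
    [Ex_cross] with t = e V: after division by 2 e V^2 one term is small with [e], the other for
    large [V]. *)
Lemma energy_optimum (R : realFieldType) (Lam A V K C d e : R) : 0 < V -> 0 < e ->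
  `|A + Lam * V| <= 3 * d * V -> 2 * (e * V) * `|A| <= (e * V) ^+ 2 * K + C * V ->
  `|Lam| <= 3 * d + e * K / 2 + C / (2 * e * V).
Proof.
move=> V0 e0 h1 h2; have eV : 0 < 2 * (e * V) by rewrite !mulr_gt0.
have hL : `|Lam| * V <= 3 * d * V + `|A|.
  rewrite -(gtr0_norm V0) -normrM (gtr0_norm V0) -[X in `|X|](addKr A).
  by rewrite (le_trans (ler_normD _ _))// normrN addrC lerD2r.
have hA : `|A| <= e * V * K / 2 + C / (2 * e).
  rewrite -(ler_pM2l eV); apply: le_trans h2 _; rewrite le_eqVlt; apply/orP; left.
  by apply/eqP; field; rewrite gt_eqF.
rewrite -(ler_pM2r V0); apply: (le_trans hL); apply: le_trans (lerD (lexx _) hA) _.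
by rewrite le_eqVlt; apply/orP; left; apply/eqP; field; rewrite !gt_eqF.
Qed.

(** Three shares of r / 3: [d] and [e] are fixed first, then [V] is taken large. The choice of [e]
    has K + 1 in its denominator since [K] may be 0. *)
Lemma energy_limit (R : realFieldType) (Lam K C : R) : 0 <= K -> 0 <= C ->
  (forall d e V1, 0 < d -> 0 < e -> exists V, [/\ 0 < V, V1 <= V &
    `|Lam| <= 3 * d + e * K / 2 + C / (2 * e * V)]) -> Lam = 0.
Proof.
move=> K0 C0 h; apply/eqP; rewrite -normr_le0; apply/ler_addgt0Pr => r r0; rewrite add0r.
have K1 : 0 < K + 1 by rewrite ltr_wpDl.
have d0 : 0 < r / 9 by rewrite divr_gt0.
have [e eE e0] : exists2 e, e = 2 * r / (3 * (K + 1)) & 0 < e.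
  by exists (2 * r / (3 * (K + 1))) => //; rewrite divr_gt0 ?mulr_gt0.
have [V [V0 VV /le_trans]] := h _ _ (3 * C / (2 * e * r)) d0 e0; apply.
have t2 : e * K / 2 <= r / 3.
  have -> : e * K / 2 = r / 3 * (K / (K + 1)) by rewrite eE; field; rewrite gt_eqF.
  by apply: ler_piMr; [rewrite divr_ge0// ltW|rewrite ler_pdivrMr// mul1r lerDl].
have t3 : C / (2 * e * V) <= r / 3.
  rewrite ler_pdivrMr ?mulr_gt0//.
  have -> : C = r / 3 * (2 * e) * (3 * C / (2 * e * r)) by field; rewrite !gt_eqF.
  rewrite [leRHS]mulrA; apply: ler_wpM2l => //.
  have r3 : 0 <= r / 3 by apply: ltW; exact: divr_gt0.
  have e2 : 0 <= 2 * e by apply: mulr_ge0 => //; exact: ltW.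
  exact: mulr_ge0.
lra.
Qed.

(** The indices 0 and 1 stand for the value false or true of one coordinate. The expression is w
    times a qf (p0 - p1) - (g0 - g1 - a p1), whence 2 a^2 + a^2. *)
Lemma response_bound (R : realFieldType) (w a qt qf g0 g1 p0 p1 : R) :
  0 <= w -> w <= 1 -> `|g0 - g1 - a * p1| <= a ^+ 2 -> `|p0 - p1| <= 2 * a ->
  0 <= a -> 0 <= qf -> 0 <= qt -> qt + qf = 1 ->
  `|w * g1 - w * g0 + a * (qt * (w * p1) + qf * (w * p0))| <= 3 * a ^+ 2.
Proof.
move=> w0 w1 h1 h2 a0 qf0 qt0 qs; have qtE : qt = 1 - qf by lra.
have -> : w * g1 - w * g0 + a * (qt * (w * p1) + qf * (w * p0)) =
          w * (a * qf * (p0 - p1) - (g0 - g1 - a * p1)) by rewrite qtE; ring.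
rewrite normrM (ger0_norm w0).
have -> : 3 * a ^+ 2 = 1 * (a * 1 * (2 * a) + a ^+ 2) by ring.
apply: ler_pM => //; apply: (le_trans (ler_normB _ _)); apply: lerD => //.
rewrite !normrM (ger0_norm a0) (ger0_norm qf0); apply: ler_pM => //; first exact: mulr_ge0.
by apply: ler_wpM2l => //; lra.
Qed.

Lemma maxn_lt_int (n N : nat) (k : int) : (maxn n N)%:Z < k ->
  n%:Z < k /\ exists2 j : nat, k = j%:Z & (N <= j)%N.
Proof. by move=> h; split; [lia|exists (absz k); lia]. Qed.

(** * Sets invariant under all flips are trivial *)

Section fiber_energy.
Context (R : realType) (lam : R) (hlam : 0 < lam < 1) (eta : nat -> R).
Hypothesis eta_cvg0 : eta n @[n --> \oo] --> 0.
Context (eps : int -> R) (L l : nat -> nat).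
Hypothesis heps : inductive_procedure lam eta eps L l.
Hypothesis eps_le0 : forall i : int, i <= 0 -> eps i = 0.
Context (mu : probability shift_space R).
Let q (i : int) := coord_law lam (eps i).
Hypothesis hmu : is_product_measure q mu.
Local Notation X := shift_space.

Let q_gt0 i b : 0 < q i b. Proof. exact: coord_law_gt0. Qed.
Let q_ge0 i b : 0 <= q i b. Proof. exact: ltW. Qed.
Let q_sum i : q i true + q i false = 1. Proof. exact: coord_law_sum. Qed.

Local Notation m := (mu \x inv_leb (R := R))%E.
Local Notation nu := (@inv_leb R).

Context (E : set (X * R)) (mE : measurable E).
Hypothesis E_flip : forall k, m (E `&` flip_ext eps k @^-1` (~` E)) = 0%E.
Hypothesis EC_flip : forall k, m (~` E `&` flip_ext eps k @^-1` E) = 0%E.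

(** The value [b] has positive probability, and [q k b] times the mass of the preimage is at most
    the mass of [N]. *)
Lemma null_upd k b N : measurable N -> mu N = 0%E -> mu (upd k b @^-1` N) = 0%E.
Proof.
move=> mN N0; have mN' := preimage_measurable (measurable_upd k b) mN.
rewrite -(Ex_indic mu mN'); congr (_%:E).
have hN : bmeas (\1_N : X -> R) by exact: bmeas_indic.
have E0 : Ex mu (\1_N : X -> R) = 0 by apply: EFin_inj; rewrite Ex_indic.
apply/eqP; rewrite eq_le Ex_ge0 ?andbT; last by move=> x; rewrite indicE.
rewrite -(ler_pM2l (q_gt0 k b)) mulr0 -E0 [leRHS](Ex_avg q_ge0 q_sum hmu k hN).
rewrite -ExZ; last exact: bmeas_indic.
apply: Ex_le; [exact/bmeasZ/bmeas_indic|exact: bmeas_avg|] => x.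
have -> : (\1_(upd k b @^-1` N) x : R) = \1_N (upd k b x).
  by rewrite !indicE; congr (nat_of_bool _)%:R; apply/idP/idP; rewrite !inE.
by rewrite /avg; case: b {mN'}; rewrite ?lerDl ?lerDr mulr_ge0// indicE.
Qed.

(** At a point whose coordinate [k] is false, the hypotheses on [E] and on its complement are the
    two inclusions, up to null sets, between these fibers. *)
Lemma fiber_dilation k : exists N, [/\ measurable N, mu N = 0%E & forall x, ~ N x ->
  let B0 := xsection E (upd k false x) in
  let B1 := *%R (expR (eps k)) @^-1` xsection E (upd k true x) in
  nu (B0 `\` B1) = 0%E /\ nu (B1 `\` B0) = 0%E].
Proof.
have mf := measurable_flip_ext eps k; have mEC := measurableC mE.
have [N1 [mN1 N10 h1]] : exists N, [/\ measurable N, mu N = 0%E & forall x, ~ N x ->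
    nu (xsection (E `&` flip_ext eps k @^-1` (~` E)) x) = 0%E].
  by apply: null_sections => //; apply: measurableI => //; exact: preimage_measurable.
have [N2 [mN2 N20 h2]] : exists N, [/\ measurable N, mu N = 0%E & forall x, ~ N x ->
    nu (xsection (~` E `&` flip_ext eps k @^-1` E) x) = 0%E].
  by apply: null_sections => //; apply: measurableI => //; exact: preimage_measurable.
exists (upd k false @^-1` (N1 `|` N2)); split.
- by apply: preimage_measurable; [exact: measurable_upd|exact: measurableU].
- apply: null_upd; first exact: measurableU.
  by rewrite measureU0.
move=> x nN; have hf t : flip_ext eps k (upd k false x, t) = (upd k true x, expR (eps k) * t).
  by rewrite /flip_ext /flip /= upd_same upd_upd.
split; [rewrite -(h1 (upd k false x))|rewrite -(h2 (upd k false x))].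
- congr (nu _); apply/seteqP; split => t; rewrite /xsection /= !inE /= hf; [|].
  + by move=> [h h']; split => // h''; apply: h'; rewrite inE.
  + by move=> [h h']; split => // h''; apply: h'; move: h''; rewrite inE.
- by move=> h; apply: nN; left.
- congr (nu _); apply/seteqP; split => t; rewrite /xsection /= !inE /= hf; [|].
  + by move=> [h h']; split => // h''; apply: h'; rewrite inE.
  + by move=> [h h']; split => // h''; apply: h'; move: h''; rewrite inE.
- by move=> h; apply: nN; right.
Qed.

Definition fiber_mass (b : R) (x : X) : R := ray_mass b (xsection E x).
Local Notation H := fiber_mass.

Lemma bmeas_fiber_mass b : 0 < b -> bmeas (H b).
Proof. exact: bmeas_ray_mass. Qed.

Let eps_ge0 k : 0 <= eps k. Proof. exact: (eps_ge0 heps eps_le0). Qed.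

Let c_ge1 k : 1 <= expR (eps k). Proof. by rewrite -expR0 ler_expR. Qed.

Lemma fiber_mass_flip k : exists N, [/\ measurable N, mu N = 0%E & forall x, ~ N x ->
  forall b, 0 < b -> H b (upd k false x) =
    expR (eps k) * H (expR (eps k) * b) (upd k true x)].
Proof.
have [N [mN N0 h]] := fiber_dilation k; exists N; split => // x /h/= [h1 h2] b b0.
have mB1 := measurable_xsection (upd k true x) mE.
rewrite /H (ray_mass_null b _ _ h1 h2); first exact: (ray_mass_dilation mB1 (c_ge1 k)).
- exact: measurable_xsection.
- by apply: preimage_measurable mB1; exact: mulrl_measurable.
Qed.

Definition jump k : R := expR (eps k) - 1.
Local Notation a := jump.

Lemma jump_ge k : eps k <= a k.
Proof. by rewrite lerBrDl expR_ge1Dx. Qed.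

Lemma jump_ge0 k : 0 <= a k. Proof. exact: le_trans (jump_ge k). Qed.

Section two_levels.
Context (b1 b2 : R) (b20 : 0 < b2) (b21 : b2 <= b1).

Let b10 : 0 < b1. Proof. exact: lt_le_trans b21. Qed.

(** Changing the coordinate [k] from true to false changes [G] by a_k [Psi], up to a_k^2. The aim is
    that [Psi] has zero mean against every weight. *)
Let G (x : X) : R := trapezoid_mass b1 b2 (xsection E x).
Let Psi (x : X) : R := b1 * H b1 x - b2 * H b2 x.
Let K : R := (b1 - b2) / b2.

Let hG : bmeas G. Proof. exact: bmeas_trapezoid_mass. Qed.
Let hPsi : bmeas Psi. Proof. by apply: bmeasB; apply: bmeasZ; exact: bmeas_fiber_mass. Qed.

Lemma fiber_response k : exists N, [/\ measurable N, mu N = 0%E & forall x, ~ N x ->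
  `|G (upd k false x) - G (upd k true x) - a k * Psi (upd k true x)| <= a k ^+ 2 /\
  `|Psi (upd k false x) - Psi (upd k true x)| <= 2 * a k].
Proof.
have [N [mN N0 h]] := fiber_dilation k; exists N; split => // x /h/= [h1 h2].
have mB0 := measurable_xsection (upd k false x) mE.
have mB1 := measurable_xsection (upd k true x) mE.
have mB' : measurable ( *%R (expR (eps k)) @^-1` xsection E (upd k true x)).
  by apply: preimage_measurable mB1; exact: mulrl_measurable.
split.
  rewrite /G (trapezoid_mass_null b21 mB0 mB' h1 h2).
  exact: (trapezoid_mass_dilation mB1 (c_ge1 k)).
rewrite /Psi /H !(ray_mass_null _ mB0 mB' h1 h2).
set r := b1 * _; set s := b2 * _; set r' := b1 * _; set s' := b2 * _.
have -> : r - s - (r' - s') = (r - r') - (s - s') by ring.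
apply: (le_trans (ler_normB _ _)); rewrite mulr_natl mulr2n.
by apply: lerD; apply: (ray_mass_dilation_dist mB1 (c_ge1 k)).
Qed.

(* Multiplying by the centred variable [score k] turns an expectation into that of a
   difference across the k-th coordinate. *)
Definition score k (x : X) : R := if x k then (q k true)^-1 else - (q k false)^-1.
Local Notation xi := score.

Lemma bmeas_score k : bmeas (xi k).
Proof. exact: (bmeas_coord k (fun b => if b then (q k true)^-1 else - (q k false)^-1)). Qed.

Let bmeas_upd k b (u : X -> R) : bmeas u -> bmeas (fun x : X => u (upd k b x)).
Proof. exact: (bmeas_comp (measurable_upd k b)). Qed.

Lemma Ex_score k (u : X -> R) : bmeas u ->
  Ex mu (fun x => u x * xi k x) = Ex mu (fun x => u (upd k true x) - u (upd k false x)).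
Proof.
move=> hu; rewrite [LHS](Ex_avg q_ge0 q_sum hmu k); last first.
  by apply: bmeasM => //; exact: bmeas_score.
apply: eq_Ex => x; rewrite /avg /xi !upd_same; field.
by rewrite !gt_eqF.
Qed.

Section bounded_weight.
Context (w : X -> R) (hw : bmeas w) (w01 : forall x, 0 <= w x <= 1).

(** By [Ex_score] the covariance is the mean of w (G1 - G0) across the coordinate [k], whose
    first-order part is - a_k w Psi. *)
Lemma score_response k : indep [:: k] w ->
  `|Ex mu (fun x => w x * G x * xi k x) + a k * Ex mu (fun x => w x * Psi x)| <= 3 * a k ^+ 2.
Proof.
move=> iw; have wk b x : w (upd k b x) = w x by apply: iw; rewrite inE.
have hwG : bmeas (fun x => w x * G x) by exact: bmeasM.
have hwP : bmeas (fun x => w x * Psi x) by exact: bmeasM.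
rewrite Ex_score// [X in a k * X](Ex_avg q_ge0 q_sum hmu k hwP).
rewrite -ExZ; last exact: bmeas_avg.
rewrite -ExD; last 2 first.
- by apply: bmeasB; exact: (@bmeas_upd k _ (fun x => w x * G x)).
- exact/bmeasZ/bmeas_avg.
have [N [mN N0 hN]] := fiber_response k.
rewrite -[leRHS](Ex_cst mu); apply: (Ex_ae_norm _ _ mN N0).
- apply: bmeasD; last exact/bmeasZ/bmeas_avg.
  by apply: bmeasB; exact: (@bmeas_upd k _ (fun x => w x * G x)).
- exact: bmeas_cst.
move=> x /hN[h1 h2]; rewrite /avg !wk.
have := q_sum k; have := q_ge0 k true; have := q_ge0 k false; have := jump_ge0 k.
have /andP[w0 w1] := w01 x.
move: (G (upd k true x)) (G (upd k false x)) h1 => g1 g0 h1.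
move: (Psi (upd k true x)) (Psi (upd k false x)) h1 h2 => p1 p0 h1 h2.
move: (q k true) (q k false) (a k) (w x) w0 w1 h1 h2 => qt qf ak wx w0 w1 h1 h2 a0 qf0 qt0 qs.
exact: response_bound.
Qed.

(** The response in the coordinate [k] is proportional to a_k. With these coefficients the
    covariance and the variance both grow like the sum of the a_k^2, while the bound by
    Cauchy-Schwarz grows only like its square root. *)
Definition combined_score (s : seq int) (x : X) : R := \sum_(k <- s) a k * xi k x.
Local Notation Z := combined_score.

Lemma bmeas_combined_score s : bmeas (Z s).
Proof. by apply: bmeas_sum => k; apply: bmeasZ; exact: bmeas_score. Qed.

Lemma combined_score_response s (d : R) : (forall k, k \in s -> indep [:: k] w /\ a k <= d) ->
  let V := \sum_(k <- s) a k ^+ 2 in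
  `|Ex mu (fun x => w x * G x * Z s x) + Ex mu (fun x => w x * Psi x) * V| <= 3 * d * V.
Proof.
move=> hs; lazy zeta; set Lam := Ex mu (fun x => w x * Psi x).
have hwG : bmeas (fun x => w x * G x) by exact: bmeasM.
have hx k : bmeas (fun x => w x * G x * xi k x) by apply: bmeasM => //; exact: bmeas_score.
have -> : Ex mu (fun x => w x * G x * Z s x) =
    \sum_(k <- s) a k * Ex mu (fun x => w x * G x * xi k x).
  under [RHS]eq_bigr do rewrite -ExZ//.
  rewrite -Ex_sum; last by move=> k; exact: bmeasZ.
  by apply: eq_Ex => x; rewrite /Z mulr_sumr; apply: eq_bigr => k _; rewrite mulrCA.
rewrite !mulr_sumr -big_split/=; apply: (le_trans (ler_norm_sum _ _ _)).
rewrite !big_seq; apply: ler_sum => k ks; have [ik akd] := hs k ks.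
have := score_response ik; rewrite -/Lam => h.
have a0 := jump_ge0 k.
have -> : a k * Ex mu (fun x => w x * G x * xi k x) + Lam * a k ^+ 2 =
    a k * (Ex mu (fun x => w x * G x * xi k x) + a k * Lam) by ring.
rewrite normrM (ger0_norm a0); apply: (le_trans (ler_wpM2l a0 h)).
have -> : a k * (3 * a k ^+ 2) = 3 * a k * a k ^+ 2 by ring.
by rewrite ler_wpM2r ?sqr_ge0// ler_wpM2l.
Qed.

End bounded_weight.

Local Notation Z := combined_score.

(** Scores of different coordinates are centred and independent, so cross terms vanish; the variance
    of [score k] is the sum of the two inverse probabilities. *)
Lemma Ex_combined_score2 (C : R) s : (forall k, (q k true)^-1 + (q k false)^-1 <= C) -> uniq s ->
  Ex mu (fun x => Z s x ^+ 2) <= C * \sum_(k <- s) a k ^+ 2.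
Proof.
move=> hC; elim: s => [_|k s IH /= /andP[ks us]].
  rewrite big_nil mulr0 (_ : (fun x => _) = fun=> 0) ?Ex_cst//.
  by apply/funext => x; rewrite /Z big_nil expr2 mulr0.
have hxi := bmeas_score k; have hZ := bmeas_combined_score s.
have Zk b x : Z s (upd k b x) = Z s x.
  rewrite /Z !big_seq; apply: eq_bigr => i si; rewrite /xi upd_other//.
  by apply: contraNneq ks => <-.
have -> : Ex mu (fun x => Z (k :: s) x ^+ 2) =
    Ex mu (fun x => a k ^+ 2 * (xi k x * xi k x) + (2 * a k) * (Z s x * xi k x) + Z s x ^+ 2).
  by apply: eq_Ex => x; rewrite /Z big_cons; ring.
have h1 : bmeas (fun x => xi k x * xi k x) by exact: bmeasM.
have h2 : bmeas (fun x => Z s x * xi k x) by exact: bmeasM.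
have h3 : bmeas (fun x => Z s x ^+ 2) by exact: bmeasM.
have h12 : bmeas (fun x => a k ^+ 2 * (xi k x * xi k x) + 2 * a k * (Z s x * xi k x)).
  by apply: bmeasD; exact: bmeasZ.
rewrite (ExD _ h12 h3) (ExD _ (bmeasZ _ h1) (bmeasZ _ h2)) (ExZ _ _ h1) (ExZ _ _ h2).
rewrite (Ex_score k hZ) (Ex_score k hxi).
rewrite (_ : (fun x => Z s _ - _) = fun=> 0); last by apply/funext => x; rewrite !Zk subrr.
rewrite (_ : (fun x => xi k _ - _) = fun=> (q k true)^-1 + (q k false)^-1); last first.
  by apply/funext => x; rewrite /xi !upd_same opprK.
rewrite !Ex_cst mulr0 addr0 big_cons [leRHS]mulrDr lerD ?IH//.
by rewrite mulrC ler_wpM2r ?sqr_ge0.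
Qed.

Lemma Ex_cross (u v : X -> R) (Ku Cv t : R) : bmeas u -> bmeas v -> 0 < t ->
  Ex mu (fun x => u x ^+ 2) <= Ku -> Ex mu (fun x => v x ^+ 2) <= Cv ->
  2 * t * `|Ex mu (fun x => u x * v x)| <= t ^+ 2 * Ku + Cv.
Proof.
move=> hu hv t0 hK hC.
have huv : bmeas (fun x => u x * v x) by exact: bmeasM.
have hu2 : bmeas (fun x => u x ^+ 2) by exact: bmeasM.
have hv2 : bmeas (fun x => v x ^+ 2) by exact: bmeasM.
have main (e : R) : e ^+ 2 = 1 ->
    0 <= t ^+ 2 * Ku + (2 * t * e) * Ex mu (fun x => u x * v x) + Cv.
  move=> e2; apply: (@le_trans _ _ (Ex mu (fun x => (t * u x + e * v x) ^+ 2))).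
    by apply: Ex_ge0 => x; rewrite sqr_ge0.
  have -> : Ex mu (fun x => (t * u x + e * v x) ^+ 2) =
      Ex mu (fun x => t ^+ 2 * u x ^+ 2 + (2 * t * e) * (u x * v x) + v x ^+ 2).
    apply: eq_Ex => x; rewrite -[X in _ = _ + X]mul1r -[X in X * v x ^+ 2]e2; ring.
  have h12 : bmeas (fun x => t ^+ 2 * u x ^+ 2 + 2 * t * e * (u x * v x)).
    by apply: bmeasD; exact: bmeasZ.
  rewrite (ExD _ h12 hv2) (ExD _ (bmeasZ _ hu2) (bmeasZ _ huv)) (ExZ _ _ hu2) (ExZ _ _ huv).
  by rewrite lerD// lerD// ler_wpM2l ?sqr_ge0.
have := main 1; have := main (-1); rewrite sqrrN expr1n => /(_ erefl) h1 /(_ erefl) h2.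
move: (Ex mu _) h1 h2 => A h1 h2.
have -> : 2 * t * `|A| = `|2 * t * A| by rewrite normrM (@ger0_norm _ (2 * t))// mulr_ge0// ltW.
by rewrite ler_norml; apply/andP; split; lra.
Qed.

Lemma score_variance : exists C, forall k, (q k true)^-1 + (q k false)^-1 <= C.
Proof.
have [lam0 lam1] := andP hlam; have [M hM] := eps_range eta_cvg0 heps eps_le0.
exists (2 + lam^-1 + expR M) => k; have /andP[e0 eM] := hM k.
rewrite /q /coord_law; set e := expR (eps k); have e1 : 1 <= e := c_ge1 k.
have ep : 0 < e by exact: expR_gt0.
have eeM : e <= expR M by rewrite ler_expR.
have -> : (lam * e / (1 + lam * e))^-1 + (1 / (1 + lam * e))^-1 = 2 + (lam * e)^-1 + lam * e.
  by field; rewrite !gt_eqF// addr_gt0// mulr_gt0.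
have h1 : (lam * e)^-1 <= lam^-1 by rewrite lef_pV2 ?posrE ?mulr_gt0// ler_peMr// ltW.
have h2 : lam * e <= e by rewrite ler_piMl// ltW.
by rewrite lerD// ?lerD// (le_trans h2).
Qed.

(* The combined score has variance O(V), while its covariance with [w * G] is close to
   - V times the expectation of [w * Psi]; and V is as large as we please. *)
Lemma level_independence (w : X -> R) : bmeas w -> (forall x, 0 <= w x <= 1) ->
  (exists n : nat, forall k : int, n%:Z < k -> indep [:: k] w) ->
  Ex mu (fun x => w x * Psi x) = 0.
Proof.
move=> hw w01 [n hn]; have [C hC] := score_variance.
have C0 : 0 <= C by apply: le_trans (hC 0); rewrite addr_ge0// invr_ge0.
apply: (energy_limit (sqr_ge0 K) C0) => d e V1 d0 e0.
(* For eps_k at most ln (1 + d) the jump e^(eps_k) - 1 is at most [d]. *)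
have [N hN] : exists N : nat, forall j : nat, (N <= j)%N -> eps j%:Z <= ln (1 + d).
  by apply: (eps_small eta_cvg0 heps eps_le0); rewrite ln_gt0// ltrDl.
(* Beyond [n] the weight ignores the coordinates, beyond [N] the jumps are small; |V1| + 1 makes [V]
   positive as well as at least [V1]. *)
have [s [us sgt hV]] := energy heps (maxn n N) (`|V1| + 1).
pose V := \sum_(k <- s) a k ^+ 2.
have VV : `|V1| + 1 <= V.
  by apply: (le_trans hV); apply: ler_sum => k _; rewrite lerXn2r ?nnegrE ?jump_ge0// jump_ge.
have V0 : 0 < V by apply: lt_le_trans VV; rewrite ltr_wpDl.
have hs k : k \in s -> indep [:: k] w /\ a k <= d.
  move=> /sgt /maxn_lt_int[nk [j kj Nj]]; split; first exact: hn.
  have : eps k <= ln (1 + d) by rewrite kj; exact: hN.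
  by rewrite -ler_expR lnK ?posrE ?addr_gt0// lerBlDl.
exists V; split => //.
  by apply: le_trans VV; rewrite (le_trans (ler_norm V1))// lerDl.
have h1 := combined_score_response hw w01 hs.
have hwG : bmeas (fun x => w x * G x) by exact: bmeasM.
have hG2 : Ex mu (fun x => (w x * G x) ^+ 2) <= K ^+ 2.
  rewrite -[leRHS](Ex_cst mu); apply: Ex_le; [exact: bmeasM|exact: bmeas_cst|] => x.
  have /andP[w0 w1] := w01 x.
  have /andP[g0 g1] := trapezoid_mass_range b20 b21 (measurable_xsection x mE).
  have wg0 : 0 <= w x * G x by exact: mulr_ge0.
  have wgK : w x * G x <= K by apply: le_trans g1; rewrite ler_piMl.
  by rewrite lerXn2r ?nnegrE// (le_trans wg0).
have eV0 : 0 < e * V by rewrite mulr_gt0.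
have h2 := Ex_cross hwG (bmeas_combined_score s) eV0 hG2 (Ex_combined_score2 hC us).
exact: energy_optimum V0 e0 h1 h2.
Qed.

End two_levels.

Definition weight (w : X -> R) := [/\ bmeas w, forall x, 0 <= w x <= 1 &
  exists n : nat, forall k : int, n%:Z < k -> indep [:: k] w].

Lemma scaled_fiber_mass w b : weight w -> 0 < b ->
  b * Ex mu (fun x => w x * H b x) = Ex mu (fun x => w x * H 1 x).
Proof.
move=> [hw w01 wn] b0.
have hwH c : 0 < c -> bmeas (fun x => w x * H c x).
  by move=> c0; apply: bmeasM => //; exact: bmeas_fiber_mass.
have main (b1 b2 : R) : 0 < b2 -> b2 <= b1 ->
    b1 * Ex mu (fun x => w x * H b1 x) = b2 * Ex mu (fun x => w x * H b2 x).
  move=> b20 b21; have b10 := lt_le_trans b20 b21.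
  have h := level_independence b20 b21 hw w01 wn.
  apply/eqP; rewrite -subr_eq0 -!ExZ; [|exact: hwH|exact: hwH].
  rewrite -ExB; [|exact/bmeasZ/hwH|exact/bmeasZ/hwH].
  by apply/eqP; rewrite -[RHS]h; apply: eq_Ex => x; ring.
have [b1|b1] := leP b 1; last by rewrite (main b 1) ?mul1r// ltW.
by rewrite -(main 1 b)// mul1r.
Qed.

Definition coord_eq k b (x : X) : R := (x k == b)%:R.

Lemma bmeas_coord_eq k b : bmeas (coord_eq k b).
Proof. exact: (bmeas_coord k (fun c => (c == b)%:R)). Qed.

Lemma weight_coord_eq k b w : weight w -> weight (fun x => coord_eq k b x * w x).
Proof.
move=> [hw w01 [n wn]]; split.
- by apply: bmeasM => //; exact: bmeas_coord_eq.
- move=> x; have /andP[w0 w1] := w01 x.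
  by rewrite /coord_eq; case: eqVneq => _; rewrite ?mul1r ?mul0r ?w0 ?w1 ?lexx ?ler01.
- exists (maxn n (absz k)) => j nj i c x; rewrite inE => /eqP ->{i}.
  rewrite /coord_eq upd_other; last by apply/eqP; lia.
  by congr (_ * _); apply: (wn j); [lia|rewrite inE].
Qed.

(** By the flip, the part with x k = false at level 1 is a multiple of the part with x k = true at
    level e^(eps_k), and [scaled_fiber_mass] brings the latter back to level 1. So the two parts are
    in the ratio of [q k false] to [q k true]. *)
Lemma fiber_mass_coord k b w : weight w -> indep [:: k] w ->
  Ex mu (fun x => coord_eq k b x * w x * H 1 x) = q k b * Ex mu (fun x => w x * H 1 x).
Proof.
move=> hw iw; have [mw w01 wn] := hw.
have wk c x : w (upd k c x) = w x by apply: iw; rewrite inE.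
have hH c : 0 < c -> bmeas (H c) by move=> c0; exact: bmeas_fiber_mass.
set c := expR (eps k); have c0 : 0 < c by exact: expR_gt0.
have hwe d b' : 0 < d -> bmeas (fun x => coord_eq k b' x * w x * H d x).
  by move=> d0; apply: bmeasM; [apply: bmeasM => //; exact: bmeas_coord_eq|exact: hH].
have hu d b' : 0 < d -> bmeas (fun x => w x * H d (upd k b' x)).
  by move=> d0; apply: bmeasM => //; exact: (bmeas_comp (measurable_upd k b') (hH d d0)).
have e0 : Ex mu (fun x => coord_eq k false x * w x * H 1 x) =
    q k false * (c * Ex mu (fun x => w x * H c (upd k true x))).
  rewrite [LHS](Ex_avg q_ge0 q_sum hmu k (hwe _ _ ltr01)).
  have [N [mN N0 hN]] := fiber_mass_flip k.
  rewrite -!ExZ; [|exact/bmeasZ/hu|exact: hu].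
  apply: (Ex_ae_eq _ _ mN N0); [exact/bmeas_avg/hwe|exact/bmeasZ/bmeasZ/hu|].
  move=> x /hN/(_ 1 ltr01); rewrite -/c mulr1 => h.
  by rewrite /avg /coord_eq !upd_same !wk h /=; ring.
have e1 : Ex mu (fun x => coord_eq k true x * w x * H c x) =
    q k true * Ex mu (fun x => w x * H c (upd k true x)).
  rewrite [LHS](Ex_avg q_ge0 q_sum hmu k (hwe _ _ c0)) -ExZ; last exact: hu.
  by apply: eq_Ex => x; rewrite /avg /coord_eq !upd_same !wk /=; ring.
have e2 := scaled_fiber_mass (weight_coord_eq k true hw) c0.
have e3 : Ex mu (fun x => w x * H 1 x) = Ex mu (fun x => coord_eq k true x * w x * H 1 x) +
    Ex mu (fun x => coord_eq k false x * w x * H 1 x).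
  rewrite -ExD; [|exact: hwe|exact: hwe].
  by apply: eq_Ex => x; rewrite /coord_eq; case: (x k) => /=; ring.
rewrite {}e1 in e2; have [h1 h0] := coord_split e0 e2 e3 (q_sum k).
by case: b.
Qed.

Definition cylinder_weight (s : seq int) (a : int -> bool) (x : X) : R :=
  \prod_(k <- s) coord_eq k (a k) x.

Lemma weight_cylinder s a : weight (cylinder_weight s a).
Proof.
elim: s => [|k s IH].
  have -> : cylinder_weight [::] a = fun=> 1.
    by apply/funext => x; rewrite /cylinder_weight big_nil.
  by split; [exact: bmeas_cst|move=> x; rewrite lexx ler01|exists 0%N].
have := weight_coord_eq k (a k) IH; congr weight.
by apply/funext => x; rewrite /cylinder_weight big_cons.
Qed.

Let gam := Ex mu (H 1).

Lemma fiber_mass_cylinder s a : uniq s ->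
  Ex mu (fun x => cylinder_weight s a x * H 1 x) = (\prod_(k <- s) q k (a k)) * gam.
Proof.
elim: s => [_|k s IH /= /andP[ks us]].
  rewrite big_nil mul1r; apply: eq_Ex => x.
  by rewrite /cylinder_weight big_nil mul1r.
rewrite big_cons -mulrA -IH// -fiber_mass_coord; last 2 first.
- exact: weight_cylinder.
- move=> i c x; rewrite inE => /eqP ->{i}; rewrite /cylinder_weight !big_seq.
  apply: eq_bigr => i si; rewrite /coord_eq upd_other//.
  by apply: contraNneq ks => <-.
by apply: eq_Ex => x; rewrite /cylinder_weight big_cons.
Qed.

Lemma cylinder_weightE (F : {fset int}) a x : cylinder_weight F a x = \1_(cylinder F a) x.
Proof.
rewrite indicE; have [xF|nxF] := pselect (cylinder F a x).
  rewrite mem_set// /cylinder_weight big_seq big1// => k kF.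
  by rewrite /coord_eq xF// eqxx.
rewrite memNset//; have [k /not_implyP[kF xk]] : exists k, ~ (k \in F -> x k = a k).
  by apply/existsNP.
apply/eqP; rewrite /cylinder_weight prodf_seq_eq0; apply/hasP; exists k => //=.
by rewrite /coord_eq (introF eqP xk).
Qed.

Lemma product_on_cylinder_rays F a b : 0 < b ->
  m (E `&` (cylinder F a `*` `]b, +oo[)) = (gam%:E * m (cylinder F a `*` `]b, +oo[))%E.
Proof.
move=> b0; have mC : measurable (cylinder F a : set X) by exact: measurable_cylinder.
rewrite (measure_ray_set mu b0 mC) hmu maharam_measureE.
have hH := bmeas_fiber_mass b0.
have hC : bmeas (\1_(cylinder F a) : X -> R) by exact: bmeas_indic.
transitivity (\int[mu]_x ((\1_(cylinder F a) x * H b x)%R)%:E)%E.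
  apply: eq_integral => x _; rewrite indicE; have [xC|nxC] := pselect (cylinder F a x).
    rewrite mem_set// mul1r -ray_massE//; last exact: measurable_xsection.
    by congr (nu _); apply/seteqP; split => t; rewrite /xsection /= !inE/=; [case=> ? []|case].
  rewrite memNset// mul0r -[RHS](measure0 nu); congr (nu _).
  by apply/seteqP; split => t; rewrite /xsection /= !inE//= => -[_ []].
rewrite -EFin_Ex; last exact: bmeasM.
have h1 := scaled_fiber_mass (weight_cylinder F a) b0.
rewrite fiber_mass_cylinder ?fset_uniq// in h1.
rewrite -!EFinM; congr (_%:E); apply: (mulfI (lt0r_neq0 b0)).
under eq_Ex do rewrite -cylinder_weightE.
by rewrite h1; field; rewrite gt_eqF.
Qed.

Let gam_ge0 : 0 <= gam. Proof. by apply: Ex_ge0 => x; exact: ray_mass_ge0. Qed.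

(** Two measures that agree on a pi-system. Restricting both to [ray_set b] makes them finite and
    turns a ray from any level b' into one from the positive level max(b, b'). *)
Lemma product_on_ray_sets b A : 0 < b -> measurable A ->
  m (E `&` ray_set b `&` A) = (gam%:E * m (ray_set b `&` A))%E.
Proof.
move=> b0 mA; have mR := measurable_ray_set (R := R) b.
have mER : measurable (E `&` ray_set b) by exact: measurableI.
pose m1 : {measure set (X * R) -> \bar R} := mrestr m mER.
pose m2 : {measure set (X * R) -> \bar R} := mscale (NngNum gam_ge0) (mrestr m mR).
rewrite setIC [_ `&` A]setIC -[LHS]/(m1 A) -[RHS]/(m2 A).
apply: (measure_unique (cylinder_rays (R := R)) (fun k => setT `*` `](- k%:R), +oo[)) => //.
- exact: cylinder_rays_gen.
- exact: cylinder_rays_setI.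
- by move=> k; right; exists fset0, (fun=> true), (- k%:R); rewrite cylinder_fset0.
- exact: rays_cover.
- move=> _ [->|[F [a [b' ->]]]]; first by rewrite !measure0.
  have mb0 : 0 < Num.max b b' by rewrite lt_max b0.
  have RE : (cylinder F a `*` `]b', +oo[) `&` ray_set b = cylinder F a `*` `](Num.max b b'), +oo[.
    apply/seteqP; split => [[x t] [[Fx b't] /ray_setP bt]|[x t] [Fx]].
      by split => //=; move: b't bt; rewrite /= !in_itv/= !andbT gt_max => -> ->.
    rewrite /= in_itv/= andbT gt_max => /andP[bt b't]; split; last exact/ray_setP.
    by split => //=; rewrite in_itv/= b't.
  rewrite -[LHS]/(m _) -[RHS]/(gam%:E * m _)%E RE -product_on_cylinder_rays// -RE.
  by congr (m _); rewrite setIA [in RHS]setIA [E `&` _]setIC setIA.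
- move=> k; pose D : set (X * R) := setT `*` `](- k%:R), +oo[.
  have mD : measurable (D `&` (E `&` ray_set b)) by apply: measurableI => //; exact: measurableX.
  have sub : D `&` (E `&` ray_set b) `<=` ray_set b by move=> z [_ []].
  have := le_measure m (mem_set mD) (mem_set mR) sub; move/le_lt_trans; apply.
  by rewrite [ltLHS](measure_ray_setT mu b0) ltry.
Qed.

Lemma flip_invariant_trivial : m E = 0%E \/ m (~` E) = 0%E.
Proof.
have mEC := measurableC mE.
have [g1|g1] := eqVneq gam 1; [right|left]; apply: null_on_ray_sets => // b b0.
  have := product_on_ray_sets b0 mEC; rewrite g1 mul1e setIAC setICr set0I measure0 setIC.
  by [].
have mER : measurable (E `&` ray_set b) by apply: measurableI => //; exact: measurable_ray_set.
have fin : m (E `&` ray_set b) \is a fin_num.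
  rewrite ge0_fin_numE//.
  have mR := measurable_ray_set (R := R) b.
  have := le_measure m (mem_set mER) (mem_set mR) (@subIsetr _ _ _); move/le_lt_trans; apply.
  by rewrite [ltLHS](measure_ray_setT mu b0) ltry.
have := product_on_ray_sets b0 mE; rewrite setIAC setIid [ray_set b `&` E]setIC.
rewrite -(fineK fin) -EFinM => -[h]; congr (_%:E).
have : (1 - gam) * fine (m (E `&` ray_set b)) = 0 by rewrite mulrBl mul1r -h subrr.
by move/eqP; rewrite mulf_eq0 subr_eq0 eq_sym (negPf g1)/= => /eqP.
Qed.

End fiber_energy.

Theorem theorem4p2 (R : realType) (lam : R) (hlam : 0 < lam < 1)
    (eta : nat -> R)
    (eta_gt0 : forall n : nat, (0 < n)%N -> 0 < eta n)
    (eta_cvg0 : eta n @[n --> \oo] --> 0)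
    (eta_l2 : cvgn (series (fun n : nat => eta n ^+ 2)))
    (eps : int -> R) (L l : nat -> nat)
    (heps : inductive_procedure lam eta eps L l)
    (eps_le0 : forall i : int, i <= 0 -> eps i = 0)
    (mu : probability shift_space R)
    (hmu : is_product_measure (fun i : int => coord_law lam (eps i)) mu) :
  [/\ nonsingular mu bshift, conservative mu bshift & type_III1 mu bshift].
Proof.
have [f hf] : exists f, RN_version mu bshift f.
  apply: (RN_version_exists (measurable_shiftn (- 1)) (shiftnK 1) (shiftnVK 1)).
    exact: (shift_dominates hlam eta_gt0 eta_cvg0 eta_l2 heps eps_le0 hmu).
  exact: (shift_dominates' hlam eta_gt0 eta_cvg0 eta_l2 heps eps_le0 hmu).
split.
- exact: (shift_nonsingular hlam eta_gt0 eta_cvg0 eta_l2 heps eps_le0 hmu).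
- exact: (shift_conservative hlam eta_gt0 eta_cvg0 eta_l2 heps eps_le0 hmu hf).
exists f; split=> // E mE SE; have mEC := measurableC mE.
have SEC : maharam bshift f @^-1` (~` E) = ~` E by rewrite preimage_setC; congr (~` _).
(* Applied to [E] and to its complement, which is invariant as well: the two inclusions behind
   [fiber_dilation]. *)
have inv A := @flip_invariant _ _ hlam _ eta_gt0 eta_cvg0 eta_l2 _ _ _ heps eps_le0 _ hmu _ hf A.
have EC_flip := inv _ mEC SEC; rewrite setCK in EC_flip.
have [h|h] := flip_invariant_trivial hlam eta_cvg0 heps eps_le0 hmu mE (inv _ mE SE) EC_flip.
  by left; exact: maharam_null_lebesgue.
by right; exact: maharam_null_lebesgue.
Qed.
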